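(* Suppose that the marginal density $f_X$ of $X$ is bounded, that the class $\mathcal{F}$ satisfies (F.i)–(F.iii), that the kernel $K$ satisfies (K.i) and (K.ii) (all stated in the context), and that $\mathcal{F}$ is bounded in the sense that for some $0<M<\infty$ its envelope function $F$ satisfies $F(\mathbf{y})\le M$ for all $\mathbf{y}\in\mathbb{R}^m$. Then for all $c>0$ and $0<b_0<1$ there exists a constant $0<C<\infty$ such that, with $a_n=c(\log n/n)^{1/m}$, $$\limsup_{n\to\infty}\ \sup_{a_n\le h\le b_0}\ \sup_{g\in\mathcal{F}}\ \sup_{\mathbf{t}\in\mathbb{R}^m}\frac{\sqrt{nh^m}\,|U_n(g,h,\mathbf{t})-\mathbb{E}U_n(g,h,\mathbf{t})|}{\sqrt{|\log h|\vee\log\log n}}\le C\quad\text{almost surely.}$$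
   Context: Fix an integer $m\ge 1$. Let $(X,Y),(X_1,Y_1),(X_2,Y_2),\ldots$ be i.i.d. random vectors in $\mathbb{R}\times\mathbb{R}$ with joint density $f:\mathbb{R}\times\mathbb{R}\to[0,\infty)$, and let $f_X$ be the marginal density of $X$. Here $a\vee b=\max(a,b)$. VC-type: a class $\mathcal{H}$ of measurable functions on $\mathbb{R}^d$ with measurable envelope $H$ (i.e. $H\ge\sup_{g\in\mathcal{H}}|g|$ pointwise) is of VC-type if for some $A\ge 3$, $v\ge 1$, one has $\mathcal{N}(\mathcal{H},L_2(Q),\varepsilon)\le (A\|H\|_{L_2(Q)}/\varepsilon)^v$ for all $0<\varepsilon\le 2\|H\|_{L_2(Q)}$ and every probability measure $Q$ on $\mathbb{R}^d$ with $\|H\|_{L_2(Q)}<\infty$, where $\mathcal{N}(\mathcal{H},L_2(Q),\varepsilon)$ is the smallest number of open $L_2(Q)$-balls of radius $\varepsilon$ needed to cover $\mathcal{H}$. Pointwise measurable: a class $\mathcal{H}$ is pointwise measurable if it has a countable subclass $\mathcal{H}_0$ such that every $g\in\mathcal{H}$ is the pointwise limit of a sequence in $\mathcal{H}_0$. Assumptions on $\mathcal{F}$: $\mathcal{F}$ is a class of measurable functions $g:\mathbb{R}^m\to\mathbb{R}$ with $\mathbb{E}g^2(Y_1,\ldots,Y_m)<\infty$ such that (F.i) $\mathcal{F}$ is pointwise measurable; (F.ii) $\mathcal{F}$ has a measurable envelope function $F$, $F(\mathbf{y})\ge\sup_{g\in\mathcal{F}}|g(\mathbf{y})|$ for $\mathbf{y}\in\mathbb{R}^m$;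 (F.iii) $\mathcal{F}$ is of VC-type with envelope $F$. Assumptions on $K$: $K:\mathbb{R}\to\mathbb{R}$ is a kernel function with support contained in $[-1/2,1/2]$ such that (K.i) $\sup_{x}|K(x)|=:\kappa<\infty$ and $\int K(x)\,dx=1$; (K.ii) the class $\mathcal{K}=\{hK_h(t-\cdot):h>0,t\in\mathbb{R}\}$, where $K_h(z)=h^{-1}K(z/h)$, is pointwise measurable and of VC-type (with envelope the constant $\kappa$). Product kernel: $\widetilde{K}(\mathbf{t})=\prod_{j=1}^m K(t_j)$ and $\widetilde{K}_h(\mathbf{t})=h^{-m}\widetilde{K}(\mathbf{t}/h)$ for $\mathbf{t}\in\mathbb{R}^m$. $U$-statistic: for $n\ge m$ let $I_n^m=\{(i_1,\ldots,i_m):1\le i_j\le n,\ i_j\ne i_l\text{ if }j\ne l\}$. For $\mathbf{i}\in I_n^m$ write $\mathbf{X}_{\mathbf{i}}=(X_{i_1},\ldots,X_{i_m})$, $\mathbf{Y}_{\mathbf{i}}=(Y_{i_1},\ldots,Y_{i_m})$. For $0<h<1$, $\mathbf{t}\in\mathbb{R}^m$ and $g\in\mathcal{F}$, $$U_n(g,h,\mathbf{t})=\frac{(n-m)!}{n!}\sum_{\mathbf{i}\in I_n^m}g(\mathbf{Y}_{\mathbf{i}})\widetilde{K}_h(\mathbf{t}-\mathbf{X}_{\mathbf{i}}).$$ *)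

(* Defs.v *)
From HB Require Import structures.
From mathcomp Require Import all_boot all_order all_algebra.
From mathcomp Require Import all_classical all_reals all_analysis.
Import Order.TTheory GRing.Theory Num.Theory.
Import numFieldNormedType.Exports.

Set Implicit Arguments.
Unset Strict Implicit.
Unset Printing Implicit Defensive.

Local Open Scope classical_set_scope.
Local Open Scope ring_scope.

Section FunctionClasses.
Context d (T : measurableType d) (R : realType).
Implicit Types (Fam : set (T -> R)) (G : T -> R) (Q : probability T R).

(* Centres range over all of L_2(Q), not only over Fam. *)
Definition covered_by Fam Q (eps : R) (k : nat) : Prop :=
  exists c : 'I_k -> T -> R,
    (forall i, c i \in Lfun Q 2%:E) /\
    (forall g, Fam g ->
       exists i, ('N[Q]_2%:E [EFin \o (fun x => g x - c i x)%R] < eps%:E)%E).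

(* Equal to +oo when there is no finite cover. *)
Definition covering_number Fam Q (eps : R) : \bar R :=
  ereal_inf [set k%:R%:E | k in [set k : nat | covered_by Fam Q eps k]].

Definition is_envelope Fam G : Prop :=
  measurable_fun [set: T] G /\ forall g, Fam g -> forall x, `|g x| <= G x.

Definition vc_type Fam G : Prop :=
  [/\ forall g, Fam g -> measurable_fun [set: T] g,
      is_envelope Fam G &
      exists A v : R, [/\ 3 <= A, 1 <= v &
        forall Q : probability T R,
          ('N[Q]_2%:E [EFin \o G] < +oo)%E ->
          forall eps : R, 0 < eps ->
            (eps%:E <= 2%:E * 'N[Q]_2%:E [EFin \o G])%E ->
            (covering_number Fam Q eps <=
              ((A * fine 'N[Q]_2%:E [EFin \o G] / eps) `^ v)%:E)%E]].

Definition pointwise_measurable Fam : Prop :=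
  exists Fam0 : set (T -> R), [/\ Fam0 `<=` Fam, countable Fam0 &
    forall g, Fam g -> exists u : nat -> T -> R,
      (forall k, Fam0 (u k)) /\ (forall x, u k x @[k --> \oo] --> g x)].

End FunctionClasses.

Definition mutually_independent d d' (T : measurableType d)
    (T' : measurableType d') (R : realType) (P : probability T R)
    (Z : nat -> T -> T') : Prop :=
  forall (J : seq nat) (A : nat -> set T'), uniq J ->
    (forall i, i \in J -> measurable (A i)) ->
    P (\bigcap_(i in [set` J]) (Z i @^-1` A i)) =
    (\prod_(i <- J) P (Z i @^-1` A i))%E.

Section Densities.
Context d (T : measurableType d) (R : realType) (P : probability T R).

Definition has_joint_density (X Y : T -> R) (f : R * R -> R) : Prop :=
  [/\ measurable_fun [set: R * R] f, forall z, 0 <= f z &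
      forall A : set (R * R), measurable A ->
        P ((fun w => (X w, Y w)) @^-1` A) =
        (\int[lebesgue_measure \x lebesgue_measure]_(z in A) (f z)%:E)%E].

Definition marginal_density (f : R * R -> R) (x : R) : \bar R :=
  (\int[lebesgue_measure]_y (f (x, y))%:E)%E.

(* The sample is indexed from 0: X i, Y i stand for X_(i+1), Y_(i+1). *)
Definition iid_with_density (X Y : nat -> T -> R) (f : R * R -> R) : Prop :=
  mutually_independent P (fun i w => (X i w, Y i w)) /\
  forall i, has_joint_density (X i) (Y i) f.

End Densities.

Section Kernels.
Context (R : realType).
Implicit Types (K : R -> R) (h : R).

Definition kernel_sup K : R := sup [set `|K x| | x in [set: R]].

Definition scaled_kernel K h (z : R) : R := h^-1 * K (z / h).

Definition kernel_class K : set (R -> R) :=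
  [set k | exists h t : R, 0 < h /\ k = fun x => h * scaled_kernel K h (t - x)].

Definition prod_kernel m K (t : m.-tuple R) : R := \prod_(j < m) K (tnth t j).

Definition scaled_prod_kernel m K h (t : m.-tuple R) : R :=
  h ^- m * prod_kernel K [tuple tnth t j / h | j < m].

End Kernels.

(* I_n^m is the set of injective maps from 'I_m to 'I_n; when n < m it is empty
   and the statistic is 0. *)
Definition ustat (T : Type) (R : realType) (m : nat) (K : R -> R)
    (X Y : nat -> T -> R) (n : nat) (g : m.-tuple R -> R) (h : R)
    (t : m.-tuple R) (w : T) : R :=
  (n - m)`!%:R / n`!%:R *
  \sum_(i : {ffun 'I_m -> 'I_n} | injectiveb i)
    g [tuple Y (i j) w | j < m] *
    scaled_prod_kernel K h [tuple tnth t j - X (i j) w | j < m].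

(* Equal to -oo when a_n > b0 or Fam is empty. *)
Definition normalized_sup d (T : measurableType d) (R : realType)
    (P : probability T R) (m : nat) (K : R -> R) (X Y : nat -> T -> R)
    (Fam : set (m.-tuple R -> R)) (a b0 : R) (n : nat) (w : T) : \bar R :=
  ereal_sup [set
    ereal_sup [set
      ereal_sup [set
        (Num.sqrt (n%:R * h ^+ m) *
         `|ustat K X Y n g h t w - fine 'E_P[ustat K X Y n g h t]| /
         Num.sqrt (Num.max `|ln h| (ln (ln n%:R))))%:E
      | t in [set: m.-tuple R]]
    | g in Fam]
  | h in `[a, b0]].

Definition bandwidth_lower (R : realType) (m : nat) (c : R) (n : nat) : R :=
  c * (ln n%:R / n%:R) `^ (m%:R^-1).

(* Main.v *)
Require Import Defs.
From HB Require Import structures.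
From mathcomp Require Import all_boot all_order all_algebra.
From mathcomp Require Import perm.
From mathcomp Require Import all_classical all_reals all_analysis.
From mathcomp Require Import measurable_realfun.
From mathcomp Require Import ring lra zify.
Import Order.TTheory GRing.Theory Num.Theory.
Import numFieldNormedType.Exports.

Set Implicit Arguments.
Unset Strict Implicit.
Unset Printing Implicit Defensive.

Local Open Scope classical_set_scope.
Local Open Scope ring_scope.

(** The problem is reduced to an empirical process of independent terms, for which
    moments of growing order are estimated.

    By Hoeffding's representation ([hoeffding_average]) a U-statistic is an
    average, over permutations of the sample, of means of r = n %/ m independent
    summands, each of them a function of m sample points.  The normalization
    sqrt(n h^m) is exactly that of such a mean: a summand divided by its bound is
    at most 1 and, as the marginal density is bounded, has second moment of order
    h^m ([unit_summand_variance]).  So the full decomposition of the U-statistic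
    into degenerate parts can be avoided.

    Fix a dyadic scale h ~ 2^-j and a block of sample sizes n ~ 2^k.  For the
    supremum W of the centred sum of r independent summands over the class,
    symmetrization with a ghost sample and chaining in moments of order 2q give
    E W^(2q) <= (C q r h^m)^q ([empirical_moment]).  The covering numbers are
    polynomial, so q need only be of order j; the random radius of the class, the
    maximal sum of squares, is bounded by running the same argument for the
    squares.  Supremum over the block costs nothing: the supremum of a centred
    U-statistic over a class is a reverse submartingale, and an elementary version
    of Doob's inequality using exchangeability gives
    [ustat_sup_maximal_inequality].  Markov's inequality then bounds by 4^-q the
    probability that the deviation exceeds a level of order sqrt(q h^m / n).

    With q of order j + log k these probabilities are summable over both j and k,
    and q is at most of order |ln h| \/ ln ln n, which is the denominator in the
    statement; the Borel-Cantelli lemma concludes.  The constraint that q be at most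
    of order r h^m is where n h^m >= c^m ln n is used ([scale_valid]).

    Suprema over uncountable classes are reduced to countable ones by pointwise
    density ([class_tail]), and countable ones to finite ones by monotonicity, so
    that all estimates are made for finite families. *)

(** * Finite means, convexity and Rademacher sums *)

Ltac nonneg := repeat first [by [] | assumption | exact: sqr_ge0 |
  apply: mulr_ge0 | apply: exprn_ge0 | rewrite invr_ge0 | apply: addr_ge0 |
  exact: (le_trans ler01) ].

Section Mean.
Context {R : realType}.

Definition fmean (I : finType) (F : I -> R) : R := #|I|%:R^-1 * \sum_i F i.

Lemma le_fmean (I : finType) (F G : I -> R) :
  (forall i, F i <= G i) -> fmean F <= fmean G.
Proof.
by move=> FG; rewrite /fmean ler_wpM2l ?invr_ge0 ?ler0n// ler_sum.
Qed.

Lemma fmean_ge0 (I : finType) (F : I -> R) :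
  (forall i, 0 <= F i) -> 0 <= fmean F.
Proof. by move=> F0; rewrite /fmean mulr_ge0 ?invr_ge0 ?ler0n ?sumr_ge0. Qed.

Lemma fmeanD (I : finType) (F G : I -> R) :
  fmean (fun i => F i + G i) = fmean F + fmean G.
Proof. by rewrite /fmean big_split mulrDr. Qed.

Lemma fmeanZ (I : finType) c (F : I -> R) :
  fmean (fun i => c * F i) = c * fmean F.
Proof. by rewrite /fmean -mulr_sumr mulrCA. Qed.

Lemma fmean_cst (I : finType) c : (0 < #|I|)%N -> fmean (fun _ : I => c) = c.
Proof.
move=> I0; rewrite /fmean sumr_const -[c *+ _]mulr_natl mulKf//.
by rewrite pnatr_eq0 -lt0n.
Qed.

Lemma fmean_sum (I J : finType) (A : pred J) (F : J -> I -> R) :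
  fmean (fun i => \sum_(j | A j) F j i) = \sum_(j | A j) fmean (F j).
Proof. by rewrite /fmean exchange_big mulr_sumr. Qed.

Lemma exprD_le (x y : R) p : 0 <= x -> 0 <= y ->
  (x + y) ^+ p <= 2 ^+ p * (x ^+ p + y ^+ p).
Proof.
move=> x0 y0; wlog xy : x y x0 y0 / x <= y => [H|].
  have [/H->//|/ltW/H] := leP x y.
  by rewrite addrC [y ^+ p + _]addrC; exact.
have : (x + y) ^+ p <= (2 * y) ^+ p by rewrite lerXn2r ?nnegrE; lra.
rewrite exprMn => /le_trans; apply.
by rewrite ler_wpM2l ?exprn_ge0// lerDr exprn_ge0.
Qed.

(** A substitute for Minkowski's inequality: the weights 2^((l+1)p) cost the
    l-th term a factor 2^(l+1) after p-th roots, which geometric decay of the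
    terms absorbs.  It keeps chaining inside finite sums of p-th powers. *)
Lemma sum_expr_le (n p : nat) (y : nat -> R) : (forall l, 0 <= y l) ->
  (0 < p)%N ->
  (\sum_(l < n) y l) ^+ p <= \sum_(l < n) 2 ^+ (l.+1 * p) * y l ^+ p.
Proof.
move=> y0 p0; elim: n y y0 => [|n IH] y y0; first by rewrite !big_ord0 expr0n; case: p p0.
rewrite !big_ord_recl.
apply: (le_trans (exprD_le p (y0 _) (sumr_ge0 _ (fun i _ => y0 _)))).
rewrite mulrDr mul1n lerD2l.
apply: (le_trans (ler_wpM2l _ (IH (fun l => y l.+1) _))) => //.
rewrite mulr_sumr ler_sum// => i _.
by rewrite mulrA -exprD.
Qed.


Lemma expr_ge_tangent (q : nat) (b y : R) : 0 <= b -> 0 <= y ->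
  b ^+ q + q%:R * b ^+ q.-1 * (y - b) <= y ^+ q.
Proof.
move=> b0 y0; elim: q => [|q IH]; first by rewrite !expr0 !mul0r addr0.
rewrite [leRHS]exprS; apply: le_trans (ler_wpM2l y0 IH) => /=.
case: q {IH} => [|q]; first by rewrite expr0 !mul1r !mul0r addr0 expr1; lra.
rewrite /= -subr_ge0.
rewrite [X in 0 <= X](_ : _ = q.+1%:R * b ^+ q * ((y - b) ^+ 2)); last first.
  by rewrite !exprS expr0 -[q.+2%:R]natr1; ring.
by rewrite mulr_ge0 ?sqr_ge0// mulr_ge0 ?exprn_ge0.
Qed.

(** An even power lies above its tangents.  Integrating this inequality gives
    Jensen's inequality for finite means as well as for expectations. *)
Lemma expr_even_ge_tangent (q : nat) (a x : R) :
  a ^+ q.*2 + q%:R * (a ^+ 2) ^+ q.-1 * (2 * a) * (x - a) <= x ^+ q.*2.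
Proof.
rewrite -!mul2n !exprM.
apply: le_trans (expr_ge_tangent q (sqr_ge0 a) (sqr_ge0 x)).
rewrite lerD2l -!mulrA; rewrite ler_wpM2l// ler_wpM2l//.
  exact/exprn_ge0/sqr_ge0.
by have := sqr_ge0 (x - a); rewrite !expr2; lra.
Qed.

Lemma fmean_jensen (I : finType) (q : nat) (F : I -> R) : (0 < #|I|)%N ->
  (fmean F) ^+ q.*2 <= fmean (fun i => F i ^+ q.*2).
Proof.
move=> I0; set a := fmean F.
have -> : a ^+ q.*2 = fmean (fun i =>
    a ^+ q.*2 + q%:R * (a ^+ 2) ^+ q.-1 * (2 * a) * (F i - a)).
  by rewrite fmeanD fmeanZ fmeanD !fmean_cst// subrr mulr0 addr0.
by apply: le_fmean => i; exact: expr_even_ge_tangent.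
Qed.

End Mean.

Section Rademacher.
Context {R : realType} (B : finType).
Implicit Types (a : B -> R) (e : {ffun B -> bool}).

Definition rsum a e : R := \sum_b (-1) ^+ (e b) * a b.

Definition flip (b0 : B) e : {ffun B -> bool} :=
  [ffun b => if b == b0 then ~~ e b else e b].

Lemma flipK b0 : involutive (flip b0).
Proof.
by move=> e; apply/ffunP => b; rewrite !ffunE; case: eqP => // _; rewrite negbK.
Qed.

Lemma fmean_flip b0 (F : {ffun B -> bool} -> R) :
  fmean (F \o flip b0) = fmean F.
Proof.
by rewrite /fmean; congr (_ * _); rewrite [RHS](reindex_inj (can_inj (flipK b0))).
Qed.

Lemma rsum_flip a b0 e :
  (-1) ^+ (e b0) * (rsum a e - rsum a (flip b0 e)) = 2 * a b0.
Proof.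
rewrite /rsum -sumrB (bigD1 b0)//= big1 => [|b bb0]; last first.
  by rewrite ffunE (negbTE bb0) subrr.
by rewrite ffunE eqxx addr0; case: (e b0); rewrite ?expr0 ?expr1; lra.
Qed.

(** Discrete integration by parts: flipping the sign of one coordinate changes
    the sum by 2 (a b0), so the difference of two odd powers factors out another
    (a b0) and lowers the exponent by two. *)
Lemma signed_moment_le a b0 q :
  fmean (fun e => (-1) ^+ (e b0) * a b0 * rsum a e ^+ q.*2.+1) <=
  a b0 ^+ 2 * (2 * q.*2.+1%:R * fmean (fun e => rsum a e ^+ q.*2)).
Proof.
set F := fun e => _ * _ ^+ q.*2.+1.
have -> : fmean F = fmean (fun e => 2^-1 * (F e + F (flip b0 e))).
  rewrite fmeanZ fmeanD [fmean (fun e => F (flip b0 e))](fmean_flip b0 F); lra.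
have -> : a b0 ^+ 2 * (2 * q.*2.+1%:R * fmean (fun e => rsum a e ^+ q.*2)) =
    fmean (fun e => a b0 ^+ 2 * (q.*2.+1%:R *
      (rsum a e ^+ q.*2 + rsum a (flip b0 e) ^+ q.*2))).
  rewrite fmeanZ fmeanZ fmeanD.
  by rewrite [fmean (fun e => rsum a (flip b0 e) ^+ q.*2)]
    (fmean_flip b0 (fun e => rsum a e ^+ q.*2)); lra.
apply: le_fmean => e.
set S := rsum a e; set W := rsum a (flip b0 e).
have -> : F e + F (flip b0 e) =
    a b0 * ((-1) ^+ e b0 * (S - W)) * \sum_(i < q.*2.+1) S ^+ (q.*2 - i) * W ^+ i.
  rewrite /F -/S -/W ffunE eqxx.
  transitivity (a b0 * (-1) ^+ e b0 * (S ^+ q.*2.+1 - W ^+ q.*2.+1)).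
    by case: (e b0); rewrite /= ?expr0 ?expr1; ring.
  by rewrite subrXX; ring.
rewrite rsum_flip.
have -> : 2^-1 * (a b0 * (2 * a b0) *
    \sum_(i < q.*2.+1) S ^+ (q.*2 - i) * W ^+ i) =
    a b0 ^+ 2 * \sum_(i < q.*2.+1) S ^+ (q.*2 - i) * W ^+ i by rewrite expr2; field.
rewrite ler_wpM2l ?sqr_ge0// mulr_natl.
rewrite -[X in _ *+ X]card_ord -sumr_const; apply: ler_sum => i _.
have i2q : (i <= q.*2)%N by rewrite -ltnS.
have evn (x : R) : x ^+ q.*2 = `|x| ^+ q.*2.
  by rewrite -!mul2n !exprM real_normK ?num_real.
rewrite (le_trans (ler_norm _))// normrM !normrX !(evn S) !(evn W).
have [SW|/ltW SW] := leP `|S| `|W|.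
  apply: (@le_trans _ _ (`|W| ^+ q.*2)); last by rewrite lerDr exprn_ge0.
  rewrite -[in leRHS](subnK i2q) exprD ler_wpM2r ?exprn_ge0//.
  by rewrite lerXn2r ?nnegrE.
apply: (@le_trans _ _ (`|S| ^+ q.*2)); last by rewrite lerDl exprn_ge0.
rewrite -[in leRHS](subnK i2q) exprD ler_wpM2l ?exprn_ge0//.
by rewrite lerXn2r ?nnegrE.
Qed.

(** Summing [signed_moment_le] over the coordinates bounds the moment of order
    2(k+1) by 4q (sum of squares) times the moment of order 2k, for k < q. *)
Lemma khinchine a q :
  fmean (fun e => rsum a e ^+ q.*2) <= (4 * q%:R * \sum_b a b ^+ 2) ^+ q.
Proof.
set s := \sum_b _.
have s0 : 0 <= s by apply: sumr_ge0 => b _; exact: sqr_ge0.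
suff H : forall k, (k <= q)%N ->
    fmean (fun e => rsum a e ^+ k.*2) <= (4 * q%:R * s) ^+ k by exact: H.
elim=> [_|k IH kq].
  by rewrite expr0 fmean_cst// card_ffun expn_gt0 card_bool.
rewrite exprS; set c := 4 * q%:R * s in IH *.
have -> : fmean (fun e => rsum a e ^+ k.+1.*2) =
    \sum_b fmean (fun e => (-1) ^+ (e b) * a b * rsum a e ^+ k.*2.+1).
  rewrite -fmean_sum; congr fmean; apply/funext => e.
  by rewrite -mulr_suml doubleS exprS.
apply: (@le_trans _ _ (\sum_b a b ^+ 2 *
    (2 * k.*2.+1%:R * fmean (fun e => rsum a e ^+ k.*2)))).
  by apply: ler_sum => b _; exact: signed_moment_le.
rewrite -mulr_suml -/s.
apply: (@le_trans _ _ (s * (4 * q%:R * c ^+ k))); last by rewrite /c; lra.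
rewrite ler_wpM2l//; apply: ler_pM => //.
- by rewrite fmean_ge0// => e; rewrite -mul2n exprM exprn_ge0// sqr_ge0.
- have -> : 4 * q%:R = 2 * (q.*2)%:R :> R by rewrite -muln2 natrM; lra.
  by rewrite ler_wpM2l// ler_nat; lia.
- exact: IH (ltnW kq).
Qed.

End Rademacher.

(** * Chaining for Rademacher sums *)

Section FiniteMax.
Context {R : realType} (I : finType).
Implicit Types (A : pred I) (F : I -> R).

Definition fmax A F : R := \big[Num.max/0]_(i | A i) F i.

Lemma fmax_ge0 A F : 0 <= fmax A F.
Proof. exact: bigmax_ge_id. Qed.

Lemma le_fmax A F i : A i -> F i <= fmax A F.
Proof. by move=> Ai; exact: le_bigmax_cond. Qed.

Lemma fmax_le A F c : 0 <= c -> (forall i, A i -> F i <= c) -> fmax A F <= c.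
Proof. by move=> c0 FC; exact: bigmax_le. Qed.

Lemma fmaxX_le A F p : (forall i, 0 <= F i) -> (0 < p)%N ->
  fmax A F ^+ p <= \sum_(i | A i) F i ^+ p.
Proof.
move=> F0 p0; rewrite /fmax.
suff : 0 <= \big[Num.max/0]_(i | A i) F i /\
  (\big[Num.max/0]_(i | A i) F i) ^+ p <= \sum_(i | A i) F i ^+ p by case.
elim/big_rec2 : _ => [|i y1 y2 Ai [z0 IH]]; first by rewrite expr0n; case: p p0.
rewrite le_max F0; split=> //.
rewrite maxEle; case: ifP => _; last by rewrite lerDl (le_trans _ IH) ?exprn_ge0.
by rewrite (le_trans IH)// lerDr exprn_ge0.
Qed.

End FiniteMax.

Section Chaining.
Context {R : realType} (I B : finType).

Lemma rsumB (x y : B -> R) e :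
  rsum (fun b => x b - y b) e = rsum x e - rsum y e.
Proof. by rewrite /rsum -sumrB; apply: eq_bigr => b _; rewrite mulrBr. Qed.

(** A maximum over a finite set costs a factor equal to its cardinality, that is,
    almost nothing after p-th roots when p exceeds the logarithm of the
    cardinality. *)
Lemma max_moment_le (A : pred I) (x : I -> B -> R) (D : R) q : (0 < q)%N ->
  (forall i, A i -> \sum_b x i b ^+ 2 <= D) ->
  fmean (fun e => fmax A (fun i => `|rsum (x i) e|) ^+ q.*2) <=
  #|A|%:R * (4 * q%:R * D) ^+ q.
Proof.
move=> q0 xD.
apply: (@le_trans _ _ (\sum_(i | A i)
    fmean (fun e => rsum (x i) e ^+ q.*2))).
  rewrite -fmean_sum; apply: le_fmean => e.
  apply: le_trans (fmaxX_le _ _ _) _ => //; first by rewrite double_gt0.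
  by apply: ler_sum => i _; rewrite -!mul2n !exprM real_normK ?num_real.
have -> : #|A|%:R * (4 * q%:R * D) ^+ q = \sum_(i | A i) (4 * q%:R * D) ^+ q.
  by rewrite sumr_const mulr_natl.
apply: ler_sum => i Ai; apply: le_trans (khinchine _ _) _.
have S0 : 0 <= \sum_b x i b ^+ 2 by apply: sumr_ge0 => b _; exact: sqr_ge0.
by rewrite lerXn2r ?nnegrE ?mulr_ge0 ?(le_trans S0 (xD i Ai))// ler_wpM2l ?mulr_ge0// xD.
Qed.

(** Dudley's chaining in moment form.  Links between the nets of levels l and
    l+1 have squared length at most rho / 16^l, and there are at most
    N 4^((l+1)v) of them; as v <= q/2, the p-th moments of the links
    (p = 2q) decay geometrically even with the weights of [sum_expr_le].  Only
    the coarsest level sees the full size D of the vectors, which is what lets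
    the bound be used when D is random. *)
Lemma chaining (a : I -> B -> R) (q v : nat) (N rho D : R) :
  (0 < v)%N -> (v.*2 <= q)%N -> 0 <= rho -> 0 <= D -> 1 <= N ->
  (forall l : nat, exists s : pred I, #|s|%:R <= N * 4 ^+ (l * v) /\
     forall i, exists2 c, s c &
       \sum_b (a i b - a c b) ^+ 2 <= rho / 16 ^+ l) ->
  (forall i, \sum_b a i b ^+ 2 <= D) ->
  fmean (fun e => fmax predT (fun i => `|rsum (a i) e|) ^+ q.*2) <=
  2 * N * (128 * q%:R) ^+ q * (D ^+ q + rho ^+ q).
Proof.
move=> v0 vq rho0 D0 N1 /choice[s hs] aD.
have q0 : (0 < q)%N by lia.
have p0 : (0 < q.*2)%N by lia.
have /choice[pi hpi] : forall li : nat * I, exists c, s li.1 c /\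
    \sum_b (a li.2 b - a c b) ^+ 2 <= rho / 16 ^+ li.1.
  by move=> [l i]; have [_ /(_ i)[c sc ac]] := hs l; exists c.
(* From level L + 1 on the net is the whole index set: 4 ^ L exceeds its
   cardinality, so no residual term is left. *)
pose L := #|I|.
pose t l : pred I := if (l <= L)%N then s l else predT.
pose G l e := fmax (t l) (fun i => `|rsum (a i) e|).
pose T l e := fmax (t l.+1) (fun i => `|rsum (fun b => a i b - a (pi (l, i)) b) e|).
have GT l e : (l <= L)%N -> G l.+1 e <= G l e + T l e.
  move=> lL; apply: fmax_le => [|i ti]; first by rewrite addr_ge0 ?fmax_ge0.
  rewrite -[rsum (a i) e](subrK (rsum (a (pi (l, i))) e)) -rsumB.
  rewrite (le_trans (ler_normD _ _))// addrC lerD//.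
    rewrite /G (le_fmax (fun i => `|rsum (a i) e|))// /t lL.
    by have [] := hpi (l, i).
  by rewrite /T (le_fmax (fun i => `|rsum (fun b => a i b - a (pi (l, i)) b) e|)).
have GS n e : (n <= L.+1)%N -> G n e <= G 0%N e + \sum_(l < n) T l e.
  elim: n => [|n IH] nL; first by rewrite big_ord0 addr0.
  rewrite big_ord_recr/= addrA (le_trans (GT _ _ _))// lerD2r; apply: IH; lia.
have cardt l : (l <= L.+1)%N -> #|t l|%:R <= N * 4 ^+ (l * v).
  move=> lL; rewrite /t; case: ifP => [_|]; first by have [] := hs l.
  move=> /negbT; rewrite -ltnNge => Ll; have -> : l = L.+1 by lia.
  have -> : #|(predT : pred I)| = L by [].
  apply: (@le_trans _ _ (1 * 4 ^+ (L.+1 * v))); last first.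
    by apply: ler_wpM2r; first nonneg.
  rewrite mul1r -natrX ler_nat.
  apply: (@leq_trans (4 ^ L)%N); first by apply: ltnW; exact: ltn_expl.
  by apply: leq_pexp2l => //; rewrite (leq_trans (leqnSn L))// leq_pmulr.
set c := N * (4 * q%:R) ^+ q.
have N0 : 0 <= N by exact: le_trans ler01 N1.
have c0 : 0 <= c by rewrite /c; nonneg.
have ET l : (l <= L)%N -> 2 ^+ (l.+1 * q.*2) * fmean (fun e => T l e ^+ q.*2) <=
    c * (8 * rho) ^+ q * 2^-1 ^+ l.
  move=> lL.
  apply: (@le_trans _ _ (2 ^+ (l.+1 * q.*2) *
      (N * 4 ^+ (l.+1 * v) * (4 * q%:R * (rho / 16 ^+ l)) ^+ q))).
    rewrite ler_wpM2l ?exprn_ge0//.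
    apply: le_trans (max_moment_le (D := rho / 16 ^+ l) _ _) _ => //.
      by move=> i _; have [_] := hpi (l, i).
    by apply: ler_wpM2r; [nonneg | exact: cardt].
  have le4 : (4 : R) ^+ (l.+1 * v) <= 2 ^+ (l.+1 * q).
    have -> : (4 : R) = 2 ^+ 2 by rewrite expr2; lra.
    by rewrite -exprM; apply: ler_weXn2l; rewrite ?ler1n// mulnCA leq_mul2l mul2n vq.
  apply: (@le_trans _ _ (2 ^+ (l.+1 * q.*2) *
      (N * 2 ^+ (l.+1 * q) * (4 * q%:R * (rho / 16 ^+ l)) ^+ q))).
    apply: ler_wpM2l; first by nonneg.
    apply: ler_wpM2r; first by nonneg.
    by apply: ler_wpM2l; first by nonneg.
  have -> : 2 ^+ (l.+1 * q.*2) * (N * 2 ^+ (l.+1 * q) *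
      (4 * q%:R * (rho / 16 ^+ l)) ^+ q) =
      c * (8 * rho) ^+ q * (2^-1 ^+ (l * q) : R).
    rewrite /c !exprMn.
    have -> : (16 ^+ l)^-1 ^+ q = (2^-1 ^+ (l * q)) ^+ 4 :> R.
      rewrite -exprVn -!exprM.
      have -> : (16^-1 : R) = (2^-1) ^+ 4 by rewrite !exprS expr0; field.
      by rewrite -exprM; congr (_ ^+ _); lia.
    have -> : 2 ^+ (l.+1 * q.*2) = (2 ^+ q) ^+ 2 * (2 ^+ (l * q)) ^+ 2 :> R.
      by rewrite -!exprM -exprD; congr (_ ^+ _); lia.
    have -> : 2 ^+ (l.+1 * q) = 2 ^+ q * 2 ^+ (l * q) :> R.
      by rewrite -exprD; congr (_ ^+ _); lia.
    have -> : (8 : R) ^+ q = (2 ^+ q) ^+ 3.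
      by rewrite -exprM mulnC exprM; congr (_ ^+ _); rewrite !exprS expr0; lra.
    have : 2 ^+ (l * q) * 2^-1 ^+ (l * q) = 1 :> R.
      by rewrite -exprMn divff// expr1n.
    move: (2 ^+ (l * q) : R) (2^-1 ^+ (l * q) : R) => x y xy.
    transitivity (N * (4 ^+ q * q%:R ^+ q) * ((2 ^+ q) ^+ 3 * rho ^+ q) * y * (x * y) ^+ 3).
      ring.
    by rewrite xy expr1n mulr1.
  apply: ler_wpM2l; first by nonneg.
  rewrite ler_wiXn2l ?invr_ge0//; last by rewrite leq_pmulr.
  by rewrite invf_le1//; lra.
pose S e := \sum_(l < L.+1) T l e.
have S0 e : 0 <= S e by apply: sumr_ge0 => l _; exact: fmax_ge0.
have ES : fmean (fun e => S e ^+ q.*2) <= c * (8 * rho) ^+ q * 2.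
  apply: (@le_trans _ _ (fmean (fun e =>
     \sum_(l < L.+1) 2 ^+ (l.+1 * q.*2) * T l e ^+ q.*2))).
    by apply: le_fmean => e; apply: (@sum_expr_le R L.+1 q.*2 (T ^~ e)) => // l; exact: fmax_ge0.
  rewrite fmean_sum.
  apply: (@le_trans _ _ (\sum_(l < L.+1) c * (8 * rho) ^+ q * 2^-1 ^+ l)).
    by apply: ler_sum => l _; rewrite fmeanZ; apply: ET; rewrite -ltnS.
  rewrite -mulr_sumr; apply: ler_wpM2l; first by nonneg.
  have := subrX1 (2^-1 : R) L.+1.
  set sg := \sum_(i < _) _ => E.
  have : 0 <= (2^-1 : R) ^+ L.+1 by rewrite exprn_ge0// invr_ge0.
  by move: E; move: (2^-1 ^+ L.+1 : R) => z; lra.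
have EG0 : fmean (fun e => G 0%N e ^+ q.*2) <= c * D ^+ q.
  apply: le_trans (max_moment_le (D := D) _ _) _ => //.
  rewrite /c exprMn mulrA; apply: ler_wpM2r; first by nonneg.
  apply: ler_wpM2r; first by nonneg.
  by have := cardt 0%N isT; rewrite mul0n expr0 mulr1.
apply: (@le_trans _ _ (fmean (fun e => 2 ^+ q.*2 * (G 0%N e ^+ q.*2 + S e ^+ q.*2)))).
  apply: le_fmean => e.
  have -> : fmax predT (fun i => `|rsum (a i) e|) = G L.+1 e by rewrite /G /t ltnn.
  apply: le_trans (exprD_le _ _ _) => //; last exact: fmax_ge0.
  by rewrite lerXn2r ?nnegrE ?addr_ge0 ?fmax_ge0// GS.
rewrite fmeanZ fmeanD.
apply: (@le_trans _ _ (2 ^+ q.*2 * (c * D ^+ q + c * (8 * rho) ^+ q * 2))).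
  by rewrite ler_wpM2l ?exprn_ge0// lerD.
have -> : 2 ^+ q.*2 = 4 ^+ q :> R.
  by rewrite -mul2n exprM; congr (_ ^+ _); rewrite expr2; lra.
have -> : 2 * N * (128 * q%:R) ^+ q * (D ^+ q + rho ^+ q) =
   4 ^+ q * (2 * c * (8 ^+ q * D ^+ q + 8 ^+ q * rho ^+ q)).
  rewrite /c; have -> : 128 * q%:R = 4 * ((4 * q%:R) * 8) :> R by lra.
  by rewrite 3!exprMn; ring.
rewrite ler_wpM2l ?exprn_ge0// exprMn.
have D1 : c * D ^+ q <= 2 * c * (8 ^+ q * D ^+ q).
  rewrite mulrA ler_wpM2r ?exprn_ge0//.
  rewrite -mulrA mulrCA -[leLHS]mulr1 ler_wpM2l//.
  have : 1 <= (8 : R) ^+ q by rewrite exprn_ege1//; lra.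
  by move: (8 ^+ q : R) => z; lra.
rewrite [leRHS]mulrDr; apply: lerD => //.
by rewrite mulrAC [c * 2]mulrC.
Qed.

End Chaining.

(** * Averages over permutations *)

Section PermutationAverage.
Context {R : realType}.

(** List the image of an injection followed by its complement: matching two such
    lists term by term is a permutation. *)
Lemma extend_injection (n m : nat) (b b' : 'I_m -> 'I_n) :
  injective b -> injective b' -> exists r : 'S_n, forall j, r (b j) = b' j.
Proof.
move=> ib ib'.
pose ext (c : 'I_m -> 'I_n) := codom c ++ [seq x <- enum 'I_n | x \notin codom c].
have ext_uniq c : injective c -> uniq (ext c).
  move=> ic; rewrite cat_uniq filter_uniq ?enum_uniq// andbT.
  have -> : uniq (codom c) by rewrite map_inj_uniq ?enum_uniq.
  by apply/hasPn => x; rewrite mem_filter => /andP[].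
have ext_mem c x : x \in ext c.
  by rewrite mem_cat mem_filter mem_enum andbT orbN.
have ext_size c : injective c -> size (ext c) = n.
  move=> ic; have /card_uniqP <- := ext_uniq c ic.
  rewrite (eq_card (B := 'I_n)) ?card_ord// => x; exact: ext_mem.
have ext_index c j : injective c -> index (c j) (ext c) = j.
  move=> ic; rewrite index_cat codom_f /codom.
  by rewrite index_map// index_enum_ord.
case: n => [|n] in b b' ib ib' ext ext_uniq ext_mem ext_size ext_index *.
  exists 1%g => j; by case: (b j).
pose r x := nth ord0 (ext b') (index x (ext b)).
have ir : injective r.
  move=> x y /eqP; rewrite /r nth_uniq ?ext_uniq//; last 2 first.
  - by rewrite ext_size// -[X in (_ < X)%N](ext_size b ib) index_mem.
  - by rewrite ext_size// -[X in (_ < X)%N](ext_size b ib) index_mem.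
  by move=> /eqP E; rewrite -(nth_index ord0 (ext_mem b x)) E nth_index.
exists (perm ir) => j; rewrite permE /r ext_index//.
by rewrite -(ext_index b' j ib') nth_index.
Qed.

(** Both sides are invariant under the symmetric group: the sum over all
    permutations does not depend on the injection b, by [extend_injection], so it
    can be averaged over all injections. *)
Lemma fmean_perm (n m : nat) (b : 'I_m -> 'I_n) (F : {ffun 'I_m -> 'I_n} -> R) :
  injective b ->
  fmean (fun s : 'S_n => F [ffun j => s (b j)]) =
  (n - m)`!%:R / n`!%:R * \sum_(i : {ffun 'I_m -> 'I_n} | injectiveb i) F i.
Proof.
move=> ib.
pose W (c : 'I_m -> 'I_n) := \sum_(s : 'S_n) F [ffun j => s (c j)].
have WE c c' : injective c -> injective c' -> W c = W c'.
  move=> ic ic'; have [r rE] := extend_injection ic ic'.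
  rewrite /W (reindex_inj (mulgI r)) /=; apply: eq_bigr => s _.
  by congr F; apply/ffunP => j; rewrite !ffunE permM rE.
have mn : (m <= n)%N by have := leq_card b ib; rewrite !card_ord.
have E1 : \sum_(i : {ffun 'I_m -> 'I_n} | injectiveb i) W i =
    n`!%:R * \sum_(i : {ffun 'I_m -> 'I_n} | injectiveb i) F i.
  rewrite exchange_big/=.
  rewrite -card_Sn mulr_natl -sumr_const; apply: eq_bigr => s _.
  rewrite [RHS](reindex_inj (h := fun i : {ffun 'I_m -> 'I_n} => [ffun j => s (i j)])).
    apply: eq_bigl => i; apply/injectiveP/injectiveP => ii x y.
      by rewrite !ffunE => /perm_inj/ii.
    by move=> xy; apply: ii; rewrite !ffunE xy.
  by move=> i i' /ffunP E; apply/ffunP => j; have := E j; rewrite !ffunE => /perm_inj.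
have E2 : \sum_(i : {ffun 'I_m -> 'I_n} | injectiveb i) W i =
    (n ^_ m)%:R * W b.
  rewrite (eq_bigr (fun=> W b)); last by move=> i /injectiveP ii; exact: WE.
  rewrite sumr_const mulr_natl; congr (_ *+ _).
  have := card_inj_ffuns 'I_m 'I_n; rewrite !card_ord => <-.
  by rewrite cardsE.
have nf : n`!%:R != 0 :> R by rewrite pnatr_eq0 -lt0n fact_gt0.
have nf' : (n - m)`!%:R != 0 :> R by rewrite pnatr_eq0 -lt0n fact_gt0.
rewrite /fmean card_Sn -/(W b).
set S := \sum_(i : {ffun 'I_m -> 'I_n} | injectiveb i) F i in E1 *.
have -> : S = n`!%:R^-1 * ((n ^_ m)%:R * W b) by rewrite -E2 E1 mulKf.
rewrite -(ffact_fact mn) natrM.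
have nf'' : (n ^_ m)%:R != 0 :> R by rewrite pnatr_eq0 -lt0n ffact_gt0.
by field; rewrite nf' nf''.
Qed.

End PermutationAverage.

(** * Laws determined on boxes *)

Section TupleLaw.
Context d (S : measurableType d) (R : realType).

Definition box n (A : 'I_n -> set S) : set (n.-tuple S) :=
  [set t | forall i, A i (tnth t i)].

Lemma measurable_box n (A : 'I_n -> set S) :
  (forall i, measurable (A i)) -> measurable (box A).
Proof.
move=> mA.
have -> : box A = \big[setI/setT]_(i < n) ((@tnth n S)^~ i @^-1` A i).
  rewrite -bigcap_seq; apply/seteqP; split=> t tA i; first by move=> _; exact: tA.
  by apply: tA; rewrite /= mem_index_enum.
apply: bigsetI_measurable => i _.
by rewrite -[X in measurable X]setTI; exact: measurable_tnth.
Qed.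

(** Boxes are stable under intersection, so this presentation of the product
    sigma-algebra is the one to which uniqueness of measures applies. *)
Lemma tuple_measurable_boxE n :
  @measurable _ (n.-tuple S) =
  <<s [set box A | A in [set A | forall i : 'I_n, measurable (A i)]] >>.
Proof.
apply/seteqP; split.
  apply: smallest_sub; first exact: smallest_sigma_algebra.
  rewrite -bigcup_seq; apply: bigcup_sub => i _ _ [B mB <-].
  apply: sub_sigma_algebra; exists (fun j => if j == i then B else setT).
    by move=> j /=; case: ifP.
  rewrite setTI; apply/seteqP; split=> t /=.
    by move=> /(_ i); rewrite eqxx.
  by move=> Bt j; case: eqP => [->|].
apply: smallest_sub; first exact: sigma_algebra_measurable.
by move=> _ [A mA <-]; exact: measurable_box.
Qed.

Lemma tuple_measure_unique n (m1 m2 : {measure set (n.-tuple S) -> \bar R}) :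
  (forall A, (forall i, measurable (A i)) -> m1 (box A) = m2 (box A)) ->
  (m1 setT < +oo)%E -> forall E, measurable E -> m1 E = m2 E.
Proof.
move=> m12 m1oo.
have bT : box (fun _ : 'I_n => [set: S]) = setT by apply/seteqP; split.
apply: (measure_unique _ (fun=> setT) (tuple_measurable_boxE n)).
- move=> _ _ [A mA <-] [A' mA' <-]; exists (fun i => A i `&` A' i).
    by move=> i /=; exact: measurableI.
  apply/seteqP; split=> t; first by move=> AA; split=> i; have [] := AA i.
  by move=> [tA tA'] i; split.
- by move=> k; exists (fun=> setT) => //= i; exact: measurableT.
- by rewrite bigcup_const//; exists 0%N.
- by move=> _ [A mA <-]; exact: m12.
- by move=> k.
Qed.

End TupleLaw.

Section SameLaw.
Context d (S : measurableType d) (R : realType) (J : finType).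

Definition tuple_of_fun (z : J -> S) : #|J|.-tuple S := [tuple z (enum_val i) | i < #|J|].
Definition fun_of_tuple (t : #|J|.-tuple S) : J -> S := fun j => tnth t (enum_rank j).

Lemma tuple_of_funK : cancel tuple_of_fun fun_of_tuple.
Proof.
by move=> z; apply/funext => j; rewrite /fun_of_tuple tnth_mktuple enum_rankK.
Qed.

(** Functions of a finite family of points are measured through tuples, whose
    sigma-algebra is generated by the coordinates. *)
Definition fmeas d' (U : sigmaRingType d') (Phi : (J -> S) -> U) :=
  measurable_fun setT (Phi \o fun_of_tuple).

Lemma measurable_tuple_of_fun d' (T : measurableType d') (W : J -> T -> S) :
  (forall j, measurable_fun setT (W j)) ->
  measurable_fun setT (fun w => tuple_of_fun (W ^~ w)).
Proof.
move=> mW; apply/measurable_fun_tnthP => i.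
rewrite [X in measurable_fun _ X](_ : _ = W (enum_val i)); first exact: mW.
by apply/funext => w /=; rewrite tnth_mktuple.
Qed.

Lemma fmeas_comp d' (T : measurableType d') d2 (U : measurableType d2)
  (W : J -> T -> S) (Phi : (J -> S) -> U) :
  (forall j, measurable_fun setT (W j)) -> fmeas Phi ->
  measurable_fun setT (fun w => Phi (W ^~ w)).
Proof.
move=> mW mPhi.
have := measurableT_comp mPhi (measurable_tuple_of_fun mW).
by congr measurable_fun; apply/funext => w; rewrite /comp tuple_of_funK.
Qed.

(** The two families have laws that agree on boxes, hence everywhere.  This is
    applied to reorderings of a sample and to exchanges of a sample with an
    independent copy. *)
Theorem same_law d1 d2 (T1 : measurableType d1) (T2 : measurableType d2)
  (P1 : {measure set T1 -> \bar R}) (P2 : {measure set T2 -> \bar R})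
  (W1 : J -> T1 -> S) (W2 : J -> T2 -> S) :
  (P1 setT < +oo)%E ->
  (forall j, measurable_fun setT (W1 j)) ->
  (forall j, measurable_fun setT (W2 j)) ->
  (forall A : J -> set S, (forall j, measurable (A j)) ->
    P1 [set w | forall j, A j (W1 j w)] = P2 [set w | forall j, A j (W2 j w)]) ->
  forall Phi : (J -> S) -> \bar R, fmeas Phi -> (forall z, 0 <= Phi z)%E ->
  (\int[P1]_w Phi (W1 ^~ w) = \int[P2]_w Phi (W2 ^~ w))%E.
Proof.
move=> P1oo mW1 mW2 PW Phi mPhi Phi0.
have mt1 := measurable_tuple_of_fun mW1.
have mt2 := measurable_tuple_of_fun mW2.
have E1 : (\int[P1]_w Phi (W1 ^~ w) =
    \int[pushforward P1 (fun w => tuple_of_fun (W1 ^~ w))]_t (Phi (fun_of_tuple t)))%E.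
  rewrite [RHS]ge0_integral_pushforward//.
  by rewrite preimage_setT; apply: eq_integral => w _; rewrite /= tuple_of_funK.
have E2 : (\int[P2]_w Phi (W2 ^~ w) =
    \int[pushforward P2 (fun w => tuple_of_fun (W2 ^~ w))]_t (Phi (fun_of_tuple t)))%E.
  rewrite [RHS]ge0_integral_pushforward//.
  by rewrite preimage_setT; apply: eq_integral => w _; rewrite /= tuple_of_funK.
rewrite E1 E2.
pose m1 : {measure set _ -> \bar R} :=
  measure_function_pushforward__canonical__measure_function_Measure P1 mt1.
pose m2 : {measure set _ -> \bar R} :=
  measure_function_pushforward__canonical__measure_function_Measure P2 mt2.
change (\int[m1]_t Phi (fun_of_tuple t) = \int[m2]_t Phi (fun_of_tuple t))%E.
apply: eq_measure_integral => E mE _.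
apply: tuple_measure_unique => // A mA.
rewrite /m1 /m2 /= /pushforward.
have pre d' (T : measurableType d') (W : J -> T -> S) :
    (fun w => tuple_of_fun (W ^~ w)) @^-1` box A =
    [set w | forall j, A (enum_rank j) (W j w)].
  apply/seteqP; split=> w /= Aw.
    by move=> j; have := Aw (enum_rank j); rewrite tnth_mktuple enum_rankK.
  by move=> i; have := Aw (enum_val i); rewrite tnth_mktuple enum_valK.
by rewrite !pre; apply: (PW (fun j => A (enum_rank j))) => j; exact: mA.
Qed.

End SameLaw.

(** * Bounded measurable functions and their expectation *)

Section BoundedMeasurable.
Context d (T : measurableType d) (R : realType).
Implicit Types (g : T -> R).

Definition bmeas g := measurable_fun setT g /\ exists M, forall w, `|g w| <= M.

Lemma bmeas_cst c : bmeas (fun=> c).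
Proof. by split; [exact: measurable_cst|exists `|c|]. Qed.

Lemma bmeasD g1 g2 : bmeas g1 -> bmeas g2 -> bmeas (fun w => g1 w + g2 w).
Proof.
move=> [m1 [M1 h1]] [m2 [M2 h2]]; split; first exact: measurable_funD.
by exists (M1 + M2) => w; rewrite (le_trans (ler_normD _ _))// lerD.
Qed.

Lemma bmeasM g1 g2 : bmeas g1 -> bmeas g2 -> bmeas (fun w => g1 w * g2 w).
Proof.
move=> [m1 [M1 h1]] [m2 [M2 h2]]; split; first exact: measurable_funM.
by exists (M1 * M2) => w; rewrite normrM ler_pM.
Qed.

Lemma bmeasB g1 g2 : bmeas g1 -> bmeas g2 -> bmeas (fun w => g1 w - g2 w).
Proof.
move=> [m1 [M1 h1]] [m2 [M2 h2]]; split; first exact: measurable_funB.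
by exists (M1 + M2) => w; rewrite (le_trans (ler_normB _ _))// lerD.
Qed.

Lemma bmeasX p g : bmeas g -> bmeas (fun w => g w ^+ p).
Proof.
move=> bg; elim: p => [|p IH]; first exact: bmeas_cst.
by under eq_fun do rewrite exprS; exact: bmeasM.
Qed.

Lemma bmeas_norm g : bmeas g -> bmeas (fun w => `|g w|).
Proof.
move=> [mg [M gM]]; split; first exact: measurableT_comp.
by exists M => w; rewrite normr_id.
Qed.

Lemma bmeas_sum (I : Type) (s : seq I) (A : pred I) (g : I -> T -> R) :
  (forall i, A i -> bmeas (g i)) -> bmeas (fun w => \sum_(i <- s | A i) g i w).
Proof.
move=> bg; elim: s => [|i s IH].
  by under eq_fun do rewrite big_nil; exact: bmeas_cst.
under eq_fun do rewrite big_cons.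
by case Ai : (A i) => //; exact: bmeasD (bg _ Ai) IH.
Qed.

Lemma bmeas_max g1 g2 : bmeas g1 -> bmeas g2 ->
  bmeas (fun w => Num.max (g1 w) (g2 w)).
Proof.
move=> [m1 [M1 h1]] [m2 [M2 h2]]; split; first exact: measurable_maxr.
exists (Num.max M1 M2) => w; rewrite le_max.
by have [_|_] := leP (g1 w) (g2 w); rewrite (h1, h2) ?orbT.
Qed.

Lemma bmeas_fmax (I : finType) (A : pred I) (g : I -> T -> R) :
  (forall i, A i -> bmeas (g i)) -> bmeas (fun w => fmax A (fun i => g i w)).
Proof.
move=> bg; rewrite /fmax; elim: (index_enum I) => [|i s IH].
  by under eq_fun do rewrite big_nil; exact: bmeas_cst.
under eq_fun do rewrite big_cons.
by case Ai : (A i) => //; exact: bmeas_max (bg _ Ai) IH.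
Qed.

Lemma bmeas_indic (A : set T) : measurable A -> bmeas (\1_A : T -> R).
Proof.
move=> mA; split; first exact: measurable_indic.
by exists 1 => w; rewrite indicE; case: (_ \in _); rewrite ?normr1 ?normr0.
Qed.

End BoundedMeasurable.

Lemma bmeas_comp d (T : measurableType d) (R : realType) d' (U : measurableType d')
    (phi : U -> T) (g : T -> R) :
  measurable_fun setT phi -> bmeas g -> bmeas (g \o phi).
Proof.
by move=> mphi [mg [M gM]]; split; [exact: measurableT_comp|exists M => w; exact: gM].
Qed.

Section BoundedExpectation.
Context d (T : measurableType d) (R : realType).
Variable mu : probability T R.
Let mu1 : mu setT = 1%E := probability_setT mu.
Implicit Types (g : T -> R).

Local Notation Ex g := (Rintegral mu setT g).

Lemma bmeas_integrable g : bmeas g -> mu.-integrable setT (EFin \o g).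
Proof.
move=> [mg [M gM]]; apply: measurable_bounded_integrable => //.
  by rewrite -ge0_fin_numE// fin_num_measure.
exists M; split=> [|x Mx y _]; first exact: num_real.
exact: le_trans (gM y) (ltW Mx).
Qed.

Lemma ExE g : bmeas g -> (\int[mu]_w (g w)%:E = (Ex g)%:E)%E.
Proof. by move=> /bmeas_integrable/integrable_fin_num/fineK <-. Qed.

Lemma Ex_cst c : Ex (fun=> c) = c.
Proof. by rewrite Rintegral_cst// [X in fine X]mu1 mulr1. Qed.

Lemma ExD g1 g2 : bmeas g1 -> bmeas g2 ->
  Ex (fun w => g1 w + g2 w) = Ex g1 + Ex g2.
Proof. by move=> b1 b2; rewrite RintegralD//; exact: bmeas_integrable. Qed.

Lemma ExB g1 g2 : bmeas g1 -> bmeas g2 ->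
  Ex (fun w => g1 w - g2 w) = Ex g1 - Ex g2.
Proof. by move=> b1 b2; rewrite RintegralB//; exact: bmeas_integrable. Qed.

Lemma ExZ c g : bmeas g -> Ex (fun w => c * g w) = c * Ex g.
Proof. by move=> b; rewrite RintegralZl//; exact: bmeas_integrable. Qed.

Lemma le_Ex g1 g2 : bmeas g1 -> bmeas g2 -> (forall w, g1 w <= g2 w) ->
  Ex g1 <= Ex g2.
Proof. by move=> b1 b2 h; apply: le_Rintegral => //; exact: bmeas_integrable. Qed.

Lemma Ex_ge0 g : (forall w, 0 <= g w) -> 0 <= Ex g.
Proof. by move=> g0; apply: Rintegral_ge0. Qed.

Lemma Ex_sum (I : Type) (s : seq I) (A : pred I) (g : I -> T -> R) :
  (forall i, A i -> bmeas (g i)) ->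
  Ex (fun w => \sum_(i <- s | A i) g i w) = \sum_(i <- s | A i) Ex (g i).
Proof.
move=> bg; elim: s => [|i s IH].
  by under eq_fun do rewrite big_nil; rewrite Ex_cst big_nil.
under eq_fun do rewrite big_cons.
rewrite big_cons; case Ai : (A i) => //; rewrite ExD ?IH//; first exact: bg.
exact: bmeas_sum.
Qed.

Lemma Ex_fmean (I : finType) (g : I -> T -> R) :
  (forall i, bmeas (g i)) ->
  Ex (fun w => fmean (fun i => g i w)) = fmean (fun i => Ex (g i)).
Proof. by move=> bg; rewrite /fmean ExZ ?Ex_sum//; exact: bmeas_sum. Qed.

(** Integrate the tangent inequality at the point Ex g. *)
Lemma Ex_jensen q g : bmeas g -> (Ex g) ^+ q.*2 <= Ex (fun w => g w ^+ q.*2).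
Proof.
move=> bg; set a := Ex g.
have <- : Ex (fun w => a ^+ q.*2 + q%:R * (a ^+ 2) ^+ q.-1 * (2 * a) * (g w - a))
    = a ^+ q.*2.
  have bga : bmeas (fun w => g w - a) by apply: bmeasB => //; exact: bmeas_cst.
  rewrite ExD; [|exact: bmeas_cst|exact: bmeasM (bmeas_cst _ _) bga].
  by rewrite ExZ// ExB ?Ex_cst ?subrr ?mulr0 ?addr0//; exact: bmeas_cst.
apply: le_Ex => [||w]; last exact: expr_even_ge_tangent.
  apply: bmeasD; first exact: bmeas_cst.
  apply: bmeasM; first exact: bmeas_cst.
  by apply: bmeasB => //; exact: bmeas_cst.
exact: bmeasX.
Qed.

End BoundedExpectation.

Section FubiniBounded.
Context d1 d2 (T1 : measurableType d1) (T2 : measurableType d2) (R : realType).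
Variables (P1 : probability T1 R) (P2 : probability T2 R).

Lemma Ex_fubini (g : T1 * T2 -> R) : bmeas g -> (forall z, 0 <= g z) ->
  bmeas (fun w1 => Rintegral P2 setT (fun w2 => g (w1, w2))) /\
  Rintegral (P1 \x P2)%E setT g =
  Rintegral P1 setT (fun w1 => Rintegral P2 setT (fun w2 => g (w1, w2))).
Proof.
move=> [mg [M gM]] g0.
have bs w1 : bmeas (fun w2 => g (w1, w2)).
  by apply: (bmeas_comp (phi := pair w1)) => //; split=> //; exists M.
have mE : measurable_fun setT (fun z => (g z)%:E) by exact/measurable_EFinP.
have b : bmeas (fun w1 => Rintegral P2 setT (fun w2 => g (w1, w2))).
  split.
    apply: measurableT_comp => //.
    by apply: (@measurable_fun_fubini_tonelli_F _ _ _ _ _ P2 (fun z => (g z)%:E)) => // z; rewrite lee_fin.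
  exists M => w1; rewrite ger0_norm ?Ex_ge0//.
  rewrite -[leRHS](Ex_cst P2).
  apply: le_Ex => //; first exact: bmeas_cst.
  by move=> w2; rewrite (le_trans _ (gM (w1, w2)))// ler_norm.
split=> //; rewrite [LHS]/Rintegral fubini_tonelli1//.
rewrite [RHS]/Rintegral; congr fine; apply: eq_integral => w1 _.
by rewrite /fubini_F -ExE.
Qed.

End FubiniBounded.

(** * Independent samples, ghost copies and symmetrization *)

Lemma fmaxX {R : realType} (I : finType) (A : pred I) (F : I -> R) p :
  (0 < p)%N -> (forall i, 0 <= F i) ->
  fmax A F ^+ p = fmax A (fun i => F i ^+ p).
Proof.
move=> p0 F0; rewrite /fmax.
suff : 0 <= \big[Num.max/0]_(i | A i) F i /\
  (\big[Num.max/0]_(i | A i) F i) ^+ p = \big[Num.max/0]_(i | A i) F i ^+ p by case.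
elim/big_rec2 : _ => [|i y1 y2 Ai [z0 <-]]; first by rewrite expr0n; case: p p0.
rewrite le_max F0; split=> //.
have [Fy|yF] := leP (F i) y2.
  by rewrite (max_idPr _)// lerXn2r ?nnegrE.
by rewrite (max_idPl _)// lerXn2r ?nnegrE// ltW.
Qed.

Section BoundedFunctional.
Context dS (S : measurableType dS) (R : realType) (J : finType).
Implicit Types (Phi : (J -> S) -> R).

(** The analogue of [bmeas] for functions of a finite family of points. *)
Definition bmeasJ Phi := bmeas (Phi \o @fun_of_tuple _ S J).

Lemma bmeasJ_comp d (T : measurableType d) (W : J -> T -> S) Phi :
  (forall j, measurable_fun setT (W j)) -> bmeasJ Phi ->
  bmeas (fun w => Phi (W ^~ w)).
Proof.
move=> mW [mPhi [M PhiM]]; split; first exact: fmeas_comp.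
by exists M => w; have := PhiM (tuple_of_fun (W ^~ w)); rewrite /= tuple_of_funK.
Qed.

Lemma measurable_fun_of_tuple (j : J) : measurable_fun setT (fun t => @fun_of_tuple _ S J t j).
Proof. exact: measurable_tnth. Qed.

Lemma Ex_same_law d1 d2 (T1 : measurableType d1) (T2 : measurableType d2)
  (P1 : probability T1 R) (P2 : probability T2 R)
  (W1 : J -> T1 -> S) (W2 : J -> T2 -> S) Phi :
  (forall j, measurable_fun setT (W1 j)) ->
  (forall j, measurable_fun setT (W2 j)) ->
  (forall A : J -> set S, (forall j, measurable (A j)) ->
    P1 [set w | forall j, A j (W1 j w)] = P2 [set w | forall j, A j (W2 j w)]) ->
  bmeasJ Phi ->
  Rintegral P1 setT (fun w => Phi (W1 ^~ w)) =
  Rintegral P2 setT (fun w => Phi (W2 ^~ w)).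
Proof.
move=> mW1 mW2 PW bPhi; have [mPhi [M PhiM]] := bPhi.
have b1 := bmeasJ_comp mW1 bPhi.
have b2 := bmeasJ_comp mW2 bPhi.
(* Adding the bound M makes the function nonnegative. *)
apply: (addIr M); rewrite -[in LHS](Ex_cst P1 M) -[in RHS](Ex_cst P2 M).
rewrite -!ExD//; try exact: bmeas_cst.
rewrite /Rintegral; congr fine.
apply: (@same_law _ S R J _ _ T1 T2 P1 P2 W1 W2 _ mW1 mW2 PW
  (fun z => (Phi z + M)%:E)).
- by rewrite -ge0_fin_numE// fin_num_measure.
- by apply/measurable_EFinP; apply: measurable_funD.
- move=> z; rewrite lee_fin; have := PhiM (tuple_of_fun z); rewrite /= tuple_of_funK.
  by rewrite ler_norml => /andP[+ _]; lra.
Qed.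

End BoundedFunctional.

Section IID.
Context d (T : measurableType d) (R : realType) (P : probability T R).
Context dS (S : measurableType dS).
Implicit Types (Z : nat -> T -> S).

Definition iid Z := [/\ forall i, measurable_fun setT (Z i),
  mutually_independent P Z &
  forall i A, measurable A -> P (Z i @^-1` A) = P (Z 0%N @^-1` A)].

Lemma iid_box Z (J : finType) (s : J -> nat) (A : J -> set S) :
  iid Z -> injective s -> (forall j, measurable (A j)) ->
  P [set w | forall j, A j (Z (s j) w)] = (\prod_j P (Z 0%N @^-1` A j))%E.
Proof.
move=> [mZ indZ idZ] inj_s mA.
pose A' i := if [pick j | s j == i] is Some j then A j else setT.
have A's j : A' (s j) = A j.
  rewrite /A'; case: pickP => [j' /eqP/inj_s ->//|/(_ j)]; by rewrite eqxx.
have := indZ [seq s j | j <- enum J] A'.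
rewrite map_inj_uniq// enum_uniq => /(_ isT).
have mA' i : measurable (A' i) by rewrite /A'; case: pickP.
move=> /(_ (fun i _ => mA' i)).
rewrite big_map big_enum /= => E.
rewrite [RHS](_ : _ = (\prod_j P (Z (s j) @^-1` A' (s j)))%E); last first.
  by apply: eq_bigr => j _; rewrite A's idZ.
rewrite -E; congr (P _); apply/seteqP; split=> w /=.
  by move=> AZ i /= /mapP[j _ ->]; rewrite /= A's; exact: AZ.
move=> AZ j; have := AZ (s j); rewrite /= A's; apply.
by apply/mapP; exists j; rewrite // mem_enum.
Qed.

(** Any two injective selections from the sample give boxes the same
    probability. *)
Lemma Ex_exchange Z (J : finType) (s s' : J -> nat) (Phi : (J -> S) -> R) :
  iid Z -> injective s -> injective s' -> bmeasJ Phi ->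
  Rintegral P setT (fun w => Phi (fun j => Z (s j) w)) =
  Rintegral P setT (fun w => Phi (fun j => Z (s' j) w)).
Proof.
move=> iZ is1 is2 bPhi; have [mZ _ _] := iZ.
apply: (@Ex_same_law _ S R J _ _ T T P P (fun j => Z (s j)) (fun j => Z (s' j))) => // A mA.
by rewrite (iid_box (A := A) iZ is1)// (iid_box (A := A) iZ is2).
Qed.

(** The product space carries two independent copies of the sample, one for each
    coordinate of w.  Swapping the copies of any set of indices, here those
    where e holds, preserves the probability of every box. *)
Lemma Ex_ghost_swap Z (K : finType) (s : K -> nat) (e : K -> bool)
    (Phi : (bool * K -> S) -> R) :
  iid Z -> injective s -> bmeasJ Phi ->
  Rintegral (P \x P)%E setT
    (fun w => Phi (fun k => Z (s k.2) (if k.1 (+) e k.2 then w.1 else w.2))) =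
  Rintegral (P \x P)%E setT
    (fun w => Phi (fun k => Z (s k.2) (if k.1 then w.1 else w.2))).
Proof.
move=> iZ is1 bPhi; have [mZ _ _] := iZ.
have mW (c : bool) i : measurable_fun setT (fun w : T * T => Z i (if c then w.1 else w.2)).
  by case: c; apply: measurableT_comp.
suff law (g : K -> bool) (A : bool * K -> set S) : (forall k, measurable (A k)) ->
    (P \x P)%E [set w | forall k, A k (Z (s k.2) (if k.1 (+) g k.2 then w.1 else w.2))] =
    (\prod_k (P (Z 0%N @^-1` A (true, k)) * P (Z 0%N @^-1` A (false, k))))%E.
  apply: (@Ex_same_law _ S R _ _ _ (T * T)%type (T * T)%type (P \x P)%E (P \x P)%E
    (fun k w => Z (s k.2) (if k.1 (+) e k.2 then w.1 else w.2))
    (fun k w => Z (s k.2) (if k.1 then w.1 else w.2))) => // A mA.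
  apply: (etrans (law e A mA)); apply: esym.
  apply: etrans (law (fun=> false) A mA).
  by congr ((P \x P)%E _); apply/funext => w /=; apply/propext; split=> h k; have := h k;
    rewrite addbF.
move=> mA.
have -> : [set w | forall k, A k (Z (s k.2) (if k.1 (+) g k.2 then w.1 else w.2))] =
    [set w1 | forall k, A (~~ g k, k) (Z (s k) w1)] `*`
    [set w2 | forall k, A (g k, k) (Z (s k) w2)].
  apply/seteqP; split=> -[w1 w2] /=.
    move=> h; split=> k; first by have := h (~~ g k, k); rewrite /= addNb addbb.
    by have := h (g k, k); rewrite /= addbb.
  move=> [h1 h2] [c k] /=; case: (boolP (c (+) g k)) => cg.
    have -> : c = ~~ g k by move: cg; case: c; case: (g k).
    exact: h1.
  have -> : c = g k by move: cg; case: c; case: (g k).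
  exact: h2.
have mbox (h : K -> set S) : (forall k, measurable (h k)) ->
    measurable [set w | forall k, h k (Z (s k) w)].
  move=> mh.
  have -> : [set w | forall k, h k (Z (s k) w)] =
      \big[setI/setT]_(k : K) (Z (s k) @^-1` h k).
    rewrite -bigcap_seq; apply/seteqP; split=> w hw k; first by move=> _; exact: hw.
    by apply: hw; rewrite /= mem_index_enum.
  apply: bigsetI_measurable => k _.
  by rewrite -[X in measurable X]setTI; exact: mZ.
have m1 := mbox (fun k => A (~~ g k, k)) (fun k => mA _).
have m2 := mbox (fun k => A (g k, k)) (fun k => mA _).
apply: (etrans (product_measure1E _ _ m1 m2)).
have := iid_box (A := fun k => A (~~ g k, k)) iZ is1 (fun k => mA _).
have := iid_box (A := fun k => A (g k, k)) iZ is1 (fun k => mA _).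
rewrite /= => E2 E1.
apply: (etrans (congr2 mule E1 E2)).
rewrite -big_split/=; apply: eq_bigr => k _.
by case: (g k) => //=; rewrite muleC.
Qed.

End IID.

Section Symmetrization.
Context d (T : measurableType d) (R : realType) (P : probability T R).
Context dS (S : measurableType dS) (Z : nat -> T -> S).
Context (I B M : finType) (s : B * M -> nat) (f : I -> (M -> S) -> R) (e : I -> R).
Hypotheses (iZ : iid P Z) (inj_s : injective s)
  (bf : forall i, bmeasJ (f i)).

Definition block b w : M -> S := fun j => Z (s (b, j)) w.

Hypothesis fe : forall i b, Rintegral P setT (fun w => f i (block b w)) = e i.

Lemma bmeas_block i b : bmeas (fun w => f i (block b w)).
Proof.
by have [mZ _ _] := iZ; apply: (@bmeasJ_comp _ S R M _ T (fun j => Z (s (b, j)))).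
Qed.

Lemma bmeas_rsum i eps : bmeas (fun w => rsum (fun b => f i (block b w)) eps).
Proof.
apply: bmeas_sum => b _; apply: bmeasM (bmeas_cst _ _) _; exact: bmeas_block.
Qed.

Lemma bmeas_maxX (A : pred I) (g : I -> T -> R) q : (forall i, A i -> bmeas (g i)) ->
  bmeas (fun w => fmax A (fun i => `|g i w|) ^+ q).
Proof.
by move=> bg; apply: bmeasX; apply: bmeas_fmax => i Ai; apply: bmeas_norm; exact: bg.
Qed.

(** The mean e i is the integral over a ghost sample, so Jensen's inequality
    replaces the centring by the ghost sample; the difference is then invariant in
    law under swaps, which produce any prescribed pattern of signs. *)
Lemma symmetrization_sign (q : nat) (eps : {ffun B -> bool}) : (0 < q)%N ->
  Rintegral P setT (fun w =>
    fmax predT (fun i => `|\sum_b (f i (block b w) - e i)|) ^+ q.*2) <=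
  2 ^+ q.*2 * 2 * Rintegral P setT (fun w =>
    fmax predT (fun i => `|rsum (fun b => f i (block b w)) eps|) ^+ q.*2).
Proof.
move=> q0.
pose D (z : bool * (B * M) -> S) eps : R := fmax predT (fun i =>
  `|rsum (fun b => f i (fun j => z (true, (b, j))) - f i (fun j => z (false, (b, j)))) eps|)
  ^+ q.*2.
(* g tells, index by index, whether the two copies are swapped. *)
pose zz g (w : T * T) := fun k : bool * (B * M) =>
  Z (s k.2) (if k.1 (+) g k.2 then w.1 else w.2).
pose e0 : {ffun B -> bool} := [ffun=> false].
have [mZ _ _] := iZ.
have bD ep : bmeasJ (D ^~ ep).
  rewrite /bmeasJ /D.
  apply: bmeasX; apply: bmeas_fmax => i _; apply: bmeas_norm; apply: bmeas_sum => b _.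
  apply: bmeasM; first exact: bmeas_cst.
  by apply: bmeasB;
    [apply: (@bmeasJ_comp _ S R M _ _ (fun j t => @fun_of_tuple _ S _ t (true, (b, j))))|
     apply: (@bmeasJ_comp _ S R M _ _ (fun j t => @fun_of_tuple _ S _ t (false, (b, j))))] => // j;
    exact: measurable_fun_of_tuple.
have mzz g k : measurable_fun setT (fun w : T * T => zz g w k).
  by rewrite /zz; case: (_ (+) _); apply: measurableT_comp.
have bDz g ep : bmeas (fun w : T * T => D (zz g w) ep).
  by apply: (@bmeasJ_comp _ S R _ _ _ (fun k w => zz g w k) (D ^~ ep)).
have D0 z ep : 0 <= D z ep by rewrite exprn_ge0// fmax_ge0.
have [bDw DF] := Ex_fubini P P (bDz (fun=> false) e0) (fun w => D0 _ _).
apply: (@le_trans _ _ (Rintegral (P \x P)%E setT (fun w => D (zz (fun=> false) w) e0))).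
  rewrite DF; apply: le_Ex => //.
    apply: bmeas_maxX => i _; apply: bmeas_sum => b _.
    by apply: bmeasB; [exact: bmeas_block|exact: bmeas_cst].
  move=> w1.
  have bD2 : bmeas (fun w2 => D (zz (fun=> false) (w1, w2)) e0).
    exact: (bmeas_comp (phi := pair w1) _ (bDz (fun=> false) e0)).
  rewrite fmaxX ?double_gt0//; apply: fmax_le => [|i _]; first exact: Ex_ge0.
  rewrite -normrX ger0_norm; last by rewrite -mul2n exprM exprn_ge0// sqr_ge0.
  have bi : bmeas (fun w2 => \sum_b (f i (block b w1) - f i (block b w2))).
    apply: bmeas_sum => b _.
    by apply: bmeasB; [exact: bmeas_cst|exact: bmeas_block].
  have -> : \sum_b (f i (block b w1) - e i) =
      Rintegral P setT (fun w2 => \sum_b (f i (block b w1) - f i (block b w2))).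
    rewrite Ex_sum; last first.
      by move=> b _; apply: bmeasB; [exact: bmeas_cst|exact: bmeas_block].
    apply: eq_bigr => b _; rewrite ExB ?Ex_cst ?fe//; first exact: bmeas_cst.
    exact: bmeas_block.
  apply: le_trans (Ex_jensen P q bi) _.
  apply: le_Ex => //; first exact: bmeasX.
  move=> w2; rewrite /D fmaxX ?double_gt0//.
  apply: le_trans (le_fmax _ (isT : predT i)).
  rewrite -normrX ler_normr; apply/orP; left.
  rewrite le_eqVlt; apply/orP; left; apply/eqP; congr (_ ^+ _).
  by rewrite /rsum; apply: eq_bigr => b _; rewrite ffunE expr0 mul1r.
have -> : Rintegral (P \x P)%E setT (fun w => D (zz (fun=> false) w) e0) =
   Rintegral (P \x P)%E setT (fun w => D (zz (fun=> false) w) eps).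
  transitivity (Rintegral (P \x P)%E setT (fun w => D (zz (fun k => eps k.1) w) e0)).
    have := @Ex_ghost_swap _ T R P _ S Z _ s (fun k => eps k.1) (D ^~ e0) iZ inj_s (bD _).
    by rewrite /zz => ->; congr Rintegral.
  congr Rintegral; apply/funext => w; rewrite /D; congr (_ ^+ _).
  congr fmax; apply/funext => i; congr (`| _ |).
  rewrite /rsum; apply: eq_bigr => b _; rewrite ffunE expr0 mul1r /zz /=.
  by case: (eps b); rewrite /= ?expr0 ?expr1 ?mul1r// mulN1r opprB.
pose G w := fmax predT (fun i => `|rsum (fun b => f i (block b w)) eps|) ^+ q.*2.
have bG : bmeas G by apply: bmeas_maxX => i _; exact: bmeas_rsum.
have G0 w : 0 <= G w by rewrite exprn_ge0// fmax_ge0.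
have bG1 : bmeas (fun w : T * T => G w.1) by exact: (bmeas_comp (phi := fst)).
have bG2 : bmeas (fun w : T * T => G w.2) by exact: (bmeas_comp (phi := snd)).
apply: (@le_trans _ _ (Rintegral (P \x P)%E setT
   (fun w => 2 ^+ q.*2 * (G w.1 + G w.2)))).
  apply: le_Ex => //.
    by apply: bmeasM; [exact: bmeas_cst|exact: bmeasD].
  move=> w; apply: le_trans (exprD_le _ (fmax_ge0 _ _) (fmax_ge0 _ _)).
  rewrite lerXn2r ?nnegrE ?addr_ge0 ?fmax_ge0//.
  apply: fmax_le => [|i _]; first by rewrite addr_ge0 ?fmax_ge0.
  rewrite rsumB (le_trans (ler_normB _ _))// lerD//.
    exact: (le_fmax (fun i => `|rsum (fun b => f i (block b w.1)) eps|)).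
  exact: (le_fmax (fun i => `|rsum (fun b => f i (block b w.2)) eps|)).
rewrite ExZ; last exact: bmeasD.
rewrite ExD// -mulrA ler_wpM2l ?exprn_ge0//.
have [_ ->] := Ex_fubini P P bG1 (fun w => G0 _).
have [_ ->] := Ex_fubini P P bG2 (fun w => G0 _).
rewrite /=; have -> : Rintegral P setT (fun w1 => Rintegral P setT (fun _ => G w1)) =
    Rintegral P setT G by congr Rintegral; apply/funext => w1; rewrite Ex_cst.
by rewrite Ex_cst /G; lra.
Qed.

Lemma symmetrization (q : nat) : (0 < q)%N ->
  Rintegral P setT (fun w =>
    fmax predT (fun i => `|\sum_b (f i (block b w) - e i)|) ^+ q.*2) <=
  2 ^+ q.*2 * 2 * Rintegral P setT (fun w => fmean (fun eps =>
    fmax predT (fun i => `|rsum (fun b => f i (block b w)) eps|) ^+ q.*2)).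
Proof.
move=> q0; rewrite Ex_fmean; last first.
  by move=> eps; apply: bmeas_maxX => i _; exact: bmeas_rsum.
rewrite -fmeanZ.
rewrite -[leLHS](@fmean_cst _ {ffun B -> bool})//; last first.
  by rewrite card_ffun expn_gt0 card_bool.
by apply: le_fmean => eps; exact: symmetrization_sign.
Qed.

End Symmetrization.

(** * Uniform covers *)

Section UniformCover.
Context {R : realType}.

(** Covering numbers of order (A / dlt)^v at squared radius dlt, with centres in
    the class, in the L2 seminorm of any finite set of points x.  Only empirical
    measures occur in chaining, and stating the cover for them avoids integrals. *)
Definition unif_cover (V : Type) (Fam : set (V -> R)) (A : R) (v : nat) :=
  forall (B : finType) (x : B -> V) (dlt : R), 0 < dlt <= 1 ->
  exists (K : finType) (c : K -> V -> R), [/\ #|K|%:R <= (A / dlt) ^+ v,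
    forall k, Fam (c k) &
    forall g, Fam g -> exists k,
      \sum_b (g (x b) - c k (x b)) ^+ 2 <= #|B|%:R * dlt].

Lemma sqrB_le (x y z : R) : (x - z) ^+ 2 <= 2 * (x - y) ^+ 2 + 2 * (z - y) ^+ 2.
Proof. by have := sqr_ge0 (x + z - 2 * y); rewrite !expr2; lra. Qed.

(** Centres need not belong to the subfamily.  Replacing each centre of radius
    dlt / 4 by a member of the subfamily that is close to it doubles the radius,
    hence the factor 4. *)
Lemma cover_subfamily (V : Type) (Fam : set (V -> R)) A v (I : finType)
    (f : I -> V -> R) : unif_cover Fam A v -> (forall i, Fam (f i)) ->
  forall (B : finType) (x : B -> V) (dlt : R), 0 < dlt <= 1 ->
  exists s : pred I, #|s|%:R <= (4 * A / dlt) ^+ v /\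
    forall i, exists2 c, s c &
      \sum_b (f i (x b) - f c (x b)) ^+ 2 <= #|B|%:R * dlt.
Proof.
move=> cov Ff B x dlt /andP[d0 d1].
have d4 : 0 < dlt / 4 <= 1 by apply/andP; split; lra.
have [K [c [cK _ cnet]]] := cov B x (dlt / 4) d4.
pose near i k := \sum_b (f i (x b) - c k (x b)) ^+ 2 <= #|B|%:R * (dlt / 4).
pose rep k := [pick i | near i k].
exists (fun i => [exists k, rep k == Some i]); split.
  have -> : 4 * A / dlt = A / (dlt / 4) by field; rewrite gt_eqF.
  apply: le_trans cK; rewrite ler_nat.
  pose S := [set i | [exists k, rep k == Some i]]%SET.
  rewrite (_ : #|_| = #|S|); last by rewrite cardsE.
  have SK : finset.imset Some (mem S) \subset finset.imset rep (mem K).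
    apply/fintype.subsetP => _ /imsetP[i iS ->]; move: iS; rewrite inE => /existsP[k /eqP <-].
    by apply/imsetP; exists k.
  have := subset_leq_card SK; rewrite card_imset; last by move=> a b [].
  by move=> /leq_trans; apply; exact: leq_imset_card.
move=> i; have [k ik] := cnet _ (Ff i).
have := erefl (rep k); rewrite {2}/rep; case: pickP => [c' c'k rk|/(_ i)]; last first.
  by rewrite /near ik.
exists c'; first by apply/existsP; exists k; rewrite rk.
apply: (@le_trans _ _ (\sum_b (2 * (f i (x b) - c k (x b)) ^+ 2 +
   2 * (f c' (x b) - c k (x b)) ^+ 2))).
  by apply: ler_sum => b _; exact: sqrB_le.
rewrite big_split/= -!mulr_sumr; move: ik; move: c'k; rewrite /near.
by move: (\sum_b _) (\sum_b _) => y z; lra.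
Qed.

End UniformCover.

Section MomentAlgebra.
Context {R : realType}.

(** The self-bounding step.  With D the random maximal sum of squares, ED and EDq
    stand for the expectations of D^(2q) and D^q.  The hypotheses are the
    symmetrized bound of D by itself and the weighted comparison of D^q with
    D^(2q); choosing the weight first of the size of the coefficient, then of the
    size of the conclusion, absorbs the term EDq. *)
Lemma self_bound_algebra (q : nat) (k G rho ED EDq : R) :
  (0 < q)%N -> 1 <= k -> 1 <= G -> q%:R <= G * rho -> 0 <= rho ->
  ED <= 4 ^+ q * (G * rho) ^+ q.*2 + (4 * k * q%:R) ^+ q * (EDq + rho ^+ q) ->
  (forall a, 0 < a -> EDq <= a / 2 + ED / (2 * a)) ->
  EDq <= (16 * k * G * rho) ^+ q.
Proof.
move=> q0 k1 G1 qG rho0 EDle am.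
have k0 : 0 <= k by apply: le_trans k1.
have G0 : 0 <= G by apply: le_trans G1.
set y := (G * rho) ^+ q.
have q1 : (1 : R) <= q%:R by rewrite ler1n.
have y0 : 0 < y by rewrite exprn_gt0// (lt_le_trans _ qG)// ltr0n.
set z := (4 * k * q%:R) ^+ q in EDle.
have z0 : 0 < z by rewrite exprn_gt0// !mulr_gt0// ?ltr0n// (lt_le_trans _ k1).
have zy : z <= (4 * k) ^+ q * y.
  rewrite /z /y -exprMn lerXn2r ?nnegrE//; first by nonneg.
    by nonneg.
  by apply: ler_wpM2l => //; nonneg.
have ry : rho ^+ q <= y.
  rewrite /y lerXn2r ?nnegrE//; first by nonneg.
  by rewrite -{1}[rho]mul1r ler_wpM2r.
have r0 : 0 <= rho ^+ q by exact: exprn_ge0.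
have ed := am _ z0.
have E1 : ED <= 2 * (4 ^+ q * y ^+ 2) + z ^+ 2 + 2 * (z * rho ^+ q).
  have zE : z * EDq <= z ^+ 2 / 2 + ED / 2.
    have -> : z ^+ 2 / 2 + ED / 2 = z * (z / 2 + ED / (2 * z)).
      by field; rewrite gt_eqF.
    by rewrite ler_pM2l.
  move: EDle.
  have -> : (G * rho) ^+ q.*2 = y ^+ 2 by rewrite -muln2 exprM.
  rewrite mulrDr.
  move: zE; move: (4 ^+ q * y ^+ 2) (z * EDq) (z ^+ 2) (z * rho ^+ q) => a1 a2 a3 a4.
  by lra.
set a := (16 * k * G * rho) ^+ q.
set u := (4 * k) ^+ q in zy.
have aE : a = 4 ^+ q * (u * y).
  by rewrite /a /u /y -!exprMn; congr (_ ^+ _); ring.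
have four : (4 : R) ^+ q <= u.
  by rewrite /u lerXn2r ?nnegrE//; [nonneg|rewrite ler_peMr].
have four0 : 4 <= (4 : R) ^+ q by rewrite -[leLHS]expr1 ler_weXn2l// ler1n.
have u1 : 1 <= u by rewrite (le_trans _ four)// (le_trans _ four0)// ler1n.
have u0 : 0 <= u by apply: le_trans u1.
have yuy : y <= u * y by rewrite ler_peMl// ltW.
have uy0 : 0 < u * y by apply: lt_le_trans yuy.
have E2 : ED <= a ^+ 2.
  apply: (le_trans E1).
  have z2 : z ^+ 2 <= (u * y) ^+ 2 by rewrite lerXn2r ?nnegrE// ltW.
  have zr : z * rho ^+ q <= (u * y) ^+ 2.
    by rewrite expr2 ler_pM// ?(ltW z0)// (le_trans ry).
  have fy : 4 ^+ q * y ^+ 2 <= (u * y) ^+ 2.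
    rewrite exprMn; apply: ler_wpM2r; first exact: sqr_ge0.
    by rewrite (le_trans four)// expr2 ler_peMl.
  have : 16 * (u * y) ^+ 2 <= a ^+ 2.
    rewrite aE [leRHS]exprMn; apply: ler_wpM2r; first exact: sqr_ge0.
    have -> : (16 : R) = 4 ^+ 2 by rewrite expr2 -natrM.
    by rewrite lerXn2r ?nnegrE// (le_trans _ four0).
  have := sqr_ge0 (u * y).
  move: z2 zr fy.
  move: ((u * y) ^+ 2) (z ^+ 2) (z * rho ^+ q) (4 ^+ q * y ^+ 2) (a ^+ 2) => b1 b2 b3 b4 b5.
  lra.
have a0 : 0 < a by rewrite aE mulr_gt0// exprn_gt0.
apply: le_trans (am _ a0) _.
have : ED / (2 * a) <= a / 2.
  rewrite ler_pdivrMr ?mulr_gt0//.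
  by rewrite (le_trans E2)// expr2 le_eqVlt; apply/orP; left; apply/eqP; field.
by move: (ED / (2 * a)) => b; lra.
Qed.

End MomentAlgebra.

(** * Moments of the supremum of an empirical process *)

(** The numerical constant produced by symmetrization and chaining, locked so
    that it behaves as a variable. *)
Definition chain_const {R : realType} : R := locked 8192.

Lemma chain_constE {R : realType} : chain_const = 8192 :> R.
Proof. by rewrite /chain_const -lock. Qed.

Lemma chain_const_ge1 {R : realType} : 1 <= chain_const :> R.
Proof. by rewrite chain_constE ler1n. Qed.

Section MomentInequality.
Context d (T : measurableType d) (R : realType) (P : probability T R).
Context dS (S : measurableType dS) (Z : nat -> T -> S).
Context (I B M : finType) (s : B * M -> nat) (s0 : M -> nat).
Hypotheses (iZ : iid P Z) (inj_s : injective s) (inj_s0 : injective s0).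
Implicit Types (g f : I -> (M -> S) -> R).

Let blk := block Z s.
(** The expectation of h at a block of distinct sample points; s0 only selects a
    reference block. *)
Definition block_mean (h : (M -> S) -> R) : R :=
  Rintegral P setT (fun w => h (fun j => Z (s0 j) w)).

Lemma block_mean_eq (h : (M -> S) -> R) b : bmeasJ h ->
  Rintegral P setT (fun w => h (blk b w)) = block_mean h.
Proof.
move=> bh; apply: (@Ex_exchange _ T R P _ S Z M (fun j => s (b, j)) s0 h) => //.
by move=> j j' /inj_s [].
Qed.

Definition sqsum g w : R := fmax predT (fun i => \sum_b g i (blk b w) ^+ 2).

Lemma bmeas_sqsum g : (forall i, bmeasJ (g i)) -> bmeas (sqsum g).
Proof.
move=> bg; apply: bmeas_fmax => i _; apply: bmeas_sum => b _; apply: bmeasX.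
exact: (bmeas_block s iZ bg).
Qed.

(** Symmetrization followed by chaining conditionally on the sample. *)
Lemma symmetrized_chaining g (q v : nat) (rho : R) : (0 < v)%N -> (v.*2 <= q)%N ->
  0 <= rho -> (forall i, bmeasJ (g i)) ->
  (forall (x : B -> M -> S) (l : nat), exists t : pred I,
     #|t|%:R <= 4 ^+ q * 4 ^+ (l * v) :> R /\
     forall i, exists2 c, t c &
       \sum_b (g i (x b) - g c (x b)) ^+ 2 <= rho / 16 ^+ l) ->
  Rintegral P setT (fun w =>
    fmax predT (fun i => `|\sum_b (g i (blk b w) - block_mean (g i))|) ^+ q.*2) <=
  (chain_const * q%:R) ^+ q * (Rintegral P setT (fun w => sqsum g w ^+ q) + rho ^+ q).
Proof.
move=> v0 vq rho0 bg nets.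
have q0 : (0 < q)%N by lia.
have bD : bmeas (fun w => sqsum g w ^+ q) by apply: bmeasX; exact: bmeas_sqsum.
have := symmetrization iZ inj_s bg (fun i b => block_mean_eq b (bg i)) q0.
move=> /le_trans; apply.
set c : R := 2 * 4 ^+ q * (128 * q%:R) ^+ q.
have c0 : 0 <= c by rewrite /c; nonneg.
apply: (@le_trans _ _ (2 ^+ q.*2 * 2 * (c *
    (Rintegral P setT (fun w => sqsum g w ^+ q) + rho ^+ q)))).
  apply: ler_wpM2l; first by nonneg.
  have -> : c * (Rintegral P setT (fun w => sqsum g w ^+ q) + rho ^+ q) =
      Rintegral P setT (fun w => c * (sqsum g w ^+ q + rho ^+ q)).
    by rewrite ExZ ?ExD ?Ex_cst//; [exact: bmeas_cst|apply: bmeasD => //; exact: bmeas_cst].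
  apply: le_Ex => [||w].
  - apply: bmeasM; first exact: bmeas_cst.
    apply: bmeas_sum => eps _; apply: bmeas_maxX => i _.
    exact: (bmeas_rsum s iZ bg).
  - apply: bmeasM; first exact: bmeas_cst.
    by apply: bmeasD => //; exact: bmeas_cst.
  - apply: (@chaining R I B (fun i b => g i (blk b w)) q v _ rho (sqsum g w)) => //.
    + exact: fmax_ge0.
    + by rewrite exprn_ege1// ler1n.
    + by move=> i; exact: (le_fmax (fun i => \sum_b g i (blk b w) ^+ 2)).
rewrite mulrA; apply: ler_wpM2r.
  by rewrite addr_ge0 ?exprn_ge0// Ex_ge0// => w; rewrite exprn_ge0// fmax_ge0.
have -> : 2 ^+ q.*2 = 4 ^+ q :> R.
  by rewrite -mul2n exprM; congr (_ ^+ _); rewrite expr2 -natrM.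
have -> : chain_const * q%:R = 4 * 4 * 4 * (128 * q%:R) :> R.
  by rewrite chain_constE mulrA; congr (_ * _); rewrite -!natrM.
rewrite /c [leRHS]exprMn.
have -> : 4 ^+ q * 2 * (2 * 4 ^+ q * (128 * q%:R) ^+ q) =
  4 * (4 ^+ q * 4 ^+ q) * (128 * q%:R) ^+ q :> R.
  by rewrite [in RHS](_ : 4 * _ = 2 * 2 * (4 ^+ q * 4 ^+ q)); [ring|congr (_ * _); rewrite -natrM].
apply: ler_wpM2r; first by nonneg.
rewrite -exprMn mulrC [leRHS]exprMn; apply: ler_wpM2l; first by nonneg.
by rewrite -[leLHS]expr1 ler_weXn2l// ler1n.
Qed.

(** Chaining bounds the 2q-th moment of the supremum by the q-th moment of the
    maximal sum of squares.  That sum exceeds its mean by the supremum of the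
    empirical process indexed by the squares, which is bounded by the same
    argument since squaring is 2-Lipschitz on [-1, 1]; the resulting inequality
    is solved by [self_bound_algebra].  The outcome is the Gaussian order
    sqrt(q |B| tau), valid as long as q is at most of order |B| tau. *)
Theorem empirical_moment f (Fam : set ((M -> S) -> R)) (A tau G : R) (v q : nat) :
  (forall i, bmeasJ (f i)) -> (forall i z, `|f i z| <= 1) ->
  unif_cover Fam A v -> (forall i, Fam (f i)) ->
  0 < tau <= 1 -> 0 <= A -> (0 < v)%N -> (4 * v <= q)%N ->
  (16 * A / tau) ^+ v <= 4 ^+ q ->
  1 <= G -> q%:R <= G * (#|B|%:R * tau) ->
  (forall i, block_mean (fun z => f i z ^+ 2) <= G * tau) ->
  Rintegral P setT (fun w =>
    fmax predT (fun i => `|\sum_b (f i (blk b w) - block_mean (f i))|) ^+ q.*2) <=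
  (32 * chain_const ^+ 2 * G * q%:R * (#|B|%:R * tau)) ^+ q.
Proof.
have k1 := @chain_const_ge1 R.
have k0 : 0 <= chain_const :> R by apply: le_trans k1.
move=> bf f1 cov Ff /andP[tau0 tau1] A0 v0 vq Aq G1 qG var.
have G0 : 0 <= G by apply: le_trans G1.
set rho := #|B|%:R * tau in qG *.
have rho0 : 0 <= rho by rewrite mulr_ge0// ltW.
have q0 : (0 < q)%N by rewrite (leq_trans _ vq)// muln_gt0.
have v20 : (0 < 2 * v)%N by rewrite muln_gt0.
have vq2 : ((2 * v).*2 <= q)%N by rewrite -mul2n mulnA.
have netsize (cst : R) (l : nat) : 0 <= cst <= 16 ->
    (cst * A / (tau / 16 ^+ l)) ^+ v <= 4 ^+ q * 4 ^+ (l * (2 * v)).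
  move=> /andP[cst0 cst16].
  have -> : cst * A / (tau / 16 ^+ l) = (cst * A / tau) * 16 ^+ l.
    by field; rewrite gt_eqF//= expf_neq0.
  rewrite exprMn.
  have -> : (16 ^+ l) ^+ v = 4 ^+ (l * (2 * v)) :> R.
    have -> : (16 : R) = 4 ^+ 2 by rewrite expr2 -natrM.
    by rewrite -!exprM; congr (_ ^+ _); clear; lia.
  apply: ler_wpM2r; first exact: exprn_ge0.
  apply: le_trans Aq; rewrite lerXn2r ?nnegrE//.
  - by rewrite divr_ge0 ?mulr_ge0// ltW.
  - by rewrite divr_ge0 ?mulr_ge0// ltW.
  - by rewrite ler_wpM2r ?invr_ge0 ?(ltW tau0)// ler_wpM2r.
(* cst = 1 serves the class and cst = 4 the class of its squares. *)
have nets (x : B -> M -> S) (l : nat) (cst : R) : 1 <= cst <= 4 -> exists t : pred I,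
     #|t|%:R <= 4 ^+ q * 4 ^+ (l * (2 * v)) :> R /\
     forall i, exists2 c, t c &
       \sum_b (f i (x b) - f c (x b)) ^+ 2 <= rho / 16 ^+ l / cst.
  move=> /andP[cst1 cst4].
  have cst0 : 0 < cst by rewrite (lt_le_trans _ cst1).
  have l16 : 1 <= (16 : R) ^+ l by rewrite exprn_ege1// ler1n.
  have l16' : 0 < (16 : R) ^+ l by rewrite exprn_gt0.
  have dlt : 0 < tau / 16 ^+ l / cst <= 1.
    rewrite !divr_gt0//= ler_pdivrMr// mul1r ler_pdivrMr// (le_trans tau1)//.
    exact: mulr_ege1.
  have [t [ct ht]] := cover_subfamily cov Ff x dlt.
  exists t; split.
    apply: le_trans ct _.
    have -> : 4 * A / (tau / 16 ^+ l / cst) = (4 * cst) * A / (tau / 16 ^+ l).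
      by field; rewrite !gt_eqF.
    apply: netsize; rewrite mulr_ge0 ?(ltW cst0)//=.
    by rewrite (_ : 16 = 4 * 4); [rewrite ler_wpM2l|rewrite -natrM].
  move=> i; have [c tc hc] := ht i; exists c => //.
  by apply: (le_trans hc); rewrite /rho !mulrA.
have bf2 i : bmeasJ (fun z => f i z ^+ 2) by exact: (bmeasX 2 (bf i)).
have f2_1 i z : f i z ^+ 2 <= 1.
  by rewrite -real_normK ?num_real// exprn_ile1.
have bD := bmeas_sqsum bf.
have D0 w : 0 <= sqsum f w by exact: fmax_ge0.
have M1 : Rintegral P setT (fun w =>
    fmax predT (fun i => `|\sum_b (f i (blk b w) - block_mean (f i))|) ^+ q.*2) <=
    (chain_const * q%:R) ^+ q * (Rintegral P setT (fun w => sqsum f w ^+ q) + rho ^+ q).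
  apply: (symmetrized_chaining v20 vq2) => // x l.
  have [|t [ct ht]] := nets x l 1; first by rewrite lexx ler1n.
  exists t; split=> // i; have [c tc] := ht i; rewrite divr1 => hc; by exists c.
set f2 := fun i z => f i z ^+ 2 in bf2.
have M2 : Rintegral P setT (fun w =>
    fmax predT (fun i => `|\sum_b (f2 i (blk b w) - block_mean (f2 i))|) ^+ q.*2) <=
    (chain_const * q%:R) ^+ q * (Rintegral P setT (fun w => sqsum f w ^+ q) + rho ^+ q).
  have : Rintegral P setT (fun w =>
    fmax predT (fun i => `|\sum_b (f2 i (blk b w) - block_mean (f2 i))|) ^+ q.*2) <=
    (chain_const * q%:R) ^+ q * (Rintegral P setT (fun w => sqsum f2 w ^+ q) + rho ^+ q).
    apply: (symmetrized_chaining v20 vq2) => // x l.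
    have [|t [ct ht]] := nets x l 4; first by rewrite lexx ler1n.
    exists t; split=> // i; have [c tc hc] := ht i; exists c => //.
    apply: (@le_trans _ _ (4 * \sum_b (f i (x b) - f c (x b)) ^+ 2)); last first.
      by rewrite mulrC -ler_pdivlMr.
    rewrite mulr_sumr; apply: ler_sum => b _.
    have -> : f2 i (x b) - f2 c (x b) = (f i (x b) - f c (x b)) * (f i (x b) + f c (x b)).
      by rewrite /f2 subr_sqr.
    rewrite exprMn mulrC; apply: ler_wpM2r; first exact: sqr_ge0.
    rewrite -real_normK ?num_real// (_ : 4 = 2 ^+ 2); last by rewrite expr2 -natrM.
    rewrite lerXn2r ?nnegrE// (le_trans (ler_normD _ _))//.
    by rewrite (_ : 2 = 1 + 1)// lerD.
  move=> /le_trans; apply.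
  apply: ler_wpM2l; first by rewrite exprn_ge0// mulr_ge0.
  rewrite lerD2r; apply: le_Ex => [||w].
  - by apply: bmeasX; exact: bmeas_sqsum.
  - exact: bmeasX.
  - rewrite lerXn2r ?nnegrE ?fmax_ge0//.
    apply: fmax_le => [|i _]; first exact: D0.
    apply: le_trans (le_fmax (fun i => \sum_b f i (blk b w) ^+ 2) (isT : predT i)).
    apply: ler_sum => b _; rewrite /f2 [leLHS]expr2 -[leRHS]mulr1.
    by rewrite ler_wpM2l ?sqr_ge0.
pose s2 w := fmax predT (fun i => `|\sum_b (f2 i (blk b w) - block_mean (f2 i))|).
have bs2 : bmeas (fun w => s2 w ^+ q.*2).
  apply: bmeas_maxX => i _; apply: bmeas_sum => b _.
  by apply: bmeasB; [exact: (bmeas_block s iZ bf2)|exact: bmeas_cst].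
have Ds w : sqsum f w <= G * rho + s2 w.
  apply: fmax_le => [|i _].
    by rewrite addr_ge0 ?fmax_ge0// mulr_ge0// (le_trans _ G1).
  have -> : \sum_b f i (blk b w) ^+ 2 =
      #|B|%:R * block_mean (f2 i) + \sum_b (f2 i (blk b w) - block_mean (f2 i)).
    by rewrite sumrB sumr_const -[block_mean _ *+ _]mulr_natl addrC subrK.
  apply: lerD.
    by rewrite /rho mulrCA; apply: ler_wpM2l => //; exact: var.
  apply: le_trans (le_fmax (fun i => `|\sum_b (f2 i (blk b w) - block_mean (f2 i))|) (isT : predT i)).
  exact: ler_norm.
have EDq : Rintegral P setT (fun w => sqsum f w ^+ q) <=
    (16 * chain_const * G * rho) ^+ q.
  apply: (self_bound_algebra (ED := Rintegral P setT (fun w => sqsum f w ^+ q.*2))) => //.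
  - apply: (@le_trans _ _ (4 ^+ q * ((G * rho) ^+ q.*2 +
      Rintegral P setT (fun w => s2 w ^+ q.*2)))).
      have -> : 4 ^+ q * ((G * rho) ^+ q.*2 + Rintegral P setT (fun w => s2 w ^+ q.*2)) =
          Rintegral P setT (fun w => 4 ^+ q * ((G * rho) ^+ q.*2 + s2 w ^+ q.*2)).
        by rewrite ExZ ?ExD ?Ex_cst//; [exact: bmeas_cst|apply: bmeasD => //; exact: bmeas_cst].
      apply: le_Ex => [||w].
      + exact: bmeasX.
      + by apply: bmeasM; [exact: bmeas_cst|apply: bmeasD => //; exact: bmeas_cst].
      + have -> : 4 ^+ q = 2 ^+ q.*2 :> R.
          by rewrite -mul2n exprM; congr (_ ^+ _); rewrite expr2 -natrM.
        have Gr : 0 <= G * rho by rewrite mulr_ge0// (le_trans _ G1).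
        apply: le_trans (exprD_le _ Gr (fmax_ge0 _ _)).
        by rewrite lerXn2r ?nnegrE ?addr_ge0 ?fmax_ge0.
    rewrite mulrDr lerD2l -(mulrA 4) [(4 * _) ^+ q]exprMn -mulrA.
    by apply: ler_wpM2l; [exact: exprn_ge0|exact: M2].
  - move=> a a0.
    have -> : a / 2 + Rintegral P setT (fun w => sqsum f w ^+ q.*2) / (2 * a) =
        Rintegral P setT (fun w => a / 2 + (2 * a)^-1 * sqsum f w ^+ q.*2).
      rewrite ExD; [|exact: bmeas_cst|apply: bmeasM; [exact: bmeas_cst|exact: bmeasX]].
      by rewrite Ex_cst ExZ; [congr (_ + _); exact: mulrC|exact: bmeasX].
    apply: le_Ex => [||w].
    + exact: bmeasX.
    + apply: bmeasD; first exact: bmeas_cst.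
      by apply: bmeasM; [exact: bmeas_cst|exact: bmeasX].
    + rewrite -subr_ge0.
      have -> : a / 2 + (2 * a)^-1 * sqsum f w ^+ q.*2 - sqsum f w ^+ q =
          (2 * a)^-1 * (sqsum f w ^+ q - a) ^+ 2.
        by rewrite -muln2 exprM; field; rewrite gt_eqF.
      by rewrite mulr_ge0 ?sqr_ge0// invr_ge0 mulr_ge0// ltW.
apply: (le_trans M1).
have rho_le : rho ^+ q <= (16 * chain_const * G * rho) ^+ q.
  rewrite lerXn2r ?nnegrE//.
    by rewrite mulr_ge0// !mulr_ge0// (le_trans _ G1).
  by rewrite -{1}[rho]mul1r ler_wpM2r// !mulr_ege1 ?chain_const_ge1// ler1n.
apply: (@le_trans _ _ ((chain_const * q%:R) ^+ q * (2 * (16 * chain_const * G * rho) ^+ q))).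
  apply: ler_wpM2l; first by rewrite exprn_ge0// mulr_ge0.
  by rewrite (_ : 2 = 1 + 1)// mulrDl mul1r lerD.
rewrite mulrCA -exprMn.
have -> : 32 * chain_const ^+ 2 * G * q%:R * rho =
    2 * (chain_const * q%:R * (16 * chain_const * G * rho)).
  rewrite expr2 (_ : 32 = 2 * 16); last by rewrite -natrM.
  by move: (@chain_const R) => k; ring.
rewrite [leRHS]exprMn; apply: ler_wpM2r.
  apply: exprn_ge0; apply: mulr_ge0; first exact: mulr_ge0.
  by do 3 (apply: mulr_ge0 => //).
by rewrite -[leLHS]expr1 ler_weXn2l// ler1n.
Qed.

End MomentInequality.

(** * U-statistics and a maximal inequality over sample sizes *)

Section SequenceFunctionals.
Context d (T : measurableType d) (R : realType) (P : probability T R).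
Context dS (S : measurableType dS) (Z : nat -> T -> S).
Hypothesis iZ : iid P Z.

(** The sequence through which functionals of the first n points factor. *)
Definition extend n (y : 'I_n -> S) : nat -> S :=
  fun k => if insub k is Some i then y i else point.

Lemma extendE n (z : nat -> S) k : (k < n)%N -> extend (fun i : 'I_n => z i) k = z k.
Proof. by move=> kn; rewrite /extend insubT. Qed.

Lemma measurable_extend n k :
  measurable_fun setT (fun t => extend (@fun_of_tuple _ S 'I_n t) k).
Proof. by rewrite /extend; case: insub => [i|] //; exact: measurable_fun_of_tuple. Qed.

(** Exchangeability for functionals that read only the first n points of an
    infinite sequence. *)
Lemma Ex_exchange_seq n (F : (nat -> S) -> R) (s : nat -> nat) :
  (forall z z', (forall k, (k < n)%N -> z k = z' k) -> F z = F z') ->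
  bmeas (fun t => F (extend (@fun_of_tuple _ S 'I_n t))) -> injective s ->
  Rintegral P setT (fun w => F (fun k => Z (s k) w)) =
  Rintegral P setT (fun w => F (Z ^~ w)).
Proof.
move=> dF bF inj_s.
have := @Ex_exchange _ T R P _ S Z 'I_n (fun i => s i) (fun i => i)
  (fun y => F (extend y)) iZ (fun i j e => ord_inj (inj_s _ _ e)) (@ord_inj n) bF.
rewrite (_ : (fun w => F (extend _)) = (fun w => F (fun k => Z (s k) w))); last first.
  by apply/funext => w; apply: dF => k kn; rewrite (extendE (fun k => Z (s k) w)).
rewrite (_ : (fun w => F (extend _)) = (fun w => F (Z ^~ w)))//.
by apply/funext => w; apply: dF => k kn; rewrite (extendE (fun k => Z k w)).
Qed.

End SequenceFunctionals.

Lemma bmeas_ltr d (T : measurableType d) (R : realType) (g : T -> R) (x : R) :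
  bmeas g -> bmeas (fun w => (x < g w)%R%:R : R).
Proof.
move=> [mg _]; rewrite (_ : (fun _ => _) = \1_(g @^-1` `]x, +oo[) :> (T -> R)).
  by apply: bmeas_indic; rewrite -[X in measurable X]setTI; exact: mg.
apply/funext => w; rewrite indicE.
have -> // : (w \in g @^-1` `]x, +oo[) = (x < g w).
by apply/idP/idP; rewrite inE /= in_itv/= andbT.
Qed.

Lemma bmeas_prod d (T : measurableType d) (R : realType) (I : Type) (s : seq I)
    (g : I -> T -> R) :
  (forall i, bmeas (g i)) -> bmeas (fun w => \prod_(i <- s) g i w).
Proof.
move=> bg; elim: s => [|i s IH].
  by under eq_fun do rewrite big_nil; exact: bmeas_cst.
under eq_fun do rewrite big_cons; exact: bmeasM.
Qed.

Section UStatistics.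
Context (R : realType) (S : Type) (m : nat).
Implicit Types (h : ('I_m -> S) -> R) (z : nat -> S).

(** The U-statistic of order m with kernel h. *)
Definition ustat_avg n h z : R :=
  (n - m)`!%:R / n`!%:R *
  \sum_(i : {ffun 'I_m -> 'I_n} | injectiveb i) h (fun j => z (i j)).

Lemma ustat_avg_local n h z z' : (forall k, (k < n)%N -> z k = z' k) ->
  ustat_avg n h z = ustat_avg n h z'.
Proof.
move=> zz'; congr (_ * _); apply: eq_bigr => i _; congr h.
by apply/funext => j; exact: zz'.
Qed.

Lemma ustat_avg_sym n h z (g : nat -> nat) : injective g ->
  (forall k, (k < n)%N -> (g k < n)%N) -> ustat_avg n h (z \o g) = ustat_avg n h z.
Proof.
move=> inj_g gn; congr (_ * _).
pose G (k : 'I_n) : 'I_n := Ordinal (gn k (ltn_ord k)).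
have inj_G : injective G by move=> k l /(congr1 val) /= /inj_g /val_inj.
rewrite [RHS](reindex_inj (h := fun i : {ffun 'I_m -> 'I_n} => [ffun j => G (i j)])); last first.
  by move=> i i' /ffunP E; apply/ffunP => j; have := E j; rewrite !ffunE => /inj_G.
apply: eq_big => [i|i _].
  apply/injectiveP/injectiveP => ii x y; first by rewrite !ffunE => /inj_G/ii.
  by move=> xy; apply: ii; rewrite !ffunE xy.
by congr h; apply/funext => j; rewrite ffunE.
Qed.

Definition lift_perm n (s : 'S_n) (k : nat) : nat :=
  if insub k is Some i then val (s i) else k.

Lemma lift_permE n (s : 'S_n) (i : 'I_n) : lift_perm s i = s i.
Proof. by rewrite /lift_perm valK. Qed.

Lemma lift_perm_out n (s : 'S_n) k : (n <= k)%N -> lift_perm s k = k.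
Proof. by move=> nk; rewrite /lift_perm insubF// ltnNge nk. Qed.

Lemma lift_perm_ltn n (s : 'S_n) n' k : (n <= n')%N -> (k < n')%N ->
  (lift_perm s k < n')%N.
Proof.
move=> nn kn; case: (ltnP k n) => k_n; last by rewrite lift_perm_out.
by rewrite (lift_permE s (Ordinal k_n)) (leq_trans _ nn).
Qed.

Lemma lift_perm_inj n (s : 'S_n) : injective (lift_perm s).
Proof.
move=> k l; case: (ltnP k n) => kn; case: (ltnP l n) => ln.
- rewrite (lift_permE s (Ordinal kn)) (lift_permE s (Ordinal ln)).
  by move=> /val_inj/perm_inj/(congr1 val).
- rewrite (lift_permE s (Ordinal kn)) (lift_perm_out s ln) => E.
  by have := ltn_ord (s (Ordinal kn)); rewrite E ltnNge ln.
- rewrite (lift_permE s (Ordinal ln)) (lift_perm_out s kn) => E.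
  by have := ltn_ord (s (Ordinal ln)); rewrite -E ltnNge kn.
- by rewrite !lift_perm_out.
Qed.

Definition block_index r (k : 'I_r * 'I_m) : nat := k.1 * m + k.2.

Lemma block_index_inj r : injective (@block_index r).
Proof.
move=> [b j] [b' j']; rewrite /block_index /= => E.
have m0 : (0 < m)%N by exact: leq_ltn_trans (leq0n j) (ltn_ord j).
have eb : b = b' :> nat.
  by have := congr1 (divn^~ m) E; rewrite !divnMDl// !divn_small// !addn0.
have ej : j = j' :> nat by move: E; rewrite eb => /addnI.
by congr pair; apply: val_inj.
Qed.

Lemma block_index_ltn r (k : 'I_r * 'I_m) : (block_index k < r * m)%N.
Proof.
case: k => [b j]; rewrite /block_index /= (@leq_trans (b.+1 * m)) ?leq_mul2r ?ltn_ord ?orbT//.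
by rewrite mulSn addnC ltn_add2r.
Qed.

(** Hoeffding's representation: for a fixed block, the average over permutations
    of the sample is the full U-statistic, hence so is the average of r disjoint
    blocks.  Each inner sum has independent terms. *)
Lemma hoeffding_average n r h z : (0 < r)%N -> (r * m <= n)%N ->
  ustat_avg n h z = fmean (fun s : 'S_n =>
    r%:R^-1 * \sum_(b < r) h (fun j => z (lift_perm s (block_index (b, j))))).
Proof.
move=> r0 rn.
have bn (b : 'I_r) j : (block_index (b, j) < n)%N by rewrite (leq_trans (block_index_ltn _)).
have E (b : 'I_r) : fmean (fun s : 'S_n => h (fun j => z (lift_perm s (block_index (b, j))))) =
    ustat_avg n h z.
  rewrite /ustat_avg -(@fmean_perm _ n m (fun j => Ordinal (bn b j))
    (fun i => h (fun j => z (i j)))); last first.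
    by move=> j j' /(congr1 val) /= /(@block_index_inj r) [].
  congr fmean; apply/funext => s; congr h; apply/funext => j.
  by rewrite ffunE (lift_permE s (Ordinal (bn b j))).
rewrite fmeanZ fmean_sum (eq_bigr (fun=> ustat_avg n h z)); last by move=> b _; exact: E.
by rewrite sumr_const card_ord -[ustat_avg n h z *+ r]mulr_natl mulKf// pnatr_eq0 -lt0n.
Qed.

Section Family.
Context (I : finType) (f : I -> ('I_m -> S) -> R) (e : I -> R).

Definition ustat_sup n z : R := fmax predT (fun i => `|ustat_avg n (f i) z - e i|).
Definition block_sup r z : R :=
  fmax predT (fun i => `|\sum_(b < r) (f i (fun j => z (block_index (b, j))) - e i)|).

Lemma block_sup_local r n z z' : (r * m <= n)%N ->
  (forall k, (k < n)%N -> z k = z' k) -> block_sup r z = block_sup r z'.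
Proof.
move=> rn zz'; congr fmax; apply/funext => i; congr (`| _ |); apply: eq_bigr => b _.
congr (f i _ - _); apply/funext => j; apply: zz'.
by rewrite (leq_trans (block_index_ltn _)).
Qed.

Lemma ustat_sup_local n z z' : (forall k, (k < n)%N -> z k = z' k) -> ustat_sup n z = ustat_sup n z'.
Proof.
by move=> zz'; congr fmax; apply/funext => i; rewrite (ustat_avg_local _ zz').
Qed.

Lemma ustat_sup_sym n z (g : nat -> nat) : injective g ->
  (forall k, (k < n)%N -> (g k < n)%N) -> ustat_sup n (z \o g) = ustat_sup n z.
Proof. by move=> ig gn; congr fmax; apply/funext => i; rewrite ustat_avg_sym. Qed.

(** By convexity the supremum over the family and the even power pass through the
    average over permutations. *)
Lemma ustat_sup_le_average n r z q : (0 < r)%N -> (r * m <= n)%N ->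
  ustat_sup n z ^+ q.*2 <= fmean (fun s : 'S_n => (r%:R^-1 * block_sup r (z \o lift_perm s)) ^+ q.*2).
Proof.
move=> r0 rn.
have Sn0 : (0 < #|{perm 'I_n}|)%N by rewrite card_Sn fact_gt0.
apply: le_trans (fmean_jensen q _ Sn0).
have b0 s : 0 <= r%:R^-1 * block_sup r (z \o lift_perm s) :> R.
  by rewrite mulr_ge0 ?invr_ge0// fmax_ge0.
rewrite lerXn2r ?nnegrE ?fmax_ge0 ?fmean_ge0//.
apply: fmax_le => [|i _]; first exact: fmean_ge0.
have rn0 : r%:R != 0 :> R by rewrite pnatr_eq0 -lt0n.
have -> : ustat_avg n (f i) z - e i = fmean (fun s : 'S_n => r%:R^-1 *
    \sum_(b < r) (f i (fun j => z (lift_perm s (block_index (b, j)))) - e i)).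
  rewrite (hoeffding_average _ _ r0 rn) -[e i in LHS](fmean_cst _ Sn0).
  rewrite -mulN1r -fmeanZ -fmeanD; congr fmean; apply/funext => s.
  by rewrite sumrB sumr_const card_ord -[e i *+ r]mulr_natl mulrBr mulKf// mulN1r.
rewrite (@le_trans _ _ (fmean (fun s : 'S_n => `|r%:R^-1 *
    \sum_(b < r) (f i (fun j => z (lift_perm s (block_index (b, j)))) - e i)|)))//.
  rewrite /fmean normrM ger0_norm ?invr_ge0//.
  by rewrite ler_wpM2l ?invr_ge0// ler_norm_sum.
apply: le_fmean => s; rewrite normrM ger0_norm ?invr_ge0//.
rewrite ler_wpM2l ?invr_ge0//.
exact: (le_fmax (fun i => `|\sum_(b < r) (f i (fun j => z (lift_perm s (block_index (b, j)))) - e i)|)).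
Qed.

End Family.
End UStatistics.

Section MaximalInequality.
Context d (T : measurableType d) (R : realType) (P : probability T R).
Context dS (S : measurableType dS) (Z : nat -> T -> S) (m : nat).
Context (I : finType) (f : I -> ('I_m -> S) -> R) (e : I -> R).
Hypotheses (iZ : iid P Z) (bf : forall i, bmeasJ (f i)).

Lemma bmeas_ustat_avg d' (T' : measurableType d') (W : nat -> T' -> S) n i :
  (forall k, measurable_fun setT (W k)) -> bmeas (fun w => ustat_avg n (f i) (W ^~ w)).
Proof.
move=> mW; apply: bmeasM; first exact: bmeas_cst.
apply: bmeas_sum => j _.
exact: (@bmeasJ_comp _ S R 'I_m _ T' (fun k => W (j k))).
Qed.

Lemma bmeas_ustat_sup d' (T' : measurableType d') (W : nat -> T' -> S) n :
  (forall k, measurable_fun setT (W k)) -> bmeas (fun w => ustat_sup f e n (W ^~ w)).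
Proof.
move=> mW; apply: bmeas_fmax => i _; apply: bmeas_norm; apply: bmeasB.
  exact: bmeas_ustat_avg.
exact: bmeas_cst.
Qed.

Lemma bmeas_block_sup d' (T' : measurableType d') (W : nat -> T' -> S) r :
  (forall k, measurable_fun setT (W k)) -> bmeas (fun w => block_sup f e r (W ^~ w)).
Proof.
move=> mW; apply: bmeas_fmax => i _; apply: bmeas_norm; apply: bmeas_sum => b _.
apply: bmeasB; last exact: bmeas_cst.
exact: (@bmeasJ_comp _ S R 'I_m _ T' (fun j => W (block_index (b, j)))).
Qed.

(** Doob's inequality for the reverse submartingale [ustat_sup], without
    conditional expectations.  Split the event according to the last n in the
    block at which the level x is exceeded.  That piece is described by the
    statistics of sample sizes at least n, which are symmetric in the first n
    points; on it the 2q-th power is at most the average over permutations of the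
    block sums, and by exchangeability each permutation contributes the same.
    Summing over n leaves the moment of one block sum, for the smallest sample
    size. *)
Theorem ustat_sup_maximal_inequality (n1 n2 r q : nat) (x : R) :
  (0 < r)%N -> (r * m <= n1)%N -> 0 < x ->
  let E := [set w | exists2 n, (n1 <= n <= n2)%N & x < ustat_sup f e n (Z ^~ w)] in
  measurable E /\
  (P E <= ((r%:R * x) ^- q.*2 * Rintegral P setT (fun w => block_sup f e r (Z ^~ w) ^+ q.*2))%:E)%E.
Proof.
move=> r0 rn1 x0 E; have [mZ _ _] := iZ.
pose N := n2.+1.
pose ind k z : R := ((n1 <= k)%N && (x < ustat_sup f e k z)%R)%:R.
pose G n z := \prod_(n <= k < N) (1 - ind k z).
pose L n z := ind n z * G n.+1 z.
have ind01 k z : 0 <= ind k z <= 1.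
  by rewrite /ind; case: ((n1 <= k)%N && (x < _)); rewrite ?lexx ?ler01.
have G01 n z : 0 <= G n z <= 1.
  rewrite /G; elim: (index_iota n N) => [|k s /andP[IH0 IH1]].
    by rewrite big_nil lexx ler01.
  have /andP[i0 i1] := ind01 k z.
  rewrite big_cons mulr_ge0 ?subr_ge0//= mulr_ile1 ?subr_ge0//.
  by rewrite gerBl.
have L0 n z : 0 <= L n z.
  by have /andP[i0 _] := ind01 n z; have /andP[g0 _] := G01 n.+1 z; rewrite mulr_ge0.
(* L n is the indicator that n is the last exceedance, written as a product so
   that it is measurable and that the sum telescopes. *)
have sumL z : \sum_(0 <= n < N) L n z = 1 - G 0%N z.
  have LG n : (n < N)%N -> L n z = G n.+1 z - G n z.
    by move=> nN; rewrite /L [G n z]/G big_ltn//= -/(G n.+1 z); ring.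
  rewrite (eq_big_nat _ _ (F2 := fun n => G n.+1 z - G n z)); last first.
    by move=> n /andP[_ nN]; exact: LG.
  by rewrite telescope_sumr// /G big_geq.
have bind d' (T' : measurableType d') (W : nat -> T' -> S) k :
    (forall k, measurable_fun setT (W k)) -> bmeas (fun w => ind k (W ^~ w)).
  move=> mW; rewrite /ind; case: (n1 <= k)%N => /=; last exact: bmeas_cst.
  by apply: bmeas_ltr; exact: bmeas_ustat_sup.
have bG d' (T' : measurableType d') (W : nat -> T' -> S) n :
    (forall k, measurable_fun setT (W k)) -> bmeas (fun w => G n (W ^~ w)).
  move=> mW; apply: bmeas_prod => k; apply: bmeasB; first exact: bmeas_cst.
  exact: bind.
have bL d' (T' : measurableType d') (W : nat -> T' -> S) n :
    (forall k, measurable_fun setT (W k)) -> bmeas (fun w => L n (W ^~ w)).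
  by move=> mW; apply: bmeasM; [exact: bind|exact: bG].
pose Q z : R := (r%:R^-1 * block_sup f e r z) ^+ q.*2.
have Q0 z : 0 <= Q z by rewrite exprn_ge0// mulr_ge0 ?invr_ge0// fmax_ge0.
have bQ d' (T' : measurableType d') (W : nat -> T' -> S) :
    (forall k, measurable_fun setT (W k)) -> bmeas (fun w => Q (W ^~ w)).
  move=> mW; apply: bmeasX; apply: bmeasM; first exact: bmeas_cst.
  exact: bmeas_block_sup.
have step n : (n1 <= n < N)%N ->
    x ^+ q.*2 * Rintegral P setT (fun w => L n (Z ^~ w)) <=
    Rintegral P setT (fun w => Q (Z ^~ w) * L n (Z ^~ w)).
  move=> /andP[n1n nN].
  have rn : (r * m <= n)%N := leq_trans rn1 n1n.
  pose F z := Q z * L n z.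
  have Llocal z z' : (forall k, (k < N)%N -> z k = z' k) -> L n z = L n z'.
    move=> zz'; have il k : (k < N)%N -> ind k z = ind k z'.
      move=> kN; rewrite /ind (@ustat_sup_local R S m I f e k z z')// => l lk.
      by apply: zz'; exact: ltn_trans lk kN.
    rewrite /L il//; congr (_ * _); apply: eq_big_nat => k /andP[_ kN].
    by rewrite il.
  have Lsym z (s : 'S_n) : L n (z \o lift_perm s) = L n z.
    have isym k : (n <= k)%N -> ind k (z \o lift_perm s) = ind k z.
      move=> nk; rewrite /ind ustat_sup_sym//; first exact: lift_perm_inj.
      by move=> l; exact: lift_perm_ltn.
    rewrite /L isym//; congr (_ * _); apply: eq_big_nat => k /andP[nk _].
    by rewrite isym// ltnW.
  have exch (s : 'S_n) : Rintegral P setT (fun w => Q ((Z ^~ w) \o lift_perm s) * L n (Z ^~ w)) =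
      Rintegral P setT (fun w => Q (Z ^~ w) * L n (Z ^~ w)).
    rewrite -[RHS](@Ex_exchange_seq _ T R P _ S Z iZ N F (lift_perm s)).
    - by congr Rintegral; apply/funext => w; rewrite /F -(Lsym (Z ^~ w) s).
    - move=> z z' zz'; rewrite /F (Llocal _ _ zz') /Q (@block_sup_local _ _ _ _ f e r N z z')//.
      by rewrite (leq_trans rn)// ltnW.
    - by apply: bmeasM; [apply: bQ|apply: bL] => k; exact: measurable_extend.
    - exact: lift_perm_inj.
  have Sn0 : (0 < #|{perm 'I_n}|)%N by rewrite card_Sn fact_gt0.
  rewrite -(fmean_cst (Rintegral P setT (fun w => Q (Z ^~ w) * L n (Z ^~ w))) Sn0).
  rewrite (_ : (fun=> _) = (fun s : 'S_n =>
    Rintegral P setT (fun w => Q ((Z ^~ w) \o lift_perm s) * L n (Z ^~ w)))); last first.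
    by apply/funext => s; rewrite exch.
  have bQL (s : 'S_n) : bmeas (fun w => Q ((Z ^~ w) \o lift_perm s) * L n (Z ^~ w)).
    by apply: bmeasM; [apply: (bQ _ _ (fun k => Z (lift_perm s k)))|exact: bL].
  rewrite -Ex_fmean// -ExZ; last exact: bL.
  apply: le_Ex => [||w].
  - by apply: bmeasM; [exact: bmeas_cst|exact: bL].
  - apply: bmeasM; first exact: bmeas_cst.
    by apply: bmeas_sum => s _; exact: bQL.
  - have -> : fmean (fun s : 'S_n => Q ((Z ^~ w) \o lift_perm s) * L n (Z ^~ w)) =
        fmean (fun s : 'S_n => Q ((Z ^~ w) \o lift_perm s)) * L n (Z ^~ w).
      by rewrite /fmean -mulr_suml mulrA.
    have [xu|ux] := ltP x (ustat_sup f e n (Z ^~ w)); last first.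
      have -> : L n (Z ^~ w) = 0 by rewrite /L /ind ltNge ux andbF mul0r.
      by rewrite !mulr0.
    apply: ler_wpM2r; first exact: L0.
    apply: le_trans (ustat_sup_le_average _ _ _ _ r0 rn).
    by rewrite lerXn2r ?nnegrE ?ltW// (lt_le_trans x0)// ltW.
pose E' := [set w | G 0%N (Z ^~ w) = 0].
have EE' : E = E'.
  apply/seteqP; split=> w.
    move=> [n /andP[n1n nn2] xu]; rewrite /E' /G /= (bigD1_seq n) ?iota_uniq//=; last first.
      by rewrite mem_index_iota leq0n.
    by rewrite /ind n1n xu subrr mul0r.
  rewrite /E' /G /= => /eqP; rewrite prodf_seq_eq0 => /hasP[n].
  rewrite mem_index_iota => /andP[_ nN]; rewrite /= subr_eq0 /ind => /eqP h.
  have [/andP[n1n xu]|nh] := boolP ((n1 <= n)%N && (x < ustat_sup f e n (Z^~ w))).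
    by exists n => //; rewrite n1n.
  by move: h; rewrite (negbTE nh) => /eqP; rewrite oner_eq0.
have bGZ := bG _ T Z 0%N mZ.
have mE : measurable E.
  rewrite EE' (_ : E' = (fun w => G 0%N (Z ^~ w)) @^-1` [set 0]); last by [].
  by rewrite -[X in measurable X]setTI; have [mg _] := bGZ; apply: mg.
split=> //.
have PE : P E = (Rintegral P setT (\1_E : T -> R))%:E.
  by rewrite -ExE ?integral_indic ?setIT//; exact: bmeas_indic.
rewrite PE lee_fin exprMn invfM -mulrA mulrCA.
have xq : 0 < x ^+ q.*2 by rewrite exprn_gt0.
rewrite -ler_pdivrMl ?invr_gt0// invrK.
have -> : (r%:R ^+ q.*2)^-1 * Rintegral P setT (fun w => block_sup f e r (Z ^~ w) ^+ q.*2) =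
    Rintegral P setT (fun w => Q (Z ^~ w)).
  rewrite -ExZ; last by apply: bmeasX; exact: bmeas_block_sup.
  by congr Rintegral; apply/funext => w; rewrite /Q exprMn exprVn.
apply: (@le_trans _ _ (x ^+ q.*2 * Rintegral P setT (fun w => \sum_(0 <= n < N) L n (Z ^~ w)))).
  apply: ler_wpM2l; first exact: ltW.
  apply: le_Ex => [||w].
  - exact: bmeas_indic.
  - by apply: bmeas_sum => n _; exact: bL.
  - rewrite sumL indicE; have [wE|wE] := boolP (w \in E); last first.
      by rewrite subr_ge0; have /andP[] := G01 0%N (Z ^~ w).
    by move: wE; rewrite EE' inE /E' /= => ->; rewrite subr0.
rewrite Ex_sum; last by move=> n _; exact: bL.
rewrite mulr_sumr.
apply: (@le_trans _ _ (\sum_(0 <= n < N) Rintegral P setT (fun w => Q (Z ^~ w) * L n (Z ^~ w)))).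
  apply: ler_sum_nat => n /andP[_ nN]; have [n1n|nn1] := leqP n1 n.
    by apply: step; rewrite n1n.
  have L00 z : L n z = 0 by rewrite /L /ind leqNgt nn1 mul0r.
  rewrite (_ : (fun w => L n (Z ^~ w)) = (fun=> 0)); last by apply/funext => w; exact: L00.
  rewrite Ex_cst mulr0; apply: Ex_ge0 => w; exact: mulr_ge0.
rewrite -Ex_sum; last by move=> n _; apply: bmeasM; [exact: bQ|exact: bL].
apply: le_Ex => [||w].
- by apply: bmeas_sum => n _; apply: bmeasM; [exact: bQ|exact: bL].
- exact: bQ.
- rewrite -mulr_sumr sumL; have /andP[g0 g1] := G01 0%N (Z ^~ w).
  by rewrite ler_piMr// gerBl.
Qed.

End MaximalInequality.

(** * Tail bounds for finite and countable families *)

Section TailBound.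
Context d (T : measurableType d) (R : realType) (P : probability T R).
Context dS (S : measurableType dS) (Z : nat -> T -> S) (m : nat).
Hypothesis iZ : iid P Z.

Definition umean (h : ('I_m -> S) -> R) : R := block_mean P Z (fun j : 'I_m => j : nat) h.

Definition tail_const (G : R) : R := 128 * chain_const ^+ 2 * G.

(** Markov's inequality for the moment of order 2q.  The factor 4 between
    [tail_const] and the constant of [empirical_moment] is what leaves 4^-q. *)
Lemma finite_tail (I : finType) (f : I -> ('I_m -> S) -> R)
    (Fam : set (('I_m -> S) -> R)) (A tau G x : R) (v q n1 n2 r : nat) :
  (forall i, bmeasJ (f i)) -> (forall i z, `|f i z| <= 1) ->
  unif_cover Fam A v -> (forall i, Fam (f i)) ->
  0 < tau <= 1 -> 0 <= A -> (0 < v)%N -> (4 * v <= q)%N ->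
  (16 * A / tau) ^+ v <= 4 ^+ q -> 1 <= G -> q%:R <= G * (r%:R * tau) ->
  (forall i, umean (fun z => f i z ^+ 2) <= G * tau) ->
  (0 < r)%N -> (r * m <= n1)%N -> 0 < x ->
  tail_const G * q%:R * tau <= r%:R * x ^+ 2 ->
  let E := [set w | exists2 n, (n1 <= n <= n2)%N &
    x < ustat_sup f (fun i => umean (f i)) n (Z ^~ w)] in
  measurable E /\ (P E <= (4^-1 ^+ q)%:E)%E.
Proof.
move=> bf f1 cov Ff tau01 A0 v0 vq Aq G1 qG var r0 rn1 x0 xle E.
have [mE PE] := ustat_sup_maximal_inequality (fun i => umean (f i)) iZ bf n2 q r0 rn1 x0.
split=> //; apply: le_trans PE _; rewrite lee_fin.
have rx0 : 0 < r%:R * x by rewrite mulr_gt0// ltr0n.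
have qG' : q%:R <= G * (#|'I_r|%:R * tau) by rewrite card_ord.
have := @empirical_moment _ T R P _ S Z I 'I_r 'I_m (@block_index m r) (fun j : 'I_m => j : nat)
   iZ (@block_index_inj m r) (@ord_inj m) f Fam A tau G v q bf f1 cov Ff tau01 A0 v0 vq Aq
   G1 qG' var.
rewrite card_ord; set M := Rintegral _ _ _ => MM.
have rxq : 0 < (r%:R * x) ^+ q.*2 by rewrite exprn_gt0.
have {}MM : Rintegral P setT (fun w => block_sup f (fun i => umean (f i)) r (Z ^~ w) ^+ q.*2) <=
   (32 * chain_const ^+ 2 * G * q%:R * (r%:R * tau)) ^+ q by exact: MM.
rewrite -ler_pdivlMl ?invr_gt0// invrK.
apply: (le_trans MM).
rewrite -mul2n exprM -exprMn lerXn2r ?nnegrE//.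
- have k0 : 0 <= @chain_const R by apply: le_trans chain_const_ge1.
  have G0 : 0 <= G by apply: le_trans G1.
  case/andP: tau01 => /ltW tau0 _.
  apply: mulr_ge0; last by rewrite mulr_ge0.
  by rewrite mulr_ge0// mulr_ge0// mulr_ge0// exprn_ge0.
- by rewrite mulr_ge0 ?invr_ge0// sqr_ge0.
- rewrite exprMn.
  have -> : 32 * chain_const ^+ 2 * G * q%:R * (r%:R * tau) =
     4^-1 * (r%:R * (tail_const G * q%:R * tau)).
    rewrite /tail_const; have -> : (128 : R) = 4 * 32 by rewrite -natrM.
    by move: (@chain_const R ^+ 2) => k; field.
  rewrite [leRHS]mulrC; apply: ler_wpM2l; first by rewrite invr_ge0.
  by rewrite [r%:R ^+ 2]expr2 -[leRHS]mulrA; apply: ler_wpM2l.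
Qed.

(** The bound for finite families does not depend on their size, so it passes to
    an increasing union. *)
Lemma countable_tail (f : nat -> ('I_m -> S) -> R)
    (Fam : set (('I_m -> S) -> R)) (A tau G x : R) (v q n1 n2 r : nat) :
  (forall i, bmeasJ (f i)) -> (forall i z, `|f i z| <= 1) ->
  unif_cover Fam A v -> (forall i, Fam (f i)) ->
  0 < tau <= 1 -> 0 <= A -> (0 < v)%N -> (4 * v <= q)%N ->
  (16 * A / tau) ^+ v <= 4 ^+ q -> 1 <= G -> q%:R <= G * (r%:R * tau) ->
  (forall i, umean (fun z => f i z ^+ 2) <= G * tau) ->
  (0 < r)%N -> (r * m <= n1)%N -> 0 < x ->
  tail_const G * q%:R * tau <= r%:R * x ^+ 2 ->
  let E := [set w | exists2 n, (n1 <= n <= n2)%N &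
    exists i, x < `|ustat_avg n (f i) (Z ^~ w) - umean (f i)|] in
  measurable E /\ (P E <= (4^-1 ^+ q)%:E)%E.
Proof.
move=> bf f1 cov Ff tau01 A0 v0 vq Aq G1 qG var r0 rn1 x0 xle E.
pose fk k (i : 'I_k) := f i.
pose Ek k := [set w | exists2 n, (n1 <= n <= n2)%N &
    x < ustat_sup (fk k) (fun i => umean (fk k i)) n (Z ^~ w)].
have tk k : measurable (Ek k) /\ (P (Ek k) <= (4^-1 ^+ q)%:E)%E.
  by apply: (@finite_tail 'I_k (fk k) Fam A tau G x v q n1 n2 r) => // i;
    first [exact: bf | exact: f1 | exact: Ff | exact: var].
have usupP k n w : x < ustat_sup (fk k) (fun i => umean (fk k i)) n (Z ^~ w) <->
   exists2 i, (i < k)%N & x < `|ustat_avg n (f i) (Z ^~ w) - umean (f i)|.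
  split=> [|[i ik xi]].
    move=> xu; apply: contrapT => nex; move: xu; apply/negP; rewrite -leNgt.
    apply: fmax_le => [|i _]; first exact: ltW.
    by rewrite leNgt; apply/negP => xi; apply: nex; exists i.
  apply: lt_le_trans xi _.
  exact: (le_fmax (fun i : 'I_k => `|ustat_avg n (fk k i) (Z ^~ w) - umean (fk k i)|)
    (isT : predT (Ordinal ik))).
have EE : E = \bigcup_k Ek k.
  apply/seteqP; split=> w.
    move=> [n nn [i xi]]; exists i.+1 => //; exists n => //.
    by apply/usupP; exists i.
  by move=> [k _ [n nn /usupP[i _ xi]]]; exists n => //; exists i.
have mEk k : measurable (Ek k) by have [] := tk k.
have mU : measurable (\bigcup_k Ek k) by exact: bigcupT_measurable.
split; first by rewrite EE.
have nd : nondecreasing_seq Ek.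
  move=> k l kl; rewrite subsetEset => w [n nn /usupP[i ik xi]].
  by exists n => //; apply/usupP; exists i => //; exact: leq_trans kl.
have cv := nondecreasing_cvg_mu (mu := P) mEk mU nd.
rewrite EE -(cvg_lim _ cv)//; apply: lime_le; first by apply/cvg_ex; eexists; exact: cv.
by apply: nearW => k /=; have [] := tk k.
Qed.

End TailBound.

(** * Uniform covers of VC-type classes and of products *)

Section EmpiricalMeasure.
Context d (T : measurableType d) (R : realType) (B : finType) (x : B -> T) (b0 : B).

(** The uniform distribution on the points x; the index b0 witnesses that there
    is at least one. *)
Definition empirical : set T -> \bar R :=
  mscale (#|B|%:R^-1)%:nng
    (msum (fun k => \d_(x (nth b0 (enum B) k)) : {measure set T -> \bar R}) #|B|).

HB.instance Definition _ := Measure.on empirical.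

Lemma empirical_card : (0 < #|B|)%N.
Proof. by apply/card_gt0P; exists b0. Qed.

Let empiricalT : empirical setT = 1%E.
Proof.
rewrite /empirical /mscale /= /msum.
rewrite (eq_bigr (fun=> 1%:E)); last by move=> i _; rewrite /= /dirac indicE in_setT.
rewrite sumEFin sumr_const card_ord -EFinM mulVf//.
by rewrite pnatr_eq0 -lt0n empirical_card.
Qed.

HB.instance Definition _ := Measure_isProbability.Build _ _ _ empirical empiricalT.

Lemma integral_empirical (g : T -> R) : measurable_fun setT g -> (forall t, 0 <= g t) ->
  (\int[empirical]_t (g t)%:E = (#|B|%:R^-1 * \sum_b g (x b))%:E)%E.
Proof.
move=> mg g0; have mE : measurable_fun setT (EFin \o g) by exact/measurable_EFinP.
rewrite ge0_integral_mscale//; last by move=> t _; rewrite lee_fin.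
rewrite ge0_integral_measure_sum//; last by move=> t _; rewrite lee_fin.
rewrite EFinM; congr (_ * _)%E.
rewrite (eq_bigr (fun k : 'I_#|B| => (g (x (nth b0 (enum B) k)))%:E)); last first.
  by move=> k _; rewrite integral_dirac// diracT mul1e.
rewrite sumEFin; congr EFin.
rewrite -[RHS]big_enum/= (big_nth b0) big_mkord -cardE.
by apply: eq_bigr.
Qed.

Lemma empirical_Lnorm2 (g : T -> R) : measurable_fun setT g ->
  'N[empirical]_2%:E[EFin \o g]%E =
  (Num.sqrt (#|B|%:R^-1 * \sum_b g (x b) ^+ 2))%:E.
Proof.
move=> mg; rewrite unlock /Lnorm.
have -> : (\int[empirical]_t (`|(EFin \o g) t| `^ 2)%E =
    (#|B|%:R^-1 * \sum_b g (x b) ^+ 2)%:E)%E.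
  have mg2 : measurable_fun setT (fun t => g t ^+ 2) by exact: measurable_funX.
  rewrite -(integral_empirical mg2); last by move=> t; exact: sqr_ge0.
  apply: eq_integral => t _; rewrite /= ?poweR_EFin powR_mulrn//.
  by rewrite real_normK ?num_real.
have S0 : 0 <= #|B|%:R^-1 * \sum_b g (x b) ^+ 2.
  by rewrite mulr_ge0 ?invr_ge0// sumr_ge0// => b _; exact: sqr_ge0.
by rewrite poweR_EFin powR12_sqrt.
Qed.

End EmpiricalMeasure.

Section VCCover.
Context d (T : measurableType d) (R : realType).
Implicit Types (Fam : set (T -> R)) (G : T -> R).

(** Apply the definition of VC type to empirical measures, at radius
    M sqrt(dlt) / 2 so that centres can be moved into the class.  Radii larger
    than twice the norm of the envelope are excluded from that definition, but
    then any single member of the class is a cover. *)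
Lemma vc_cover Fam G M : 0 < M -> (forall t, G t <= M) -> vc_type Fam G ->
  exists (A : R) (v : nat), [/\ 1 <= A, (0 < v)%N &
    unif_cover [set (fun t => M^-1 * g t) | g in Fam] A v].
Proof.
move=> M0 GM [mF [mG FG] [A [w [A3 w1 cov]]]].
have [v vw] : exists v : nat, w <= v%:R by exists (Num.truncn w).+1; rewrite ltW// truncnS_gt.
have v0 : (0 < v)%N by rewrite -(ltr0n R) (lt_le_trans _ vw)// (lt_le_trans _ w1).
have A0 : 0 <= A by rewrite (le_trans _ A3).
exists (16 * A ^+ 2), v; split=> //.
  by rewrite mulr_ege1 ?ler1n// exprn_ege1// (le_trans _ A3)// ler1n.
move=> B x dlt /andP[d0 d1].
have big : 1 <= 16 * A ^+ 2 / dlt.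
  rewrite ler_pdivlMr// mul1r (le_trans d1)// mulr_ege1 ?ler1n//.
  by rewrite exprn_ege1// (le_trans _ A3)// ler1n.
have [[f0 Ff0]|noF] := pselect (exists f0, Fam f0); last first.
  exists void, (fun _ _ => 0); split.
  - by rewrite card_void exprn_ge0// (le_trans _ big).
  - by case.
  - by move=> g0 [g Fg _]; exfalso; apply: noF; exists g.
have one_ok : (forall g, Fam g -> \sum_b (M^-1 * g (x b) - M^-1 * f0 (x b)) ^+ 2 <= #|B|%:R * dlt) ->
  exists (K : finType) (c : K -> T -> R), [/\ #|K|%:R <= (16 * A ^+ 2 / dlt) ^+ v,
    forall k, [set (fun t => M^-1 * g t) | g in Fam] (c k) &
    forall g, [set (fun t => M^-1 * g t) | g in Fam] g -> exists k,
      \sum_b (g (x b) - c k (x b)) ^+ 2 <= #|B|%:R * dlt].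
  move=> h; exists unit, (fun _ t => M^-1 * f0 t); split.
  - by rewrite card_unit exprn_ege1.
  - by move=> _; exists f0.
  - by move=> _ [g Fg <-]; exists tt; exact: h.
have [b0 _|noB] := pickP (mem B); last first.
  apply: one_ok => g Fg; rewrite big_pred0; last by move=> b; have := noB b; rewrite inE.
  by rewrite mulr_ge0// ltW.
pose Q : probability T R := empirical R x b0.
have n0 : 0 < #|B|%:R :> R by rewrite ltr0n (empirical_card b0).
have GQ := empirical_Lnorm2 x b0 mG.
set a := Num.sqrt _ in GQ.
have a2 : a ^+ 2 = #|B|%:R^-1 * \sum_b G (x b) ^+ 2.
  rewrite sqr_sqrtr// mulr_ge0 ?invr_ge0// sumr_ge0// => b _; exact: sqr_ge0.
have G0 t : 0 <= G t by rewrite (le_trans _ (FG f0 Ff0 t)).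
have aM : a <= M.
  rewrite -(@ler_pXn2r _ 2)// ?nnegrE ?sqrtr_ge0 ?(ltW M0)//.
  rewrite a2 ler_pdivrMl//.
  apply: (@le_trans _ _ (\sum_(b : B) M ^+ 2)).
    by apply: ler_sum => b _; rewrite lerXn2r ?nnegrE// ltW.
  by rewrite sumr_const mulr_natl.
(* The half is spent on moving the centres into the class. *)
pose eps := M * Num.sqrt dlt / 2.
have sd0 : 0 < Num.sqrt dlt by rewrite sqrtr_gt0.
have eps0 : 0 < eps by rewrite /eps divr_gt0// mulr_gt0.
have eps2 : 4 * eps ^+ 2 = M ^+ 2 * dlt.
  rewrite /eps exprMn exprMn sqr_sqrtr ?(ltW d0)//.
  by clear; field.
have scale (g c : T -> R) : \sum_b (g (x b) - c (x b)) ^+ 2 <= #|B|%:R * (M ^+ 2 * dlt) ->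
    \sum_b (M^-1 * g (x b) - M^-1 * c (x b)) ^+ 2 <= #|B|%:R * dlt.
  move=> h; under eq_bigr do rewrite -mulrBr exprMn.
  rewrite -mulr_sumr exprVn ler_pdivrMl ?exprn_gt0//.
  by rewrite mulrCA.
have [small|large] := leP eps (2 * a); last first.
  apply: one_ok => g Fg; apply: scale.
  apply: (@le_trans _ _ (\sum_b 4 * G (x b) ^+ 2)).
    apply: ler_sum => b _; rewrite -real_normK ?num_real//.
    have -> : 4 * G (x b) ^+ 2 = (2 * G (x b)) ^+ 2.
      by rewrite exprMn; congr (_ * _); rewrite expr2 -natrM.
    rewrite lerXn2r ?nnegrE ?mulr_ge0// (le_trans (ler_normB _ _))//.
    by rewrite (_ : 2 = 1 + 1)// mulrDl mul1r lerD// FG.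
  rewrite -mulr_sumr -ler_pdivlMl//.
  have -> : #|B|%:R * (M ^+ 2 * dlt) = #|B|%:R * (4 * eps ^+ 2) by rewrite eps2.
  rewrite mulrCA mulKf// -ler_pdivrMl// -a2.
  rewrite lerXn2r ?nnegrE ?sqrtr_ge0 ?(ltW eps0)//.
  apply: le_trans (ltW large).
  by rewrite -{1}[a]mul1r ler_wpM2r ?sqrtr_ge0// ler1n.
have := cov Q; rewrite /= GQ => /(_ (ltry _) eps eps0).
rewrite -EFinM lee_fin => /(_ small) cle.
have a0 : 0 < a by rewrite -(pmulr_rgt0 _ (ltr0n R 2)) (lt_le_trans eps0).
have base1 : 1 <= A * a / eps.
  rewrite ler_pdivlMr// mul1r (le_trans small)// ler_wpM2r ?(ltW a0)//.
  by rewrite (le_trans _ A3)// ler_nat.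
have val_le : (A * a / eps) `^ w <= (A * a / eps) ^+ v.
  by rewrite -powR_mulrn ?(le_trans _ base1)// ler_powR.
have : (covering_number Fam Q eps < ((A * a / eps) ^+ v + 1)%:E)%E.
  apply: le_lt_trans cle _; rewrite lte_fin; apply: le_lt_trans val_le _.
  by rewrite ltrDl.
move=> /ereal_inf_lt[_ [k [c [cL ck]] <-]]; rewrite lte_fin => kle.
pose near (g : T -> R) (i : 'I_k) := \sum_b (g (x b) - c i (x b)) ^+ 2 <= #|B|%:R * eps ^+ 2.
have ex_near g : Fam g -> exists i, near g i.
  move=> Fg; have [i hi] := ck g Fg; exists i.
  have mc : measurable_fun setT (c i).
    by have := cL i; rewrite inE => /andP[/=]; rewrite inE.
  move: hi; rewrite (empirical_Lnorm2 x b0); last exact: measurable_funB (mF _ Fg) mc.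
  rewrite lte_fin => /ltW hi.
  have S0 : 0 <= #|B|%:R^-1 * \sum_b (g (x b) - c i (x b)) ^+ 2.
    by rewrite mulr_ge0 ?invr_ge0// sumr_ge0// => b _; exact: sqr_ge0.
  move: hi; rewrite -(@ler_pXn2r _ 2)// ?nnegrE ?sqrtr_ge0 ?(ltW eps0)//.
  by rewrite sqr_sqrtr// ler_pdivrMl.
have /choice[rep hrep] : forall i : 'I_k, exists r, Fam r /\
   forall g, Fam g -> near g i -> near r i.
  move=> i.
  have [[g [Fg gi]]|no] := pselect (exists g, Fam g /\ near g i).
    by exists g.
  by exists f0; split=> // g Fg gi; exfalso; apply: no; exists g.
exists 'I_k, (fun i t => M^-1 * rep i t); split.
- rewrite card_ord.
  apply: (@le_trans _ _ ((A * a / eps) ^+ v * 2 ^+ v)).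
    apply: (le_trans (ltW kle)).
    apply: (@le_trans _ _ ((A * a / eps) ^+ v * 2)).
      by rewrite mulrDr mulr1 lerD2l exprn_ege1.
    rewrite ler_wpM2l ?exprn_ge0 ?(le_trans _ base1)//.
    by rewrite -[leLHS]expr1 ler_weXn2l// ler1n.
  have nn : 0 <= A * a / eps * 2 by rewrite mulr_ge0// (le_trans _ base1).
  have big0 : 0 <= 16 * A ^+ 2 / dlt by rewrite (le_trans _ big).
  rewrite -exprMn lerXn2r ?nnegrE//.
  apply: (@le_trans _ _ ((A * M / eps * 2))).
    by rewrite ler_wpM2r// ler_wpM2r ?invr_ge0 ?(ltW eps0)// ler_wpM2l.
  have -> : A * M / eps * 2 = 4 * A / Num.sqrt dlt.
    by rewrite /eps; field; rewrite !gt_eqF.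
  have -> : 16 * A ^+ 2 / dlt = (4 * A / Num.sqrt dlt) ^+ 2.
    rewrite exprMn exprMn exprVn sqr_sqrtr ?(ltW d0)//.
    by congr (_ * _ / _); rewrite expr2 -natrM.
  have s1 : Num.sqrt dlt <= 1 by rewrite -[leRHS]sqrtr1 ler_sqrt.
  rewrite expr2 ler_peMr//; first by rewrite divr_ge0 ?mulr_ge0// ltW.
  rewrite ler_pdivlMr// mul1r (le_trans s1)// mulr_ege1// ?ler1n//.
  by rewrite (le_trans _ A3)// ler1n.
- by move=> i; have [Fr _] := hrep i; exists (rep i).
- move=> _ [g Fg <-]; have [i gi] := ex_near g Fg; exists i; apply: scale.
  have [_ /(_ g Fg gi) ri] := hrep i.
  apply: (@le_trans _ _ (\sum_b (2 * (g (x b) - c i (x b)) ^+ 2 +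
     2 * (rep i (x b) - c i (x b)) ^+ 2))).
    by apply: ler_sum => b _; exact: sqrB_le.
  rewrite big_split/= -!mulr_sumr -eps2; move: gi ri; rewrite /near.
  move: (\sum_b _) (\sum_b _) => y z.
  rewrite mulrCA; move: (#|B|%:R * eps ^+ 2) => u; clear; lra.
Qed.

End VCCover.

Section ProductCover.
Context {R : realType}.

Lemma unif_cover_comp (V V' : Type) (phi : V' -> V) (Fam : set (V -> R)) A v :
  unif_cover Fam A v -> unif_cover [set g \o phi | g in Fam] A v.
Proof.
move=> cov B x dlt d01.
have [K [c [cK Fc cn]]] := cov B (phi \o x) dlt d01.
exists K, (fun k => c k \o phi); split=> //; first by move=> k; exists (c k).
by move=> _ [g Fg <-]; have [k hk] := cn g Fg; exists k.
Qed.

(** On functions bounded by 1 the product is 1-Lipschitz in each factor, so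
    products of centres form a cover. *)
Lemma unif_cover_mul (V : Type) (F1 F2 : set (V -> R)) A1 A2 v1 v2 :
  1 <= A1 -> 1 <= A2 ->
  (forall f, F1 f -> forall z, `|f z| <= 1) ->
  (forall f, F2 f -> forall z, `|f z| <= 1) ->
  unif_cover F1 A1 v1 -> unif_cover F2 A2 v2 ->
  unif_cover [set h | exists2 f, F1 f & exists2 g, F2 g & h = fun z => f z * g z]
    (4 * Num.max A1 A2) (v1 + v2).
Proof.
move=> A1_1 A2_1 b1 b2 cov1 cov2 B x dlt /andP[d0 d1].
have d4 : 0 < dlt / 4 <= 1 by apply/andP; split; lra.
have [K1 [c1 [cK1 Fc1 cn1]]] := cov1 B x _ d4.
have [K2 [c2 [cK2 Fc2 cn2]]] := cov2 B x _ d4.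
exists (K1 * K2)%type, (fun k z => c1 k.1 z * c2 k.2 z); split.
- rewrite card_prod natrM exprD.
  have e (A : R) : 4 * A / dlt = A / (dlt / 4) by field; rewrite gt_eqF.
  have le1 : A1 <= Num.max A1 A2 by rewrite le_max lexx.
  have le2 : A2 <= Num.max A1 A2 by rewrite le_max lexx orbT.
  have d4' : 0 < dlt / 4 by case/andP: d4.
  have A1_0 : 0 <= A1 by exact: le_trans A1_1.
  have A2_0 : 0 <= A2 by exact: le_trans A2_1.
  have m0 : 0 <= Num.max A1 A2 by exact: le_trans A1_0 le1.
  have up (A : R) v : 0 <= A -> A <= Num.max A1 A2 ->
      (A / (dlt / 4)) ^+ v <= (Num.max A1 A2 / (dlt / 4)) ^+ v.
    move=> A0 Am; have i0 : 0 <= (dlt / 4)^-1 by rewrite invr_ge0 ltW.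
    by rewrite lerXn2r ?nnegrE ?mulr_ge0// ler_wpM2r.
  rewrite e; apply: ler_pM => //.
    by apply: le_trans cK1 _; exact: up.
  by apply: le_trans cK2 _; exact: up.
- by move=> [k1 k2]; exists (c1 k1) => //; exists (c2 k2).
- move=> _ [f Ff [g Fg ->]].
  have [k1 h1] := cn1 f Ff; have [k2 h2] := cn2 g Fg; exists (k1, k2) => /=.
  apply: (@le_trans _ _ (\sum_b (2 * (f (x b) - c1 k1 (x b)) ^+ 2 +
      2 * (g (x b) - c2 k2 (x b)) ^+ 2))); last first.
    rewrite big_split/= -!mulr_sumr; move: h1 h2.
    rewrite mulrA; move: (\sum_b _) (\sum_b _) (#|B|%:R * dlt) => y z u; clear; lra.
  apply: ler_sum => b _.
  have sq1 (y : R) : `|y| <= 1 -> y ^+ 2 <= 1.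
    by move=> y1; rewrite -real_normK ?num_real// exprn_ile1.
  have := sq1 _ (b2 _ Fg (x b)); have := sq1 _ (b1 _ (Fc1 k1) (x b)).
  move: (f (x b)) (c1 k1 (x b)) (g (x b)) (c2 k2 (x b)) => y y' z z' y1 z1.
  have -> : y * z - y' * z' = (y - y') * z + (z - z') * y' by ring.
  apply: (@le_trans _ _ (2 * ((y - y') * z) ^+ 2 + 2 * ((z - z') * y') ^+ 2)).
    rewrite -subr_ge0 [X in 0 <= X](_ : _ = ((y - y') * z - (z - z') * y') ^+ 2).
      exact: sqr_ge0.
    by ring.
  rewrite lerD// ler_wpM2l// exprMn ler_piMr// sqr_ge0//.
Qed.

End ProductCover.

(** * Tail bounds for pointwise separable classes *)

Section ClassTail.
Context d (T : measurableType d) (R : realType) (P : probability T R).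

Lemma Ex_cvg (g_ : nat -> T -> R) (g : T -> R) M :
  (forall k, bmeas (g_ k)) -> bmeas g -> (forall k w, `|g_ k w| <= M) ->
  (forall w, g_ k w @[k --> \oo] --> g w) ->
  Rintegral P setT (g_ k) @[k --> \oo] --> Rintegral P setT g.
Proof.
move=> bg_ bg gM cv.
have := @dominated_convergence _ T R P setT measurableT
  (fun k => EFin \o g_ k) (EFin \o g) (fun=> M%:E).
case.
- by move=> k; apply/measurable_EFinP; have [] := bg_ k.
- by apply/measurable_EFinP; have [] := bg.
- by apply/aeW => w _; apply/cvg_EFin; [exact: nearW|exact: cv].
- exact: (bmeas_integrable P (bmeas_cst _ M)).
- by apply/aeW => w k _; rewrite /= lee_fin.
move=> _ _ cvI.
have -> : (fun k => Rintegral P setT (g_ k)) =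
   fine \o (fun k => \int[P]_w (EFin \o g_ k) w)%E by [].
apply: fine_cvg; rewrite /Rintegral fineK//.
by apply: integrable_fin_num; [|exact: bmeas_integrable].
Qed.

Context dS (S : measurableType dS) (Z : nat -> T -> S) (m : nat).
Hypothesis iZ : iid P Z.

Lemma umean_cvg (h_ : nat -> ('I_m -> S) -> R) (h : ('I_m -> S) -> R) :
  (forall k, bmeasJ (h_ k)) -> bmeasJ h -> (forall k z, `|h_ k z| <= 1) ->
  (forall z, h_ k z @[k --> \oo] --> h z) ->
  umean P Z (h_ k) @[k --> \oo] --> umean P Z h.
Proof.
move=> bh_ bh h1 cv; have [mZ _ _] := iZ.
apply: (@Ex_cvg _ _ 1).
- by move=> k; exact: (@bmeasJ_comp _ S R 'I_m _ T (fun j => Z j)).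
- exact: (@bmeasJ_comp _ S R 'I_m _ T (fun j => Z j)).
- by move=> k w; exact: h1.
- by move=> w; exact: cv.
Qed.

(** A dense sequence may leave the set of functions of small variance even if its
    limit lies in it, since pointwise limits do not keep track of a bandwidth.
    Second moments however converge, by dominated convergence; so it suffices to
    keep the members of the sequence whose second moment is at most G tau, and
    to require the strict inequality for h. *)
Theorem class_tail (C : set (('I_m -> S) -> R)) (A tau G x : R) (v q n1 n2 r : nat) :
  (forall h, C h -> bmeasJ h) -> (forall h, C h -> forall z, `|h z| <= 1) ->
  unif_cover C A v ->
  (C !=set0 -> exists psi : nat -> ('I_m -> S) -> R, (forall k, C (psi k)) /\
     forall h, C h -> exists u : nat -> nat, forall z, psi (u k) z @[k --> \oo] --> h z) ->
  0 < tau <= 1 -> 0 <= A -> (0 < v)%N -> (4 * v <= q)%N ->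
  (16 * A / tau) ^+ v <= 4 ^+ q -> 1 <= G -> q%:R <= G * (r%:R * tau) ->
  (0 < r)%N -> (r * m <= n1)%N -> 0 < x ->
  tail_const G * q%:R * tau <= r%:R * x ^+ 2 ->
  exists E, [/\ measurable E, (P E <= (4^-1 ^+ q)%:E)%E &
    forall w, ~ E w -> forall n, (n1 <= n <= n2)%N -> forall h, C h ->
      umean P Z (fun z => h z ^+ 2) < G * tau ->
      `|ustat_avg n h (Z ^~ w) - umean P Z h| <= x].
Proof.
move=> bC C1 cov sep tau01 A0 v0 vq Aq G1 qG r0 rn1 x0 xle.
have small_nonneg : (0%:E <= (4^-1 ^+ q)%:E :> \bar R)%E.
  by rewrite lee_fin exprn_ge0// invr_ge0.
have [[h0 [Ch0 vh0]]|noh] := pselect (exists h, C h /\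
    umean P Z (fun z => h z ^+ 2) < G * tau); last first.
  exists set0; rewrite measure0; split=> // w _ n _ h Ch vh.
  by exfalso; apply: noh; exists h.
have [psi [Cpsi dense]] := sep (ex_intro _ h0 Ch0).
pose good k := umean P Z (fun z => psi k z ^+ 2) <= G * tau.
have near_good h u : C h -> (forall z, psi (u k) z @[k --> \oo] --> h z) ->
    umean P Z (fun z => h z ^+ 2) < G * tau -> \forall k \near \oo, good (u k).
  move=> Ch cv vh.
  have cv2 : umean P Z (fun z => psi (u k) z ^+ 2) @[k --> \oo] --> umean P Z (fun z => h z ^+ 2).
    apply: umean_cvg.
    - by move=> k; apply: (bmeasX 2 (bC _ (Cpsi _))).
    - exact: (bmeasX 2 (bC _ Ch)).
    - by move=> k z; rewrite normrX exprn_ile1// C1.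
    - by move=> z; under eq_fun do rewrite expr2; rewrite expr2; apply: cvgM; exact: cv.
  by move/cvgr_lt : cv2 => /(_ _ vh); apply: filterS => k /ltW.
have [u0 cv0] := dense _ Ch0.
have [N _ goodN] := near_good _ _ Ch0 cv0 vh0.
have good0 : good (u0 N) by apply: goodN => /=.
pose phi k := if `[< good k >] then psi k else psi (u0 N).
have Cphi k : C (phi k) by rewrite /phi; case: ifP.
have vphi k : umean P Z (fun z => phi k z ^+ 2) <= G * tau.
  by rewrite /phi; case: asboolP.
have [mE PE] := @countable_tail _ T R P _ S Z m iZ phi C A tau G x v q n1 n2 r
  (fun k => bC _ (Cphi k)) (fun k => C1 _ (Cphi k)) cov Cphi tau01 A0 v0 vq Aq G1 qG
  vphi r0 rn1 x0 xle.
set E := [set w | _] in mE PE.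
exists E; split=> // w nE n n12 h Ch vh.
have [u cv] := dense _ Ch.
have le_x k : good (u k) -> `|ustat_avg n (psi (u k)) (Z ^~ w) - umean P Z (psi (u k))| <= x.
  move=> gk; rewrite leNgt; apply/negP => xlt; apply: nE; exists n => //.
  by exists (u k); rewrite /phi asboolT.
have cvu : ustat_avg n (psi (u k)) (Z ^~ w) @[k --> \oo] --> ustat_avg n h (Z ^~ w).
  apply: cvgM; first exact: cvg_cst.
  by apply: cvg_big => [|i _]; [exact: add_continuous|exact: cv].
have cvm : umean P Z (psi (u k)) @[k --> \oo] --> umean P Z h.
  apply: umean_cvg; [by move=> k; exact: bC|exact: bC|by move=> k; exact: C1|exact: cv].
have cvd : `|ustat_avg n (psi (u k)) (Z ^~ w) - umean P Z (psi (u k))| @[k --> \oo] -->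
    `|ustat_avg n h (Z ^~ w) - umean P Z h|.
  by apply: cvg_norm; exact: cvgB.
have := near_good _ _ Ch cv vh => ng.
rewrite -(cvg_lim _ cvd)//; apply: limr_le; first by apply/cvg_ex; eexists; exact: cvd.
by apply: filterS ng => k /le_x.
Qed.

End ClassTail.

(** * Classes of product functions *)

Lemma kernel_sup_ge (R : realType) (K : R -> R) x :
  has_ubound [set `|K x| | x in [set: R]] -> `|K x| <= kernel_sup K.
Proof. by move=> ub; apply: ub_le_sup => //; exists x. Qed.

Lemma kernel_sup_gt0 (R : realType) (K : R -> R) :
  has_ubound [set `|K x| | x in [set: R]] ->
  (\int[lebesgue_measure]_x (K x)%:E = 1)%E -> 0 < kernel_sup K.
Proof.
move=> ub K1; rewrite ltNge; apply/negP => k0.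
have K0 x : K x = 0.
  by apply/eqP; rewrite -normr_le0 (le_trans (kernel_sup_ge x ub)).
move: K1; under eq_integral do rewrite K0.
by rewrite integral0 => /eqP; rewrite eq_sym onee_eq0.
Qed.

Section ProductClass.
Context (R : realType) (m : nat).
Context (F1 : set (m.-tuple R -> R)) (K1 : set (R -> R)).
Implicit Types (z : 'I_m -> R * R).

Definition ytup z : m.-tuple R := [tuple (z j).2 | j < m].

Definition product_fun (s : seq 'I_m) (f : m.-tuple R -> R) (k : 'I_m -> R -> R) z : R :=
  f (ytup z) * \prod_(j <- s) k j (z j).1.

Definition product_class (s : seq 'I_m) : set (('I_m -> R * R) -> R) :=
  [set h | exists2 f, F1 f & exists2 k, (forall j, K1 (k j)) & h = product_fun s f k].

Hypotheses (F1_1 : forall f, F1 f -> forall y, `|f y| <= 1)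
  (K1_1 : forall k, K1 k -> forall x, `|k x| <= 1)
  (mF1 : forall f, F1 f -> measurable_fun setT f)
  (mK1 : forall k, K1 k -> measurable_fun setT k)
  (K1_n0 : K1 !=set0).

Lemma product_class_le1 s h z : product_class s h -> `|h z| <= 1.
Proof.
move=> [f Ff [k Kk ->]]; rewrite /product_fun normrM mulr_ile1 ?F1_1//.
elim: s => [|j s IH]; first by rewrite big_nil normr1.
by rewrite big_cons normrM mulr_ile1// K1_1.
Qed.

Lemma product_class_bmeasJ s h : product_class s h -> bmeasJ h.
Proof.
move=> Ch; split; last by exists 1 => t; exact: product_class_le1 Ch.
move: Ch => [f Ff [k Kk ->]].
have mz j : measurable_fun setT (fun t => @fun_of_tuple _ (R * R)%type 'I_m t j).
  exact: measurable_fun_of_tuple.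
apply: measurable_funM.
  apply: (measurableT_comp (mF1 Ff)).
  apply/measurable_fun_tnthP => j.
  rewrite (_ : _ \o _ = snd \o (fun t => @fun_of_tuple _ (R * R)%type 'I_m t j)).
    exact: measurableT_comp.
  by apply/funext => t; rewrite /= tnth_mktuple.
apply: measurable_prod => j _; apply: (measurableT_comp (mK1 (Kk j))).
exact: measurableT_comp.
Qed.

Lemma product_class_nil : product_class [::] = [set f \o ytup | f in F1].
Proof.
apply/seteqP; split=> h.
  by move=> [f Ff [k Kk ->]]; exists f => //; apply/funext => z; rewrite /product_fun big_nil mulr1.
move=> [f Ff <-]; exists f => //; have [k0 Kk0] := K1_n0; exists (fun=> k0) => //.
by apply/funext => z; rewrite /product_fun big_nil mulr1.
Qed.

(** The new factor can be read off at j because j does not occur in s; this makes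
    the class an exact product and lets [unif_cover_mul] apply. *)
Lemma product_class_cons j s : j \notin s -> product_class (j :: s) =
  [set h | exists2 f, product_class s f &
    exists2 g, [set k \o (fun z => (z j).1) | k in K1] g & h = fun z => f z * g z].
Proof.
move=> js; apply/seteqP; split=> h.
  move=> [f Ff [k Kk ->]]; exists (product_fun s f k); first by exists f => //; exists k.
  exists (fun z => k j (z j).1); first by exists (k j).
  by apply/funext => z; rewrite /product_fun big_cons; ring.
move=> [_ [f Ff [k Kk ->]] [_ [k' Kk' <-] ->]].
exists f => //; exists (fun i => if i == j then k' else k i).
  by move=> i; case: ifP.
apply/funext => z; rewrite /product_fun big_cons eqxx /=.
have -> : \prod_(i <- s) (if i == j then k' else k i) (z i).1 = \prod_(i <- s) k i (z i).1.
  by apply: eq_big_seq => i si; case: eqP => // ij; rewrite -ij si in js.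
by rewrite [k' _ * _]mulrC mulrA.
Qed.

Lemma product_class_cover A1 v1 A2 v2 : 1 <= A1 -> 1 <= A2 -> (0 < v1)%N ->
  unif_cover F1 A1 v1 -> unif_cover K1 A2 v2 ->
  forall s, uniq s -> exists A v, [/\ 1 <= A, (0 < v)%N & unif_cover (product_class s) A v].
Proof.
move=> A1_1 A2_1 v1_0 c1 c2; elim=> [_|j s IH /= /andP[js us]].
  by exists A1, v1; split=> //; rewrite product_class_nil; exact: unif_cover_comp.
have [A [v [A_1 v0 cv]]] := IH us.
exists (4 * Num.max A A2), (v + v2)%N; split.
- by rewrite mulr_ege1 ?ler1n// le_max A_1.
- by rewrite addn_gt0 v0.
- rewrite product_class_cons//; apply: unif_cover_mul => //.
  + by move=> f Cf z; exact: product_class_le1 Cf.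
  + by move=> _ [k Kk <-] z; exact: K1_1.
  + exact: unif_cover_comp.
Qed.

End ProductClass.

Lemma countable_enum (V : Type) (A : set V) (a0 : V) : countable A -> A a0 ->
  exists u : nat -> V, (forall k, A (u k)) /\ forall a, A a -> exists k, u k = a.
Proof.
move=> /countable_injP[f injf] Aa0.
have H k : exists a, A a /\ forall b, A b -> f b = k -> a = b.
  have [[a [Aa fa]]|no] := pselect (exists a, A a /\ f a = k).
    exists a; split=> // b Ab fb; apply: injf; rewrite ?inE//; by rewrite fa fb.
  by exists a0; split=> // b Ab fb; exfalso; apply: no; exists b.
have [u hu] := choice H; exists u; split=> [k|a Aa]; first by have [] := hu k.
by exists (f a); have [_ /(_ a Aa erefl)] := hu (f a).
Qed.

Section ProductEnumeration.
Context (R : realType) (m : nat).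
Context (Fam : set (m.-tuple R -> R)) (K0 : set (R -> R)) (a b : R).

Let F1 := [set (fun y => a * g y) | g in Fam].
Let K1 := [set (fun x => b * k x) | k in K0].

(** Pointwise density is inherited by finite products, and the finitely many
    choices of factors are encoded in one natural number. *)
Lemma product_class_enum s : pointwise_measurable Fam -> pointwise_measurable K0 ->
  product_class F1 K1 s !=set0 -> K1 !=set0 ->
  exists psi : nat -> ('I_m -> R * R) -> R, (forall k, product_class F1 K1 s (psi k)) /\
  forall h, product_class F1 K1 s h -> exists u : nat -> nat,
    forall z, psi (u k) z @[k --> \oo] --> h z.
Proof.
move=> [Fam0 [F0F cF0 aF]] [K00 [K0K cK0 aK]] [_ [_ [g0 Fg0 <-] _]] [_ [k0 Kk0 _]].
have [ug [ug0 _]] := aF g0 Fg0.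
have [uk [uk0 _]] := aK k0 Kk0.
have [eF [eF0 eFs]] := countable_enum cF0 (ug0 0%N).
have [eK [eK0 eKs]] := countable_enum cK0 (uk0 0%N).
pose mk (p : nat * {ffun 'I_m -> nat}) := product_fun s (fun y => a * eF p.1 y)
  (fun j x => b * eK (p.2 j) x).
pose psi n := mk (odflt (0%N, [ffun=> 0%N]) (unpickle n)).
exists psi; split.
  move=> n; rewrite /psi /mk; set p := odflt _ _.
  exists (fun y => a * eF p.1 y); first by exists (eF p.1) => //; exact: F0F.
  exists (fun j x => b * eK (p.2 j) x) => // j.
  by exists (eK (p.2 j)) => //; exact: K0K.
move=> _ [_ [g Fg <-] [k Kk ->]].
have [g_ [g_0 g_cv]] := aF g Fg.
have /choice[k' hk'] : forall j, exists k', K0 k' /\ k j = (fun x => b * k' x).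
  by move=> j; have [k' Kk' <-] := Kk j; exists k'.
have /choice[k_ hk_] : forall j, exists k_ : nat -> R -> R, (forall i, K00 (k_ i)) /\
    forall x, k_ i x @[i --> \oo] --> k' j x.
  by move=> j; have [Kk'j _] := hk' j; have [k_ [? ?]] := aK _ Kk'j; exists k_.
have /choice[ig hig] : forall i, exists l, eF l = g_ i by move=> i; exact: eFs.
have /choice[ik hik] : forall ij : nat * 'I_m, exists l, eK l = k_ ij.2 ij.1.
  by move=> [i j]; apply: eKs; have [] := hk_ j.
exists (fun i => pickle (ig i, [ffun j => ik (i, j)])) => z.
have -> : (fun i => psi (pickle (ig i, [ffun j => ik (i, j)])) z) =
   (fun i => (a * g_ i (ytup z)) * \prod_(j <- s) (b * k_ j i (z j).1)).
  apply/funext => i; rewrite /psi pickleK /= /mk /product_fun /= hig; congr (_ * _).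
  by apply: eq_bigr => j _; rewrite ffunE hik.
apply: cvgM; first by apply: cvgM; [exact: cvg_cst|exact: g_cv].
apply: cvg_big => [|j _]; first exact: mul_continuous.
have [_ ->] := hk' j; apply: cvgM; first exact: cvg_cst.
by have [_ ] := hk_ j; exact.
Qed.

End ProductEnumeration.

(** * The summands of the kernel U-statistic *)

Lemma lee_prod_const (R : realType) (I : finType) (x : I -> \bar R) (c : R) :
  (forall i, 0 <= x i <= c%:E)%E -> (\prod_i x i <= (c ^+ #|I|)%:E)%E.
Proof.
move=> xc; rewrite -prodr_const -prodEFin.
suff : (0 <= \prod_i x i <= \prod_(i in I) c%:E)%E by case/andP.
elim/big_rec2 : _ => [|i y1 y2 _ /andP[y10 y12]]; first by rewrite lee_fin ler01 lexx.
have /andP[x0 x1] := xc i.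
by rewrite mule_ge0//= lee_pmul.
Qed.

Section DensityBounds.
Context (R : realType) d (T : measurableType d) (P : probability T R).
Context (X Y : T -> R) (f : R * R -> R).

(** Tonelli's theorem turns the probability of a vertical strip into an integral
    of the marginal density. *)
Lemma strip_probability (B a b : R) : has_joint_density P X Y f ->
  (forall x, (marginal_density f x <= B%:E)%E) -> a <= b ->
  (P ((fun w => (X w, Y w)) @^-1` (`[a, b]%classic `*` setT)) <= (B * (b - a))%:E)%E.
Proof.
move=> [mf f0 fE] fB ab; have mI : measurable (`[a, b]%classic : set R) by exact: measurable_itv.
have mIT : measurable (`[a, b]%classic `*` [set: R]) by exact: measurableX.
have B0 : 0 <= B.
  have := fB 0; rewrite /marginal_density => /(le_trans _); rewrite -lee_fin; apply.
  by apply: integral_ge0 => y _; rewrite lee_fin.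
rewrite fE//; rewrite integral_mkcond.
have mE : measurable_fun setT (fun z : R * R => (f z)%:E) by exact/measurable_EFinP.
set fr := (fun z => (f z)%:E) \_ _.
have mfr : measurable_fun setT fr.
  by apply/(measurable_restrictT _ mIT); exact: measurable_funTS.
have fr0 z : (0 <= fr z)%E by rewrite erestrict_ge0// => y _; rewrite lee_fin.
rewrite fubini_tonelli1//.
apply: (@le_trans _ _ (\int[lebesgue_measure]_x ((cst B%:E) \_ `[a, b]) x)%E); last first.
  rewrite -integral_mkcond integral_cst//= lebesgue_measure_itv/= lte_fin.
  by case: ifPn => _; rewrite -?EFinB ?mule0 -?EFinM ?lee_fin// mulr_ge0// subr_ge0.
apply: ge0_le_integral => //.
- by move=> x _; apply: integral_ge0 => y _; exact: fr0.
- exact: measurable_fun_fubini_tonelli_F.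
- by apply/(measurable_restrictT _ mI).
- move=> x _; rewrite /fubini_F /fr /patch; case: ifPn => [xI|xI].
    apply: le_trans (fB x); rewrite /marginal_density le_eqVlt; apply/orP; left; apply/eqP.
    by apply: eq_integral => y _; rewrite ifT// inE; split=> //; move: xI; rewrite inE.
  rewrite (eq_integral (fun=> 0%E)) ?integral0//.
  move=> y _; rewrite ifF//; apply/negbTE; apply: contra xI; rewrite !inE.
  by move=> [].
Qed.

End DensityBounds.

Section UStatClass.
Context (R : realType) (m : nat) d (T : measurableType d) (P : probability T R).
Context (X Y : nat -> T -> R) (f : R * R -> R) (K : R -> R) (M B : R).
Hypotheses (mX : forall i, measurable_fun setT (X i)) (mY : forall i, measurable_fun setT (Y i)).
Hypotheses (hXY : iid_with_density P X Y f)
  (hfX : forall x, (marginal_density f x <= B%:E)%E) (M0 : 0 < M)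
  (Kb : has_ubound [set `|K x| | x in [set: R]])
  (Ksupp : closure [set x | K x != 0] `<=` `[- 2^-1, 2^-1])
  (k0 : 0 < kernel_sup K).

Definition pairs (i : nat) (w : T) : R * R := (X i w, Y i w).

Lemma pairs_iid : iid P pairs.
Proof.
have [ind dens] := hXY; split => [i||i A mA].
- by apply/measurable_fun_pairP; split; [exact: mX|exact: mY].
- exact: ind.
- have [_ _ e1] := dens i; have [_ _ e2] := dens 0%N.
  by rewrite (e1 A mA) (e2 A mA).
Qed.

(** The summand of the U-statistic divided by h^-m M (sup |K|)^m, so that it is
    bounded by 1.  The power h^-m is exactly what is lost in passing from the
    kernels to the class of all their translates and dilates. *)
Definition unit_summand (g : m.-tuple R -> R) (h : R) (t : m.-tuple R) :=
  product_fun (index_enum 'I_m) (fun y => M^-1 * g y)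
    (fun j x => (kernel_sup K)^-1 * (h * scaled_kernel K h (tnth t j - x))).

Lemma unit_summand_in (Fam : set (m.-tuple R -> R)) g h t : Fam g -> 0 < h ->
  product_class [set (fun y => M^-1 * g y) | g in Fam]
    [set (fun x => (kernel_sup K)^-1 * k x) | k in kernel_class K] (index_enum 'I_m)
    (unit_summand g h t).
Proof.
move=> Fg h0; exists (fun y => M^-1 * g y); first by exists g.
exists (fun j x => (kernel_sup K)^-1 * (h * scaled_kernel K h (tnth t j - x))) => //.
move=> j; exists (fun x => h * scaled_kernel K h (tnth t j - x)) => //.
by exists h, (tnth t j).
Qed.

Lemma unit_summand_ustat g h t n w : 0 < h ->
  ustat K X Y n g h t w =
  h ^- m * (M * kernel_sup K ^+ m) * ustat_avg n (unit_summand g h t) (pairs ^~ w).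
Proof.
move=> h0; rewrite /ustat /ustat_avg mulrCA; congr (_ * _).
rewrite mulr_sumr; apply: eq_bigr => i _.
rewrite /unit_summand /product_fun /ytup /scaled_prod_kernel /prod_kernel /pairs /=.
have -> : [tuple (X (i j) w, Y (i j) w).2 | j < m] = [tuple Y (i j) w | j < m] by [].
have -> : \prod_(j <- index_enum 'I_m) ((kernel_sup K)^-1 *
      (h * scaled_kernel K h (tnth t j - X (i j) w))) =
    kernel_sup K ^- m * \prod_(j < m)
      K (tnth [tuple tnth [tuple tnth t j - X (i j) w | j < m] j / h | j < m] j).
  rewrite (eq_bigr (fun j => (kernel_sup K)^-1 *
    K (tnth [tuple tnth [tuple tnth t j - X (i j) w | j < m] j / h | j < m] j))).
    by rewrite big_split/= prodr_const card_ord exprVn.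
  move=> j _; rewrite !tnth_mktuple /scaled_kernel mulVKf// gt_eqF//.
have kn : kernel_sup K ^+ m != 0 by rewrite expf_neq0// gt_eqF.
have Mn : M != 0 by rewrite gt_eqF.
by field; rewrite kn Mn expf_neq0 ?gt_eqF.
Qed.

Lemma unit_summand_sq_le g h t z : 0 < h -> (forall y, `|g y| <= M) ->
  unit_summand g h t z ^+ 2 <=
  \prod_(j < m) \1_(`[tnth t j - h / 2, tnth t j + h / 2]%classic) (z j).1.
Proof.
move=> h0 gM; rewrite /unit_summand /product_fun exprMn.
have Mi : 0 <= M^-1 by rewrite invr_ge0 ltW.
have ki : 0 <= (kernel_sup K)^-1 by rewrite invr_ge0 ltW.
rewrite -[leRHS]mul1r ler_pM ?sqr_ge0//.
  rewrite -real_normK ?num_real// exprn_ile1//.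
  by rewrite normrM ger0_norm// ler_pdivrMl// mulr1.
rewrite -prodrXl; apply: ler_prod => j _; rewrite sqr_ge0/=.
rewrite /scaled_kernel mulVKf ?gt_eqF//.
rewrite indicE; case: (boolP (_ \in _)) => [_|nin].
  rewrite -real_normK ?num_real// exprn_ile1//.
  by rewrite normrM ger0_norm// ler_pdivrMl// mulr1 kernel_sup_ge.
suff -> : K ((tnth t j - (z j).1) / h) = 0 by rewrite mulr0 expr0n.
apply/eqP; apply: contraNT nin => Kn.
have : (`[- 2^-1, 2^-1])%classic ((tnth t j - (z j).1) / h).
  by apply: Ksupp; apply: subset_closure.
rewrite /= in_itv/= ler_pdivlMr// ler_pdivrMr// => /andP[l1 l2].
by rewrite inE /= in_itv/=; apply/andP; split; move: l1 l2; lra.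
Qed.

(** The square is at most the indicator of the cube of side h centred at t, whose
    probability factors over coordinates. *)
Lemma unit_summand_variance g h t : 0 < h -> (forall y, `|g y| <= M) ->
  bmeasJ (unit_summand g h t : ('I_m -> R * R) -> R) ->
  umean P pairs (fun z => unit_summand g h t z ^+ 2) <= (B * h) ^+ m.
Proof.
move=> h0 gM bu; have iZ := pairs_iid; have [mZ _ _] := iZ.
pose I j := `[tnth t j - h / 2, tnth t j + h / 2]%classic : set R.
pose E := [set w | forall j : 'I_m, (I j `*` setT) (pairs j w)].
have mI j : measurable (I j `*` setT : set (R * R)).
  by apply: measurableX => //; exact: measurable_itv.
have PE : P E = _ := iid_box (s := fun j : 'I_m => j : nat) iZ (@ord_inj m) mI.
have mE : measurable E.
  have -> : E = \big[setI/setT]_(j : 'I_m) (pairs j @^-1` (I j `*` setT)).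
    rewrite -bigcap_seq; apply/seteqP; split=> w hw k; first by move=> _; exact: hw.
    by apply: hw; rewrite /= mem_index_enum.
  apply: bigsetI_measurable => j _.
  by rewrite -[X in measurable X]setTI; apply: mZ.
apply: (@le_trans _ _ (Rintegral P setT (\1_E : T -> R))).
  apply: le_Ex.
  - apply: (@bmeasJ_comp _ _ R 'I_m _ T (fun j => pairs j)
      (fun z => unit_summand g h t z ^+ 2)) => //.
    exact: (bmeasX 2 bu).
  - exact: bmeas_indic.
  - move=> w; apply: le_trans (unit_summand_sq_le _ _ h0 gM) _.
    rewrite indicE; case: (boolP (w \in E)) => wE.
      apply: prodr_ile1 => j _; rewrite indicE ler0n/=.
      by case: (_ \in _).
    have [j nj] : exists j : 'I_m, ~ I j (X j w).
      apply: contrapT => all; move: wE; apply/negP; rewrite negbK inE => j; split=> //=.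
      by apply: contrapT => nI; apply: all; exists j.
    by rewrite (bigD1 j)//= indicE memNset// mul0r.
rewrite -lee_fin -ExE; last exact: bmeas_indic.
have -> : (\int[P]_w (\1_E w)%:E = P E)%E by rewrite integral_indic// setIT.
rewrite PE.
have B0 : 0 <= B.
  have := hfX 0; rewrite /marginal_density => /(le_trans _); rewrite -lee_fin; apply.
  have [_ dens] := hXY; have [_ f0 _] := dens 0%N.
  by apply: integral_ge0 => y _; rewrite lee_fin.
rewrite -[X in _ ^+ X]card_ord; apply: lee_prod_const => j; rewrite measure_ge0/=.
have hh : B * h = B * ((tnth t j + h / 2) - (tnth t j - h / 2)) by congr (_ * _); lra.
rewrite hh; apply: (@strip_probability _ _ _ _ _ _ f) => //; first by have [_ ] := hXY; exact.
by lra.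
Qed.

Lemma ustat_mean g h t n : 0 < h -> (m <= n)%N ->
  bmeasJ (unit_summand g h t : ('I_m -> R * R) -> R) ->
  fine ('E_P[ustat K X Y n g h t])%E =
  h ^- m * (M * kernel_sup K ^+ m) * umean P pairs (unit_summand g h t).
Proof.
move=> h0 mn bu; have iZ := pairs_iid; have [mZ _ _] := iZ.
have -> : fine ('E_P[ustat K X Y n g h t])%E = Rintegral P setT (ustat K X Y n g h t).
  by rewrite unlock.
have -> : ustat K X Y n g h t = (fun w => h ^- m * (M * kernel_sup K ^+ m) *
    ustat_avg n (unit_summand g h t) (pairs ^~ w)).
  by apply/funext => w; exact: unit_summand_ustat.
have bi (i : {ffun 'I_m -> 'I_n}) : bmeas (fun w => unit_summand g h t (fun j => pairs (i j) w)).
  exact: (@bmeasJ_comp _ _ R 'I_m _ T (fun j => pairs (i j))).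
rewrite ExZ; last first.
  by apply: bmeasM; [exact: bmeas_cst|apply: bmeas_sum => i _; exact: bi].
congr (_ * _); rewrite /ustat_avg ExZ; last by apply: bmeas_sum => i _; exact: bi.
rewrite Ex_sum; last by move=> i _; exact: bi.
rewrite (eq_bigr (fun=> umean P pairs (unit_summand g h t))); last first.
  move=> i /injectiveP ii.
  apply: (@Ex_exchange _ T R P _ (R * R)%type pairs 'I_m (fun j => i j) (fun j => j)) => //.
    by move=> j j' /ord_inj/ii.
  exact: ord_inj.
have cardE' : #|[pred i : {ffun 'I_m -> 'I_n} | injectiveb i]| = (n ^_ m)%N.
  by have := card_inj_ffuns 'I_m 'I_n; rewrite !card_ord cardsE => <-.
rewrite sumr_const cardE' -[_ *+ (n ^_ m)]mulr_natl mulrA.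
rewrite -(ffact_fact mn) natrM.
have nf' : (n - m)`!%:R != 0 :> R by rewrite pnatr_eq0 -lt0n fact_gt0.
have nf'' : (n ^_ m)%:R != 0 :> R by rewrite pnatr_eq0 -lt0n ffact_gt0.
by field; rewrite nf' nf''.
Qed.

End UStatClass.

(** * Logarithms and dyadic scales *)

Section Numeric.
Context {R : realType}.

Lemma ln2_ge : 2^-1 <= ln 2 :> R.
Proof.
have := @le_ln1Dx R (- 2^-1).
have -> : 1 + - 2^-1 = 2^-1 :> R by lra.
rewrite lnV ?posrE// => /(_ _); lra.
Qed.

Lemma dyadic_scale (h : R) : 0 < h < 1 ->
  exists j : nat, 2^-1 ^+ j.+1 < h <= 2^-1 ^+ j.
Proof.
move=> /andP[h0 h1].
have ex : exists n, 2^-1 ^+ n < h.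
  exists (Num.truncn h^-1).+1; rewrite exprVn invf_plt ?posrE ?exprn_gt0//.
  apply: (lt_le_trans (truncnS_gt _)); rewrite -natrX ler_nat ltnW//.
  exact: ltn_expl.
have := ex_minnP ex; case=> [[|j]] ltn minn.
  by move: ltn; rewrite expr0 ltNge (ltW h1).
exists j; rewrite ltn leNgt; apply/negP => /minn; by rewrite ltnn.
Qed.

(** An integer of order log2 k; at block k, with n of order 2^k, it plays the
    role of log log n, and 4^-(loglevel k) is summable in k. *)
Definition loglevel (k : nat) : nat := (trunc_log 2 k.+1).+1.

Lemma loglevel_gt k : (k.+1 < 2 ^ loglevel k)%N.
Proof. exact: trunc_log_ltn. Qed.

Lemma loglevel_le k : (loglevel k <= k.+1)%N.
Proof.
have h1 : (trunc_log 2 k.+1 < 2 ^ trunc_log 2 k.+1)%N by exact: ltn_expl.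
have h2 : (2 ^ trunc_log 2 k.+1 <= k.+1)%N by exact: trunc_logP.
exact: leq_trans h1 h2.
Qed.

Lemma loglevel_ln k : (loglevel k)%:R <= 2 * ln k.+1%:R + 1 :> R.
Proof.
rewrite /loglevel -natr1 lerD2r.
have := @trunc_logP 2 k.+1 isT isT; set t := trunc_log _ _ => tk.
have : ln (2 ^+ t : R) <= ln k.+1%:R.
  by rewrite ler_ln ?posrE ?exprn_gt0// -natrX ler_nat.
rewrite lnXn// -[ln 2 *+ t]mulr_natl => h.
have := ler_wpM2l (ler0n R t) ln2_ge; lra.
Qed.

(** The number of moments used at scale j of block k is at most of the order of
    the normalization |ln h| \/ ln ln n; this is what yields that rate. *)
Lemma scale_count_le (k j : nat) (n : nat) (h : R) : (32 <= k)%N -> (2 ^ k <= n)%N ->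
  0 < h <= 2^-1 ^+ j ->
  (j + loglevel k + 1)%:R <= 6 * Num.max `|ln h| (ln (ln n%:R)) :> R.
Proof.
move=> k32 kn /andP[h0 hj].
set L : R := Num.max _ _.
have n0 : 0 < n%:R :> R by rewrite ltr0n (leq_trans _ kn)// expn_gt0.
have jL : j%:R <= 2 * L.
  have : ln h <= ln (2^-1 ^+ j) by rewrite ler_ln ?posrE ?exprn_gt0 ?invr_gt0.
  rewrite lnXn ?invr_gt0// lnV ?posrE// -[(- ln 2) *+ j]mulr_natl => lh.
  have hL : `|ln h| <= L by rewrite le_max lexx.
  have := ler_norm (- ln h); rewrite normrN => nh.
  have {}nh : - ln h <= L := le_trans nh hL.
  have := ler_wpM2l (ler0n R j) ln2_ge.
  have {}lh : j%:R * ln 2 <= - ln h by rewrite -[j%:R * _]opprK lerNl opprK -mulrN.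
  move=> j2; have : j%:R / 2 <= L := le_trans j2 (le_trans lh nh).
  by rewrite ler_pdivrMr// mulrC.
have k32R : 32 <= k%:R :> R by rewrite ler_nat.
have lnn : k%:R / 2 <= ln n%:R :> R.
  have : ln (2 ^+ k : R) <= ln n%:R by rewrite ler_ln ?posrE ?exprn_gt0// -natrX ler_nat.
  rewrite lnXn// -[ln 2 *+ k]mulr_natl => kl; apply: le_trans kl.
  exact: (ler_wpM2l (ler0n R k) ln2_ge).
have k20 : 0 < k%:R / 2 :> R by lra.
have lk : ln (k%:R / 2) <= L.
  by rewrite le_max; apply/orP; right; rewrite ler_ln ?posrE// (lt_le_trans k20).
have kL : ln k.+1%:R + 1 <= 2 * ln (k%:R / 2) :> R.
  have : ln (4 * k.+1%:R) <= ln ((k%:R / 2) ^+ 2) :> R.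
    have p1 : 0 < 4 * k.+1%:R :> R by rewrite mulr_gt0.
    have p2 : 0 < (k%:R / 2) ^+ 2 :> R by rewrite exprn_gt0.
    rewrite ler_ln ?posrE// -natr1 expr2.
    have := ler_wpM2r (ler0n R k) k32R; lra.
  rewrite lnXn// lnM ?posrE// -[ln _ *+ 2]mulr_natl.
  have -> : (4 : R) = 2 * 2 by rewrite -natrM.
  rewrite lnM ?posrE//; have := ln2_ge; lra.
rewrite !natrD; have := loglevel_ln k; lra.
Qed.

Lemma sum_inv_sq (n : nat) : \sum_(0 <= k < n) (k.+1%:R ^+ 2)^-1 <= 2 :> R.
Proof.
suff H : forall n, \sum_(0 <= k < n.+1) (k.+1%:R ^+ 2)^-1 <= 2 - n.+1%:R^-1 :> R.
  case: n => [|n]; first by rewrite big_geq.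
  by apply: (le_trans (H n)); rewrite gerBl invr_ge0.
elim=> [|p IH]; first by rewrite big_nat1 expr1n invr1; lra.
rewrite big_nat_recr//=; apply: (le_trans (lerD IH (lexx _))).
have p1 : 0 < p.+1%:R :> R by [].
have -> : p.+2%:R = p.+1%:R + 1 :> R by rewrite natr1.
move: (p.+1%:R : R) p1 => u u0.
rewrite -subr_ge0 [X in 0 <= X](_ : _ = (u * (u + 1) ^+ 2)^-1).
  by rewrite invr_ge0 mulr_ge0 ?exprn_ge0 ?addr_ge0// ltW.
by field; rewrite !gt_eqF// addr_gt0.
Qed.

Lemma sum_dyadic (J : nat) : \sum_(j < J) 2^-1 ^+ j.+1 <= 1 :> R.
Proof.
suff -> : \sum_(j < J) 2^-1 ^+ j.+1 = 1 - 2^-1 ^+ J :> R.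
  by rewrite gerBl exprn_ge0// invr_ge0.
elim: J => [|J IH]; first by rewrite big_ord0 expr0 subrr.
rewrite big_ord_recr/= IH !exprS; lra.
Qed.

End Numeric.

(** * Bandwidths within a block of sample sizes *)

Section BlockNumeric.
Context {R : realType}.

Lemma bandwidth_lowerX (m n : nat) (c : R) : (0 < m)%N -> (0 < n)%N ->
  bandwidth_lower m c n ^+ m = c ^+ m * (ln n%:R / n%:R).
Proof.
move=> m0 n0; rewrite /bandwidth_lower exprMn; congr (_ * _).
have b0 : 0 <= ln n%:R / n%:R :> R by rewrite divr_ge0// ln_ge0// ler1n.
rewrite -powR_mulrn ?powR_ge0// -powRrM mulVf ?powRr1//.
by rewrite pnatr_eq0 -lt0n.
Qed.

(** The lower bound on the bandwidth enters here: n h^m >= c^m ln n forces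
    2^-(jm) >= 2^-(k+1), hence j <= k+1, and makes the number of blocks times the
    variance bound at least of order k, as [empirical_moment] requires. *)
Lemma scale_valid (m k j n : nat) (c h : R) : (0 < m)%N -> (m <= 2 ^ k)%N ->
  (2 ^ k <= n <= 2 ^ k.+1)%N -> 0 < c -> 2 <= c ^+ m * k%:R -> 0 <= h ->
  bandwidth_lower m c n <= h -> h <= 2^-1 ^+ j ->
  [/\ (j < k.+2)%N, (0 < 2 ^ k %/ m)%N, 2 ^+ k <= 2 * m%:R * (2 ^ k %/ m)%:R :> R &
    c ^+ m * k%:R <= 8 * m%:R * ((2 ^ k %/ m)%:R * 2^-1 ^+ (j * m))].
Proof.
move=> m0 mk /andP[kn nk] c0 ck h0 ah hj.
set r := (2 ^ k %/ m)%N; set tau : R := 2^-1 ^+ (j * m).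
have r0 : (0 < r)%N by rewrite divn_gt0.
have n0 : (0 < n)%N by rewrite (leq_trans _ kn)// expn_gt0.
have nR0 : 0 < n%:R :> R by rewrite ltr0n.
have tau0 : 0 < tau by rewrite exprn_gt0// invr_gt0.
have rk : 2 ^+ k <= 2 * m%:R * r%:R :> R.
  rewrite -natrX -!natrM ler_nat {1}(divn_eq (2 ^ k) m) -/r.
  have mr : (m <= r * m)%N by rewrite leq_pmull.
  apply: (@leq_trans (r * m + r * m)); last by rewrite addnn -mul2n -mulnA [(m * r)%N]mulnC.
  by rewrite leq_add2l (leq_trans _ mr)// ltnW// ltn_pmod.
have a0 : 0 <= bandwidth_lower m c n by rewrite mulr_ge0 ?powR_ge0// ltW.
have atau : c ^+ m * (ln n%:R / n%:R) <= tau.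
  rewrite -bandwidth_lowerX// /tau exprM; apply: (@le_trans _ _ (h ^+ m)).
    by rewrite lerXn2r ?nnegrE.
  by rewrite lerXn2r ?nnegrE// exprn_ge0// invr_ge0.
have lnn : k%:R / 2 <= ln n%:R :> R.
  have : ln (2 ^+ k : R) <= ln n%:R by rewrite ler_ln ?posrE ?exprn_gt0// -natrX ler_nat.
  rewrite lnXn// -[ln 2 *+ k]mulr_natl => kl; apply: le_trans kl.
  exact: (ler_wpM2l (ler0n R k) ln2_ge).
have ctau : c ^+ m * k%:R <= 4 * (2 ^+ k * tau).
  have e1 : c ^+ m * (k%:R / 2) <= tau * n%:R.
    rewrite -ler_pdivrMr// -mulrA; apply: le_trans atau.
    apply: ler_wpM2l; first by rewrite exprn_ge0// ltW.
    by rewrite ler_wpM2r// invr_ge0 ltW.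
  have e2 : tau * n%:R <= tau * (2 * 2 ^+ k).
    by rewrite -exprS ler_wpM2l ?(ltW tau0)// -natrX ler_nat.
  have -> : c ^+ m * k%:R = 2 * (c ^+ m * (k%:R / 2)) by move: (c ^+ m) => u; field.
  have -> : 4 * (2 ^+ k * tau) = 2 * (tau * (2 * 2 ^+ k)) by move: (2 ^+ k) => u; ring.
  by rewrite ler_wpM2l// (le_trans e1).
split=> //.
- have : 1 <= 2 ^+ k.+1 * tau :> R.
    rewrite exprS -mulrA; move: (le_trans ck ctau); move: (2 ^+ k * tau) => a; lra.
  rewrite /tau exprVn ler_pdivlMr ?exprn_gt0// mul1r ler_eXn2l ?ltr1n// => jk.
  by rewrite !ltnS (leq_trans _ jk)// leq_pmulr.
- apply: (le_trans ctau).
  have -> : 8 * m%:R * (r%:R * tau) = 4 * (2 * m%:R * r%:R * tau) by ring.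
  by rewrite ler_wpM2l// ler_wpM2r// ltW.
Qed.

(** Here h stands for the m-th power of the bandwidth and delta for the deviation
    of the normalized statistic; squaring reduces the claim to the comparisons
    n <~ r, tau <~ h and q <~ L. *)
Lemma final_bound (n h L W TC q tau r D mR delta p2 : R) :
  0 < n -> 0 < h -> 0 < L -> 0 <= W -> 0 <= TC -> 0 <= q -> 0 <= tau -> 0 < r ->
  0 <= D -> 0 <= mR -> 0 <= p2 ->
  n <= 4 * mR * r -> tau <= p2 * h -> q <= 6 * D * L ->
  delta <= Num.sqrt (TC * q * tau / r) ->
  Num.sqrt (n * h) * (h^-1 * W * delta) / Num.sqrt L <=
  W * Num.sqrt (4 * mR * p2 * TC * (6 * D)).
Proof.
move=> n0 h0 L0 W0 TC0 q0 tau0 r0 D0 mR0 p20 nr th qL dx.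
set x := Num.sqrt _ in dx.
have x0 : 0 <= x by exact: sqrtr_ge0.
have i0 : 0 <= (Num.sqrt L)^-1 by rewrite invr_ge0 sqrtr_ge0.
have hi0 : 0 <= h^-1 by rewrite invr_ge0 ltW.
apply: (@le_trans _ _ (W * (Num.sqrt (n * h) * h^-1 * x / Num.sqrt L))).
  rewrite (_ : W * _ = Num.sqrt (n * h) * (h^-1 * W * x) / Num.sqrt L); last by ring.
  rewrite ler_wpM2r// ler_wpM2l ?sqrtr_ge0// ler_wpM2l// mulr_ge0//.
rewrite ler_wpM2l//.
have Q0 : 0 <= 4 * mR * p2 * TC * (6 * D) by rewrite !mulr_ge0.
rewrite -(@ler_pXn2r _ 2)// ?nnegrE ?sqrtr_ge0//; last first.
  by rewrite !mulr_ge0// sqrtr_ge0.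
have nh0 : 0 <= n * h by rewrite mulr_ge0// ltW.
have y0 : 0 <= TC * q * tau / r by rewrite !mulr_ge0// invr_ge0 ltW.
rewrite exprMn [(Num.sqrt (n * h) * h^-1 * x) ^+ 2]exprMn [(Num.sqrt (n * h) * h^-1) ^+ 2]exprMn.
rewrite [(Num.sqrt L)^-1 ^+ 2]exprVn /x !sqr_sqrtr ?(ltW L0)//.
rewrite ler_pdivrMr//.
have -> : n * h * h^-1 ^+ 2 * (TC * q * tau / r) = TC * (n * q * tau) / (h * r).
  by field; rewrite !gt_eqF.
rewrite ler_pdivrMr ?mulr_gt0//.
have -> : 4 * mR * p2 * TC * (6 * D) * L * (h * r) =
  TC * (4 * mR * r * (6 * D * L) * (p2 * h)) by ring.
apply: ler_wpM2l => //; apply: ler_pM => //; first by rewrite mulr_ge0// ltW.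
by apply: ler_pM => //; exact: ltW.
Qed.

End BlockNumeric.

(** * The almost sure bound *)

Section UnitClass.
Context (R : realType) (m : nat) (Fam : set (m.-tuple R -> R)) (F : m.-tuple R -> R).
Context (K : R -> R) (M : R).
Hypotheses (M0 : 0 < M) (vcF : vc_type Fam F) (FM : forall y, F y <= M)
  (Kb : has_ubound [set `|K x| | x in [set: R]]) (k0 : 0 < kernel_sup K)
  (vcK : vc_type (kernel_class K) (fun=> kernel_sup K)).

(** All normalized summands, for all bandwidths and locations at once: the kernels
    of different coordinates need not share a bandwidth, which makes the class a
    full product. *)
Definition unit_class : set (('I_m -> R * R) -> R) :=
  product_class [set (fun y => M^-1 * g y) | g in Fam]
    [set (fun x => (kernel_sup K)^-1 * k x) | k in kernel_class K] (index_enum 'I_m).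

Lemma Fam_le g y : Fam g -> `|g y| <= M.
Proof. by move=> Fg; have [_ [_ GF] _] := vcF; rewrite (le_trans (GF g Fg y)). Qed.

Let F1_1 f : [set (fun y => M^-1 * g y) | g in Fam] f -> forall y, `|f y| <= 1.
Proof.
move=> [g Fg <-] y; have Mi : 0 <= M^-1 by rewrite invr_ge0 ltW.
by rewrite normrM ger0_norm// ler_pdivrMl// mulr1 Fam_le.
Qed.

Let K1_1 f : [set (fun x => (kernel_sup K)^-1 * k x) | k in kernel_class K] f ->
  forall x, `|f x| <= 1.
Proof.
move=> [_ [h [t [h0 ->]]] <-] x; have ki : 0 <= (kernel_sup K)^-1 by rewrite invr_ge0 ltW.
rewrite normrM ger0_norm// ler_pdivrMl// mulr1 /scaled_kernel mulVKf ?gt_eqF//.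
exact: kernel_sup_ge.
Qed.

Let K1_n0 : [set (fun x => (kernel_sup K)^-1 * k x) | k in kernel_class K] !=set0.
Proof.
exists (fun x => (kernel_sup K)^-1 * (1 * scaled_kernel K 1 (0 - x))).
by exists (fun x => 1 * scaled_kernel K 1 (0 - x)) => //; exists 1, 0; rewrite ltr01.
Qed.

Lemma unit_class_le1 h z : unit_class h -> `|h z| <= 1.
Proof. by move=> Ch; exact: (product_class_le1 F1_1 K1_1 z Ch). Qed.

Lemma unit_class_bmeasJ h : unit_class h -> bmeasJ h.
Proof.
apply: product_class_bmeasJ => //.
- move=> _ [g Fg <-]; apply: measurable_funM; first exact: measurable_cst.
  by have [mF _ _] := vcF; exact: mF.
- move=> _ [k Kk <-]; apply: measurable_funM; first exact: measurable_cst.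
  by have [mK _ _] := vcK; exact: mK.
Qed.

Lemma unit_class_cover : exists A v, [/\ 1 <= A, (0 < v)%N & unif_cover unit_class A v].
Proof.
have [A1 [v1 [A1_1 v1_0 c1]]] := vc_cover M0 FM vcF.
have [A2 [v2 [A2_1 v2_0 c2]]] := vc_cover k0 (fun=> lexx _) vcK.
exact: (product_class_cover F1_1 K1_1 K1_n0 A1_1 A2_1 v1_0 c1 c2 (index_enum_uniq _)).
Qed.

Lemma unit_class_enum : pointwise_measurable Fam -> pointwise_measurable (kernel_class K) ->
  unit_class !=set0 -> exists psi : nat -> ('I_m -> R * R) -> R,
    (forall k, unit_class (psi k)) /\
    forall h, unit_class h -> exists u : nat -> nat,
      forall z, psi (u k) z @[k --> \oo] --> h z.
Proof. by move=> pF pK n0; exact: product_class_enum. Qed.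

End UnitClass.

Theorem theorem1 (R : realType) (m : nat) (hm : (1 <= m)%N)
    (d : measure_display) (T : measurableType d) (P : probability T R)
    (X Y : nat -> {RV P >-> R}) (f : R * R -> R)
    (hXY : iid_with_density P (fun i => X i : T -> R) (fun i => Y i : T -> R) f)
    (hfX : exists B : R, forall x : R, (marginal_density f x <= B%:E)%E)
    (Fam : set (m.-tuple R -> R)) (F : m.-tuple R -> R)
    (hFmeas : forall g, Fam g -> measurable_fun [set: m.-tuple R] g)
    (hFsq : forall g, Fam g ->
       ('E_P[(fun w : T => (g [tuple Y j w | j < m]) ^+ 2)%R] < +oo)%E)
    (hFi : pointwise_measurable Fam)
    (hFii : is_envelope Fam F)
    (hFiii : vc_type Fam F)
    (K : R -> R)
    (hKmeas : measurable_fun [set: R] K)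
    (hKsupp : closure [set x : R | K x != 0] `<=` `[- 2^-1, 2^-1])
    (hKbounded : has_ubound [set `|K x| | x in [set: R]])
    (hKint : (\int[lebesgue_measure]_x (K x)%:E = 1)%E)
    (hKpm : pointwise_measurable (kernel_class K))
    (hKvc : vc_type (kernel_class K) (fun=> kernel_sup K))
    (M : R) (hM0 : 0 < M) (hFM : forall y : m.-tuple R, F y <= M) :
  forall c b0 : R, 0 < c -> 0 < b0 < 1 ->
  exists C : R, 0 < C /\
    {ae P, forall w : T,
      (limn_esup (fun n : nat =>
         normalized_sup P K (fun i => X i : T -> R) (fun i => Y i : T -> R) Fam
           (bandwidth_lower m c n) b0 n w) <= C%:E)%E}.
Proof.
move=> c b0 c0 /andP[b00 b01].
have k0 := kernel_sup_gt0 hKbounded hKint.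
have [B fB] := hfX.
have mX i : measurable_fun setT (X i : T -> R) by [].
have mY i : measurable_fun setT (Y i : T -> R) by [].
pose Z := pairs (fun i => X i : T -> R) (fun i => Y i : T -> R).
have iZ : iid P Z := pairs_iid mX mY hXY.
have [A [v [A1 v0 cov]]] := unit_class_cover hM0 hFiii hFM hKbounded k0 hKvc.
have A0 : 0 <= A by exact: le_trans A1.
have B0 : 0 <= B.
  have := fB 0; rewrite /marginal_density => /(le_trans _); rewrite -lee_fin; apply.
  have [_ /(_ 0%N)[_ f0 _]] := hXY.
  by apply: integral_ge0 => y _; rewrite lee_fin.
have cm0 : 0 < c ^+ m by rewrite exprn_gt0.
(* D makes q = D (j + loglevel k + 1) large enough for chaining (4 v), for the
   variance 2^-(jm) inside the covering number (m v), and for its constant 16 A. *)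
pose D := (4 * v + m * v + (Num.truncn ((16 * A) ^+ v)).+1)%N.
have D0 : (0 < D)%N by rewrite /D addnS.
(* B^m comes from the variance; the last term makes every scale that meets the
   range of bandwidths admissible. *)
pose G : R := 1 + B ^+ m + 40 * D%:R * m%:R / c ^+ m.
have G40 : 40 * D%:R * m%:R / c ^+ m <= G by rewrite /G lerDr addr_ge0// exprn_ge0.
have pos40 : 0 <= 40 * D%:R * m%:R / c ^+ m by rewrite divr_ge0 ?mulr_ge0// ltW.
have G1 : 1 <= G by rewrite /G -addrA lerDl addr_ge0// exprn_ge0.
have GB : B ^+ m < G by rewrite /G -addrA addrC -addrA ltrDl ltr_wpDl.
pose q k j := (D * (j + loglevel k + 1))%N.
pose tau j : R := 2^-1 ^+ (j * m).
pose r k := (2 ^ k %/ m)%N.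
(* The level whose tail probability at scale j of block k is at most 4^-(q k j). *)
pose x k j : R := Num.sqrt (tail_const G * (q k j)%:R * tau j / (r k)%:R).
have TC0 : 0 < tail_const G.
  rewrite /tail_const mulr_gt0 ?(lt_le_trans ltr01 G1)// mulr_gt0// exprn_gt0//.
  exact: lt_le_trans ltr01 chain_const_ge1.
have tau0 j : 0 < tau j by rewrite exprn_gt0// invr_gt0.
have tau1 j : tau j <= 1 by rewrite exprn_ile1 ?invr_ge0// invf_le1 ?ler1n.
(* Scales at which the moment bound applies; the events of the others are empty. *)
pose valid k j := (0 < r k)%N && ((q k j)%:R <= G * ((r k)%:R * tau j)).
have q0 k j : (0 < q k j)%N by rewrite muln_gt0 D0 addn1.
have qv k j : (4 * v <= q k j)%N.
  apply: (@leq_trans (D * 1)); last by rewrite leq_mul2l addn1 orbT.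
  by rewrite muln1 /D -addnA leq_addr.
have Aq k j : (16 * A / tau j) ^+ v <= 4 ^+ q k j.
  apply: (@le_trans _ _ (4 ^+ (D * (j + 1)))); last first.
    by rewrite ler_weXn2l ?ler1n// leq_mul2l leq_add2r leq_addr orbT.
  rewrite exprMn mulnDr muln1 exprD mulrC; apply: ler_pM.
  - by rewrite exprn_ge0// invr_ge0 ltW.
  - by rewrite exprn_ge0// mulr_ge0.
  - rewrite /tau exprVn invrK -exprM.
    apply: (@le_trans _ _ (4 ^+ (j * m * v))).
      by rewrite lerXn2r ?nnegrE// ler_nat.
    rewrite ler_weXn2l ?ler1n// -mulnA mulnC leq_mul2r; apply/orP; right.
    by rewrite /D -addnA addnCA leq_addr.
  - apply: (@le_trans _ _ ((Num.truncn ((16 * A) ^+ v)).+1%:R)).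
      exact/ltW/truncnS_gt.
    rewrite -natrX ler_nat; apply: leq_trans (ltnW (ltn_expl _ (isT : (1 < 4)%N))) _.
    by rewrite leq_exp2l// /D leq_addl.
have event kj : exists E : set T, [/\ measurable E, (P E <= (4^-1 ^+ q kj.1 kj.2)%:E)%E &
    valid kj.1 kj.2 -> forall w, ~ E w -> forall n, (2 ^ kj.1 <= n <= 2 ^ kj.1.+1)%N ->
    forall g h t, Fam g -> 0 < h <= 2^-1 ^+ kj.2 ->
    `|ustat_avg n (unit_summand K M g h t) (Z ^~ w) - umean P Z (unit_summand K M g h t)|
      <= x kj.1 kj.2].
  case: kj => k j /=; have [/andP[r0 qG]|nv] := boolP (valid k j); last first.
    by exists set0; rewrite measure0; split=> //; rewrite lee_fin exprn_ge0// invr_ge0.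
  have rR : 0 < (r k)%:R :> R by rewrite ltr0n.
  have y0 : 0 < tail_const G * (q k j)%:R * tau j / (r k)%:R.
    by rewrite divr_gt0// mulr_gt0// mulr_gt0// ltr0n.
  have x0 : 0 < x k j by rewrite sqrtr_gt0.
  have xle : tail_const G * (q k j)%:R * tau j <= (r k)%:R * x k j ^+ 2.
    by rewrite /x sqr_sqrtr ?(ltW y0)// [leRHS]mulrC divfK// gt_eqF.
  have tau01 : 0 < tau j <= 1 by rewrite tau0 tau1.
  have [E [mE PE hE]] := @class_tail _ T R P _ (R * R)%type Z m iZ (unit_class Fam K M)
    A (tau j) G (x k j) v (q k j) (2 ^ k) (2 ^ k.+1) (r k)
    (fun h => @unit_class_bmeasJ R m Fam F K M hM0 hFiii hFM hKbounded k0 hKvc h)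
    (fun h Ch z => @unit_class_le1 R m Fam F K M hM0 hFiii hFM hKbounded k0 h z Ch) cov
    (unit_class_enum hFi hKpm) tau01 A0 v0 (qv k j) (Aq k j) G1 qG r0 (leq_divM _ _) x0 xle.
  exists E; split=> // _ w nE n n12 g h t Fg /andP[h0 hj].
  have Cu := unit_summand_in K M t Fg h0.
  apply: hE => //.
  have gM y : `|g y| <= M by exact: (Fam_le hFiii hFM).
  have bu : bmeasJ (unit_summand K M g h t : ('I_m -> R * R) -> R).
    exact: (unit_class_bmeasJ hM0 hFiii hFM hKbounded k0 hKvc Cu).
  have := unit_summand_variance mX mY hXY fB hM0 hKbounded hKsupp k0 h0 gM bu.
  move=> /le_lt_trans; apply.
  rewrite exprMn; apply: (@le_lt_trans _ _ (B ^+ m * tau j)).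
    rewrite ler_wpM2l ?exprn_ge0// /tau exprM lerXn2r ?nnegrE ?(ltW h0)//.
  by rewrite ltr_pM2r.
have [E hE] := choice event.
pose bad k := \big[setU/set0]_(j < k.+2) E (k, j : nat).
have mbad k : measurable (bad k).
  by apply: bigsetU_measurable => j _; have [] := hE (k, j : nat).
(* Each scale contributes 4^-q <= 2^-(j+1) (k+1)^-2. *)
have Pbad k : (P (bad k) <= ((k.+1%:R ^+ 2)^-1)%:E)%E.
  apply: (@le_trans _ _ (\sum_(j < k.+2) P (E (k, j : nat)))%E).
    by apply: (@Boole_inequality _ _ _ P (fun j => E (k, j))) => j _; have [] := hE (k, j).
  apply: (@le_trans _ _ (\sum_(j < k.+2) (2^-1 ^+ j.+1 * (k.+1%:R ^+ 2)^-1)%:E)%E).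
    apply: lee_sum => j _; have [_ PE _] := hE (k, j : nat).
    apply: (le_trans PE); rewrite lee_fin /=.
    apply: (@le_trans _ _ (4^-1 ^+ (j + loglevel k + 1))).
      rewrite ler_wiXn2l ?invr_ge0 ?invf_le1 ?ler1n//.
      by rewrite /q leq_pmull.
    rewrite -addnA [(loglevel k + 1)%N]addnC addnA addn1 exprD; apply: ler_pM.
    - by rewrite exprn_ge0// invr_ge0.
    - by rewrite exprn_ge0// invr_ge0.
    - by rewrite lerXn2r ?nnegrE ?invr_ge0// lef_pV2 ?posrE// ler_nat.
    - rewrite exprVn lef_pV2 ?posrE ?exprn_gt0//.
      have -> : (4 : R) ^+ loglevel k = (2 ^+ loglevel k) ^+ 2.
        by rewrite -exprM mulnC exprM; congr (_ ^+ _); rewrite expr2 -natrM.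
      by rewrite lerXn2r ?nnegrE// -natrX ler_nat ltnW// loglevel_gt.
  rewrite sumEFin lee_fin -mulr_suml -[leRHS]mul1r.
  by rewrite ler_wpM2r ?invr_ge0 ?exprn_ge0// sum_dyadic.
have bad0 : P (lim_sup_set bad) = 0%E.
  apply: lim_sup_set_cvg0 => //; apply: (@le_lt_trans _ _ 2%:E); last exact: ltry.
  apply: lime_le; first by apply: is_cvg_nneseries => n _ _; exact: measure_ge0.
  apply: nearW => n; apply: (@le_trans _ _ (\sum_(0 <= k < n) ((k.+1%:R ^+ 2)^-1)%:E)%E).
    by apply: lee_sum => i _; exact: Pbad.
  by rewrite sumEFin lee_fin sum_inv_sq.
pose Cst := M * kernel_sup K ^+ m *
  Num.sqrt (4 * m%:R * 2 ^+ m * tail_const G * (6 * D%:R)).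
have mR0 : 0 < m%:R :> R by rewrite ltr0n.
have W0 : 0 < M * kernel_sup K ^+ m by rewrite mulr_gt0// exprn_gt0.
have Cst0 : 0 < Cst.
  have DR : 0 < D%:R :> R by rewrite ltr0n.
  rewrite mulr_gt0// sqrtr_gt0; apply: mulr_gt0; last exact: mulr_gt0.
  apply: mulr_gt0 => //; apply: mulr_gt0; first exact: mulr_gt0.
  exact: exprn_gt0.
exists Cst; split=> //.
exists (lim_sup_set bad); split=> //.
  by apply: bigcap_measurable => // k _; exact: bigcup_measurable.
move=> w nw; apply: contrapT => wbad; apply: nw => /=.
have [k1 hk1] : exists k1, forall k, (k1 <= k)%N -> ~ bad k w.
  apply: contrapT => nex; apply: wbad => k1 _; apply: contrapT => nb; apply: nex.
  by exists k1 => k kk bk; apply: nb; exists k.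
have [k2 hk2] : exists k2 : nat, 2 <= c ^+ m * k2%:R.
  exists (Num.truncn (2 / c ^+ m)).+1; rewrite -ler_pdivrMl// mulrC.
  exact/ltW/truncnS_gt.
(* From block kk on: 32 is for [scale_count_le], k1 for Borel-Cantelli, k2 for
   [scale_valid] and m for m <= 2 ^ k. *)
pose kk := (32 + k1 + k2 + m)%N.
rewrite /limn_esup limf_esupE; apply: ereal_inf_le.
exists (ereal_sup [set normalized_sup P K (fun i => X i : T -> R) (fun i => Y i : T -> R)
   Fam (bandwidth_lower m c n) b0 n w | n in [set n | (2 ^ kk <= n)%N]]).
  by exists [set n | (2 ^ kk <= n)%N] => //; exists (2 ^ kk)%N.
apply: ge_ereal_sup => _ [n /= kn <-].
apply: ge_ereal_sup => _ [h hab <-].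
apply: ge_ereal_sup => _ [g Fg <-].
apply: ge_ereal_sup => _ [t _ <-].
rewrite lee_fin.
move: hab; rewrite /= in_itv/= => /andP[ah hb].
have n0 : (0 < n)%N by rewrite (leq_trans _ kn)// expn_gt0.
pose k := trunc_log 2 n.
have kkk : (kk <= k)%N by rewrite -ltnS -(@ltn_exp2l 2)// (leq_ltn_trans kn)// trunc_log_ltn.
have kn1 : (2 ^ k <= n <= 2 ^ k.+1)%N.
  by rewrite trunc_logP//= ltnW// trunc_log_ltn.
have a0 : 0 < bandwidth_lower m c n.
  rewrite mulr_gt0// powR_gt0// divr_gt0 ?ltr0n// ln_gt0// ltr1n.
  by rewrite (leq_trans _ kn)// (leq_trans _ (ltn_expl kk (isT : (1 < 2)%N))).
have h0 : 0 < h by exact: lt_le_trans ah.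
have h01 : 0 < h < 1 by rewrite h0 (le_lt_trans hb).
have [j /andP[jh hj]] := dyadic_scale h01.
have mk : (m <= 2 ^ k)%N.
  by rewrite (leq_trans _ (ltnW (ltn_expl k (isT : (1 < 2)%N))))// (leq_trans _ kkk)// leq_addl.
have ck : 2 <= c ^+ m * k%:R.
  rewrite (le_trans hk2)// ler_wpM2l ?(ltW cm0)// ler_nat (leq_trans _ kkk)//.
  by rewrite /kk -addnA addnC -addnA leq_addr.
have [jk r0 rk ctau] := scale_valid hm mk kn1 c0 ck (ltW h0) ah hj.
have k32 : (32 <= k)%N by rewrite (leq_trans _ kkk)// /kk -!addnA leq_addr.
have vkj : valid k j.
  rewrite /valid r0 /=; apply: (@le_trans _ _ (40 * D%:R * m%:R / c ^+ m * ((r k)%:R * tau j))); last first.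
    by rewrite ler_wpM2r// mulr_ge0// ltW.
  have -> : 40 * D%:R * m%:R / c ^+ m * ((r k)%:R * tau j) =
      5 * D%:R / c ^+ m * (8 * m%:R * ((r k)%:R * tau j)).
    have -> : (40 : R) = 5 * 8 by rewrite -natrM.
    by move: (c ^+ m)^-1 => u; ring.
  apply: (@le_trans _ _ (5 * D%:R / c ^+ m * (c ^+ m * k%:R))); last first.
    by rewrite ler_wpM2l// divr_ge0 ?mulr_ge0// ltW.
  rewrite mulrA divfK ?gt_eqF// /q -mulrA mulrCA natrM ler_wpM2l// -natrM ler_nat.
  have lk := loglevel_le k.
  apply: (@leq_trans (k.+1 + k.+1 + 1)).
    by rewrite leq_add2r leq_add// -ltnS.
  by clear -k32; lia.
have wE : ~ E (k, j) w.
  move=> Ew; apply: (hk1 k); first by rewrite (leq_trans _ kkk)// /kk addnAC -addnA -addnA addnCA leq_addr.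
  by rewrite /bad -(bigcup_mkord k.+2 (fun j => E (k, j))); exists j.
have [_ _ /(_ vkj w wE n kn1 g h t Fg)] := hE (k, j).
rewrite h0 hj => /(_ isT) /= dx.
have Cu := unit_summand_in K M t Fg h0.
have bu : bmeasJ (unit_summand K M g h t : ('I_m -> R * R) -> R).
  exact: (unit_class_bmeasJ hM0 hFiii hFM hKbounded k0 hKvc Cu).
have mn : (m <= n)%N by case/andP: kn1 => kn1 _; exact: leq_trans mk kn1.
rewrite (ustat_mean mX mY hXY hM0 k0 h0 mn bu) (unit_summand_ustat _ _ hM0 k0)//.
rewrite -mulrBr normrM.
have hm0 : 0 < h ^+ m by rewrite exprn_gt0.
have -> : `|h ^- m * (M * kernel_sup K ^+ m)| = (h ^+ m)^-1 * (M * kernel_sup K ^+ m).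
  by rewrite ger0_norm//; apply: mulr_ge0; rewrite ?invr_ge0; exact: ltW.
have hjl : 0 < h <= 2^-1 ^+ j by rewrite h0.
have cnt := @scale_count_le R k j n h k32 (proj1 (andP kn1)) hjl.
set L : R := Num.max _ _ in cnt *.
have L0 : 0 < L by rewrite -(pmulr_rgt0 _ (ltr0n R 6)) (lt_le_trans _ cnt)// ltr0n addn1.
apply: (@final_bound R n%:R (h ^+ m) L (M * kernel_sup K ^+ m) (tail_const G) (q k j)%:R
  (tau j) (r k)%:R D%:R m%:R _ (2 ^+ m)) => //.
- by rewrite ltr0n.
- exact: ltW.
- exact: ltW.
- exact: ltW.
- by rewrite ltr0n.
- case/andP: kn1 => _ nk; apply: (@le_trans _ _ (2 ^+ k.+1)); first by rewrite -natrX ler_nat.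
  rewrite exprS; have -> : 4 * m%:R * (r k)%:R = 2 * (2 * m%:R * (r k)%:R) :> R.
    by rewrite (_ : 4 = 2 * 2); [ring|rewrite -natrM].
  by rewrite ler_wpM2l.
- rewrite /tau exprM -exprMn lerXn2r ?nnegrE ?exprn_ge0 ?invr_ge0 ?mulr_ge0 ?(ltW h0)//.
  by move: jh; rewrite exprS => /ltW jh; rewrite -ler_pdivrMl.
- by rewrite /q natrM -mulrA mulrCA ler_wpM2l.
Qed.
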